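(* Let $\gamma=(\gamma_s)_{s=1}^\infty$ be a sequence with $0<\gamma_s\le \frac{1}{32}$ for all $s$ and $\sum_{s=1}^\infty \gamma_s<\infty$. Let $K(\gamma)$ be the associated Cantor-type set and $h$ the associated dimension function, and suppose that $K(\gamma)$ is non-polar (i.e. has positive logarithmic capacity). Let $\mu_{K(\gamma)}$ be the equilibrium measure of $K(\gamma)$ and let $\Lambda_h$ denote the $h$-Hausdorff measure restricted to $K(\gamma)$. Then $\mu_{K(\gamma)}$ and $\Lambda_h$ are both regular in the Stahl-Totik sense.
   Context: Notation: $\mathbb{N}=\{1,2,\dots\}$, $\log$ is the natural logarithm, $\mathrm{Cap}(\cdot)$ is the logarithmic capacity. The equilibrium measure of a non-polar compact set is taken in the sense of logarithmic potential theory in $\mathbb{C}$. Stahl-Totik regularity. Let $\mu$ be a finite Borel measure on $\mathbb{C}$ with compact (infinite) support $S_\mu$. Let $p_n(\mu;z)=a_nz^n+\dots$ be the orthonormal polynomials with respect to $\mu$ in $L^2(\mu)$, with leading coefficient $a_n>0$. The measure $\mu$ is called regular in the Stahl-Totik sense if $\lim_{n\to\infty}a_n^{-1/n}=\mathrm{Cap}(S_\mu)$. The set $K(\gamma)$. Given $\gamma=(\gamma_s)_{s=1}^\infty$ with $0<\gamma_s\le\frac1{32}$, let $r_0=1$ and $r_s=\gamma_s r_{s-1}^2$ for $s\in\mathbb{N}$. Define real polynomials by $P_2(x)=x(x-1)$ and $P_{2^{s+1}}=P_{2^s}\cdot(P_{2^s}+r_s)$ for $s\in\mathbb{N}$. For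 $s\ge 0$ let $E_s=\{x\in\mathbb{R}: P_{2^{s+1}}(x)\le 0\}$. The set $E_s$ is a disjoint union of $2^s$ closed intervals $I_{j,s}$, $1\le j\le 2^s$ (the basic intervals of level $s$), with $E_{s+1}\subset E_s$ and $\max_j |I_{j,s}|\to0$ as $s\to\infty$. Define $K(\gamma)=\bigcap_{s=0}^\infty E_s$. The dimension function $h$. Let $\delta_0=1$ and $\delta_s=\gamma_1\gamma_2\cdots\gamma_s$ for $s\in\mathbb{N}$. Define $\eta:(0,1]\to[0,\infty)$ by $\eta(\delta_s)=s$ for $s\ge 0$ and $$\eta(t)=s+\frac{\log(\delta_s/t)}{\log(\delta_s/\delta_{s+1})}\quad\text{for } \delta_{s+1}<t<\delta_s,\ s\ge 0.$$ Define $h(0)=0$, $h(t)=2^{-\eta(t)}$ for $0<t\le1$, and $h(t)=1$ for $t>1$. Hausdorff measure. For $E\subset\mathbb{C}$, $$\Lambda_h(E)=\lim_{\delta\to0}\inf\left\{\sum_j h(r_j): E\subset\bigcup_j B(z_j,r_j),\ r_j\le\delta\right\},$$ where the infimum is over countable covers and $B(z,r)$ is the open ball of center $z$ and radius $r$ in $\mathbb{C}$. *)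

(* Defs.v *)
From HB Require Import structures.
From mathcomp Require Import all_boot all_order all_algebra.
From mathcomp Require Import complex.
From mathcomp Require Import all_classical all_reals all_analysis.

Set Implicit Arguments.
Unset Strict Implicit.
Unset Printing Implicit Defensive.

Import Order.TTheory GRing.Theory Num.Theory.
Import numFieldNormedType.Exports.

Local Open Scope classical_set_scope.
Local Open Scope ring_scope.

(** The complex plane is the set of pairs of reals, with the product topology
    and the product of the Borel sigma-algebras, which is the Borel
    sigma-algebra of the plane. Complex arithmetic takes place in [R[i]]. *)
Definition plane (R : realType) := (measurableTypeR R * measurableTypeR R)%type.

Definition toC (R : realType) (z : R * R) : R[i] := Complex z.1 z.2.

(** The library's balls of [R * R] are those of the sup norm, so the Euclidean
    distance and disks are introduced here. *)
Definition dist (R : realType) (z w : R * R) : R :=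
  ComplexField.Normc.normc (toC z - toC w).

Definition disk (R : realType) (z : R * R) (r : R) : set (R * R) :=
  [set w | dist w z < r].

Definition support (R : realType) (mu : {measure set (plane R) -> \bar R}) :
    set (R * R) :=
  [set z | forall U : set (R * R), open U -> U z -> (0 < mu U)%E].

(** * Logarithmic potential theory *)

Definition log_kernel (R : realType) (z w : R * R) : \bar R :=
  if z == w then +oo%E else (ln (dist z w)^-1)%:E.

Definition log_potential (R : realType) (mu : {measure set (plane R) -> \bar R})
    (z : R * R) : \bar R :=
  (\int[mu]_w log_kernel z w)%E.

Definition log_energy (R : realType)
    (mu : {measure set (plane R) -> \bar R}) : \bar R :=
  (\int[mu]_z log_potential mu z)%E.

Definition compactly_supported_in (R : realType) (E : set (R * R))
    (mu : {measure set (plane R) -> \bar R}) : Prop :=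
  compact (support mu) /\ support mu `<=` E.

Definition min_energy (R : realType) (E : set (R * R)) : \bar R :=
  ereal_inf [set log_energy mu |
    mu in [set mu : probability (plane R) R | compactly_supported_in E mu]].

(** [expeR -oo = 0], so a set that carries no measure of finite energy has
    capacity zero. *)
Definition capacity (R : realType) (E : set (R * R)) : R :=
  fine (expeR (- min_energy E)).

Definition non_polar (R : realType) (E : set (R * R)) : Prop := 0 < capacity E.

Definition is_equilibrium_measure (R : realType) (E : set (R * R))
    (mu : probability (plane R) R) : Prop :=
  compactly_supported_in E mu /\ log_energy mu = min_energy E.

(** * Orthonormal polynomials and Stahl-Totik regularity *)

Definition inner_prod (R : realType) (mu : {measure set (plane R) -> \bar R})
    (p q : {poly R[i]}) : R[i] :=
  let pq (z : R * R) := p.[toC z] * conjc q.[toC z] in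
  Complex (\int[mu]_z complex.Re (pq z)) (\int[mu]_z complex.Im (pq z)).

(** In [R[i]], [0 < a] says that [a] is real and positive. *)
Definition orthonormal_polynomials (R : realType)
    (mu : {measure set (plane R) -> \bar R}) (p : nat -> {poly R[i]}) : Prop :=
  [/\ forall n, size (p n) = n.+1,
      forall n, 0 < lead_coef (p n)
    & forall m n, inner_prod mu (p m) (p n) = (m == n)%:R].

(** There is exactly one sequence of orthonormal polynomials for a measure with
    compact infinite support. *)
Definition stahl_totik_regular (R : realType)
    (mu : {finite_measure set (plane R) -> \bar R}) : Prop :=
  [/\ compact (support mu),
      infinite_set (support mu)
    & exists2 p : nat -> {poly R[i]}, orthonormal_polynomials mu p
      & complex.Re (lead_coef (p n)) `^ (- n%:R^-1) @[n --> \oo]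
          --> capacity (support mu)].

(** * Hausdorff measures *)

(** A sequence of radii may vanish from some point on, and [disk z 0] is empty:
    with [h 0 = 0], the sequences below account for finite covers too. *)
Definition hausdorff_content (R : realType) (h : R -> R) (A : set (R * R))
    (d : R) : \bar R :=
  ereal_inf [set s | exists (z : nat -> R * R) (r : nat -> R),
    [/\ A `<=` \bigcup_j disk (z j) (r j),
        forall j, 0 <= r j <= d
      & s = (\sum_(0 <= j <oo) (h (r j))%:E)%E]].

Definition hausdorff (R : realType) (h : R -> R) (A : set (R * R)) : \bar R :=
  lim (hausdorff_content h A d @[d --> 0^'+]).

(** * The sets K(gamma) *)

(** Only the values [gamma s] with [0 < s] are used. *)
Fixpoint rad (R : realType) (gamma : nat -> R) (s : nat) : R :=
  if s is s'.+1 then gamma s * rad gamma s' ^+ 2 else 1.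

(** [pol gamma s] is the polynomial of degree [2 ^ s.+1]. *)
Fixpoint pol (R : realType) (gamma : nat -> R) (s : nat) : {poly R} :=
  if s is s'.+1 then pol gamma s' * (pol gamma s' + (rad gamma s)%:P)
  else 'X * ('X - 1).

Definition level_set (R : realType) (gamma : nat -> R) (s : nat) : set R :=
  [set x | (pol gamma s).[x] <= 0].

Definition K (R : realType) (gamma : nat -> R) : set (R * R) :=
  [set z | (\bigcap_s level_set gamma s) z.1 /\ z.2 = 0].

(** * The dimension function *)

Definition delta (R : realType) (gamma : nat -> R) (s : nat) : R :=
  \prod_(1 <= k < s.+1) gamma k.

(** The formula for [delta s.+1 < t < delta s] gives the value [s] at
    [t = delta s], hence the half-open intervals. *)
Definition eta (R : realType) (gamma : nat -> R) (t : R) : R :=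
  let s := xget 0%N [set s | delta gamma s.+1 < t <= delta gamma s] in
  s%:R + ln (delta gamma s / t) / ln (delta gamma s / delta gamma s.+1).

Definition dim_fun (R : realType) (gamma : nat -> R) (t : R) : R :=
  if t <= 0 then 0 else if t <= 1 then 2 `^ (- eta gamma t) else 1.

(* Main.v *)
Require Import Defs.
From HB Require Import structures.
From mathcomp Require Import all_boot all_order all_algebra.
From mathcomp Require Import complex.
From mathcomp Require Import all_classical all_reals all_analysis.
From mathcomp Require Import measurable_realfun perm.
From mathcomp Require Import ring lra.
Set Implicit Arguments.
Unset Strict Implicit.
Unset Printing Implicit Defensive.
Import Order.TTheory GRing.Theory Num.Theory.
Import numFieldNormedType.Exports.
Local Open Scope classical_set_scope.
Local Open Scope ring_scope.

(** Let [V] be the sum of the series of the [ln (1 / gamma k) / 2 ^+ k], the limit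
    of [partial_robin gamma s]. The theorem holds because [V] is the Robin
    constant of K(gamma), that is, the capacity is [expR (- V)], and because the
    monic orthogonal polynomial of degree [n] has norm [expR (- n V)] up to
    factors that do not matter for [n]-th roots; the leading coefficient [a_n] is
    the inverse of that norm.

    In the coordinate [w = x - 1] the polynomials [pol gamma s] are, up to the
    factor [rad gamma s.+1], compositions of the quadratic maps
    [w * (w + 1) / gamma k] (lemma [polE]). Hence K(gamma) consists of the points
    whose orbit under these maps stays in [-1, 0], and
    [|pol gamma s| <= rad gamma s.+1 = expR (- 2 ^ s.+1 * partial_robin gamma s.+1)]
    there. Products of powers of [pol gamma s] and of ['X] are therefore monic
    polynomials of every degree that are nearly as small on K(gamma) as they
    should be ([test_poly_le]).

    These polynomials have two uses. The orthogonal polynomials have minimal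
    norm among the monic ones, so their norms are at most about [expR (- n V)].
    Inserted into a Vandermonde determinant, they also bound the product of the
    mutual distances of [n] points of K(gamma), so that every probability measure
    on K(gamma) has energy at least [V] ([energy_ge_partial_robin]).

    Conversely, if a probability measure has potential at most [V] on [0, 1],
    then by Jensen's inequality a monic polynomial of degree [n] has mean square
    at least [expR (- 2 n V)] ([mean_square_ge]). For the equilibrium measure,
    whose energy is [V], the bound on the potential is Frostman's theorem
    ([frostman_potential_le]). The Hausdorff measure is compared with the measure
    [code_measure] that gives mass [2 ^ - s] to every basic interval of level [s].
    A direct computation along the quadratic maps bounds the potential of
    [code_measure] by [V] ([code_potential_le]), which shows in particular that
    the Robin constant is [V]. As [code_measure] gives mass at most [2 * h r] to
    an interval of length [2 r], it is at most twice the Hausdorff measure, which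
    thereby inherits the lower bound for mean squares, and whose support carries a
    measure of energy [V]. The two bounds on the norms give regularity
    ([regular_of_mean_square]).

    The summability of [gamma] makes the Hausdorff measure finite: up to the
    bounded factor [expR (8 * sum of the gamma k)], the basic intervals of level
    [s] have length at most [delta gamma s] ([trapped_cover]). *)

(** * The dynamics of the Cantor set *)

(** In the coordinate [w = x - 1], one step from [pol gamma s] to
    [pol gamma s.+1] amounts to one application of this map, after division by
    the radii. *)
Definition branch_map (R : realType) (g w : R) : R := w * (w + 1) / g.

Definition inv_branch (R : realType) (g : R) (b : bool) (v : R) : R :=
  ((if b then 1 else -1) * Num.sqrt (1 + 4 * g * v) - 1) / 2.

Section one_branch.
Context {R : realType} (g : R).
Hypothesis hg : 0 < g <= 32^-1.
Implicit Types v w x y z : R.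

Let g0 : 0 < g. Proof. by case/andP: hg. Qed.
Let g1 : g <= 1/32. Proof. by case/andP: hg => _; rewrite div1r. Qed.

Let gg : 0 < g /\ g <= 1/32. Proof. by []. Qed.

Let hgv v : -1 <= v <= 0 -> - g <= g * v <= 0.
Proof.
by move=> /andP[v1 v0]; rewrite pmulr_rle0// v0 andbT -[leLHS]mulrN1 ler_pM2l.
Qed.

Lemma branch_mapE w : w * (w + 1) = g * branch_map g w.
Proof.
by rewrite /branch_map [RHS]mulrC divfK// gt_eqF. Qed.

Lemma sqrt_branch v : -1 <= v <= 0 ->
  1 - 4 * g <= Num.sqrt (1 + 4 * g * v) <= 1.
Proof.
have [gp gs] := gg.
move=> hv; have /andP[v1 v0] := hv.
have D0 : 0 <= 1 + 4 * g * v by rewrite -mulrA; have := hgv hv; lra.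
have s0 := sqrtr_ge0 (1 + 4 * g * v).
have ss := sqr_sqrtr D0.
by apply/andP; split; nra.
Qed.

Lemma inv_branchK b v : -1 <= v <= 0 -> branch_map g (inv_branch g b v) = v.
Proof.
have [gp gs] := gg.
move=> hv; have /andP[v1 v0] := hv.
have D0 : 0 <= 1 + 4 * g * v by rewrite -mulrA; have := hgv hv; lra.
have ss := sqr_sqrtr D0.
rewrite /branch_map /inv_branch; move: (Num.sqrt _) ss => t ss.
apply: (mulIf (lt0r_neq0 g0)); rewrite divfK ?lt0r_neq0//.
by case: b => /=; nra.
Qed.

Lemma inv_branch_itv b v : -1 <= v <= 0 -> -1 <= inv_branch g b v <= 0.
Proof.
have [gp gs] := gg.
move=> hv; have /andP[s0 s1] := sqrt_branch hv.
by rewrite /inv_branch; move: (Num.sqrt _) s0 s1 => t s0 s1; case: b => /=; lra.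
Qed.

Lemma inv_branch_side b v : -1 <= v <= 0 ->
  if b then -(4^-1) <= inv_branch g b v else inv_branch g b v <= - (3 / 4).
Proof.
have [gp gs] := gg.
move=> hv; have /andP[s0 s1] := sqrt_branch hv.
by rewrite /inv_branch; move: (Num.sqrt _) s0 s1 => t s0 s1; case: b => /=; lra.
Qed.

(** Both branches are graphs of square roots, so the two values of [w] with a
    given image are symmetric about [-1/2]. *)
Lemma branch_mapK w : branch_map g w <= 0 ->
  -1 <= branch_map g w -> w = inv_branch g (- 2^-1 <= w) (branch_map g w).
Proof.
have [gp gs] := gg.
move=> h0 h1; rewrite /inv_branch.
have -> : 1 + 4 * g * branch_map g w = (2 * w + 1) ^+ 2.
  by rewrite -mulrA -branch_mapE; ring.
rewrite sqrtr_sqr; case: ifPn => [hw|]; last rewrite -ltNge => hw.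
  by rewrite ger0_norm; lra.
by rewrite ltr0_norm; lra.
Qed.

(** Once an orbit has left [-1, 0], it stays positive. *)
Lemma branch_map_out w : branch_map g w <= 0 -> -1 <= w <= 0.
Proof. have [gp gs] := gg; by rewrite /branch_map pmulr_lle0 ?invr_gt0//; nra. Qed.

Let half_diff (b : bool) (t t' : R) :
  ((if b then 1 else -1) * t - 1) / 2 - ((if b then 1 else -1) * t' - 1) / 2
  = (if b then 1 else -1) * ((t - t') / 2).
Proof. by field. Qed.

(** The derivative of the quadratic map is at most [1 / g] in modulus. *)
Lemma inv_branch_expand b v v' : -1 <= v <= 0 -> -1 <= v' <= 0 ->
  g * `|v - v'| <= `|inv_branch g b v - inv_branch g b v'|.
Proof.
have [gp gs] := gg.
move=> hv hv'; have /andP[v1 v0] := hv; have /andP[v1' v0'] := hv'.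
have /andP[s0 s1] := sqrt_branch hv.
have /andP[s0' s1'] := sqrt_branch hv'.
have ss : Num.sqrt (1 + 4 * g * v) ^+ 2 = 1 + 4 * g * v.
  by rewrite sqr_sqrtr// -mulrA; have := hgv hv; lra.
have ss' : Num.sqrt (1 + 4 * g * v') ^+ 2 = 1 + 4 * g * v'.
  by rewrite sqr_sqrtr// -mulrA; have := hgv hv'; lra.
rewrite /inv_branch; move: (Num.sqrt (1 + 4 * g * v)) (Num.sqrt (1 + 4 * g * v')) s0 s1 s0' s1' ss ss'.
move=> t t' s0 s1 s0' s1' ss ss'.
rewrite half_diff.
rewrite normrM (_ : `|(if b then 1 else -1 : R)| = 1) ?mul1r; last first.
  by case: b; rewrite ?normrN1 ?normr1.
have E : g * (v - v') = (t - t') / 2 * ((t + t') / 2) by nra.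
rewrite -(gtr0_norm g0) -normrM E normrM ler_piMr// ger0_norm; nra.
Qed.

(** The inverse branches have derivative [g / sqrt (1 + 4 g v)], and the square
    root is at least [1 - 4 g]. *)
Lemma inv_branch_contract b v v' : -1 <= v <= 0 -> -1 <= v' <= 0 ->
  `|inv_branch g b v - inv_branch g b v'| <= g * expR (8 * g) * `|v - v'|.
Proof.
have [gp gs] := gg.
move=> hv hv'; have /andP[v1 v0] := hv; have /andP[v1' v0'] := hv'.
have /andP[s0 s1] := sqrt_branch hv.
have /andP[s0' s1'] := sqrt_branch hv'.
have ss : Num.sqrt (1 + 4 * g * v) ^+ 2 = 1 + 4 * g * v.
  by rewrite sqr_sqrtr// -mulrA; have := hgv hv; lra.
have ss' : Num.sqrt (1 + 4 * g * v') ^+ 2 = 1 + 4 * g * v'.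
  by rewrite sqr_sqrtr// -mulrA; have := hgv hv'; lra.
rewrite /inv_branch; move: (Num.sqrt (1 + 4 * g * v)) (Num.sqrt (1 + 4 * g * v')) s0 s1 s0' s1' ss ss'.
move=> t t' s0 s1 s0' s1' ss ss'.
rewrite half_diff.
rewrite normrM (_ : `|(if b then 1 else -1 : R)| = 1) ?mul1r; last first.
  by case: b; rewrite ?normrN1 ?normr1.
have E : g * (v - v') = (t - t') / 2 * ((t + t') / 2) by nra.
have e1 : 1 + 8 * g <= expR (8 * g) := expR_ge1Dx _.
have : `|(t - t') / 2| * ((t + t') / 2) = g * `|v - v'|.
  rewrite -[X in X * `|_|](gtr0_norm g0) -[RHS]normrM E [RHS]normrM.
  by rewrite (@ger0_norm _ ((t + t') / 2))//; lra.
move: `|_ / 2| (normr_ge0 ((t - t') / 2)) => d d0 dE.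
rewrite mulrAC -dE -mulrA ler_peMr//.
apply: le_trans (ler_pM _ _ (_ : 1 - 4 * g <= _) e1); nra.
Qed.

End one_branch.

Section orbits.
Context {R : realType} (gamma : nat -> R).
Hypothesis hgamma : forall s : nat, (1 <= s)%N -> 0 < gamma s <= 32^-1.
Implicit Types v w x y z : R.

Let hg s : 0 < gamma s.+1 <= 32^-1. Proof. exact: hgamma. Qed.

(** The map changes with time; the induction proofs below shift the starting
    level [s]. *)
Fixpoint branch_orbit (s n : nat) (w : R) : R :=
  if n is n'.+1 then branch_orbit s.+1 n' (branch_map (gamma s.+1) w) else w.

Lemma branch_orbitSr s n w :
  branch_orbit s n.+1 w = branch_map (gamma (s + n).+1) (branch_orbit s n w).
Proof.
elim: n s w => [|n IH] s w; first by rewrite addn0.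
by rewrite [LHS]IH addSnnS.
Qed.

Definition trapped (s : nat) : set R :=
  [set w | forall n, -1 <= branch_orbit s n w <= 0].

Lemma trappedS s w :
  trapped s w <-> -1 <= w <= 0 /\ trapped s.+1 (branch_map (gamma s.+1) w).
Proof.
split=> [h|[h h']].
  by split; [exact: (h 0%N) | move=> n; exact: (h n.+1)].
by case=> [|n]//=; exact: h'.
Qed.

Lemma trapped_itv s w : trapped s w -> -1 <= w <= 0.
Proof. by move=> /trappedS[]. Qed.

Lemma trapped_branchE s w : trapped s w ->
  w = inv_branch (gamma s.+1) (- 2^-1 <= w) (branch_map (gamma s.+1) w).
Proof.
move=> /trappedS[_ /trapped_itv/andP[h1 h0]].
exact: branch_mapK.
Qed.

Definition cantor_set : set R := \bigcap_s level_set gamma s.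

Lemma rad_gt0 s : 0 < Defs.rad gamma s.
Proof.
elim: s => //= s IH; rewrite mulr_gt0 ?exprn_gt0//.
by case/andP: (hg s).
Qed.

Lemma polE s x : (pol gamma s).[x] = Defs.rad gamma s.+1 * branch_orbit 0 s.+1 (x - 1).
Proof.
elim: s => [|s IH].
  have /andP[g0 _] := hg 0.
  rewrite /= hornerM hornerD hornerN hornerX hornerC /branch_map; field.
  by rewrite gt_eqF.
have -> : pol gamma s.+1 = pol gamma s * (pol gamma s + (Defs.rad gamma s.+1)%:P).
  by [].
have -> : Defs.rad gamma s.+2 = gamma s.+2 * Defs.rad gamma s.+1 ^+ 2 by [].
rewrite branch_orbitSr add0n hornerM hornerD hornerC IH /branch_map.
have /andP[g0 _] := hg s.+1.
move: (Defs.rad gamma s.+1) (branch_orbit _ _ _) => r t.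
by field; rewrite gt_eqF.
Qed.

Lemma cantor_setE x : cantor_set x <-> trapped 0 (x - 1).
Proof.
have le0 s : level_set gamma s x <-> branch_orbit 0 s.+1 (x - 1) <= 0.
  by rewrite /level_set /= polE pmulr_rle0 ?rad_gt0.
split=> [h n|h s _]; last first.
  by apply/le0; case/andP: (h s.+1).
have := h n I => /le0; rewrite branch_orbitSr => h1.
exact: (branch_map_out (hg (0 + n)) h1).
Qed.

Lemma cantor_set_itv x : cantor_set x -> 0 <= x <= 1.
Proof. by move=> /cantor_setE/trapped_itv; lra. Qed.

Lemma pol_le_rad s x : cantor_set x -> `|(pol gamma s).[x]| <= Defs.rad gamma s.+1.
Proof.
move=> /cantor_setE h; rewrite polE normrM gtr0_norm ?rad_gt0//.
rewrite -[leRHS]mulr1 ler_pM2l ?rad_gt0// ler_norml; have := h s.+1; lra.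
Qed.

Lemma pol_monic_size s : pol gamma s \is monic /\ size (pol gamma s) = (2 ^ s.+1).+1.
Proof.
elim: s => [|s [IHm IHs]].
  have m : 'X * ('X - 1) \is @monic R by rewrite monicMl ?monicX// monicXsubC.
  by split=> //=; rewrite size_monicM ?monicX// ?size_XsubC ?size_polyX// polyXsubC_eq0.
have sz2 c : size (pol gamma s + c%:P) = (2 ^ s.+1).+1.
  rewrite size_polyDl// IHs; apply: leq_ltn_trans (size_polyC_leq1 _) _.
  by rewrite ltnS expn_gt0.
have m2 c : pol gamma s + c%:P \is monic.
  rewrite monicE lead_coefDl ?(eqP IHm)// IHs.
  apply: leq_ltn_trans (size_polyC_leq1 _) _.
  by rewrite ltnS expn_gt0.
split; first by rewrite monicMl.
rewrite [pol _ _]/= size_monicM ?monic_neq0// IHs sz2 /=.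
by rewrite addnS addnn -mul2n -expnS.
Qed.

Definition ratio_prod (s n : nat) : R := \prod_(s <= k < s + n) gamma k.+1.

Lemma ratio_prodS s n : ratio_prod s n.+1 = gamma s.+1 * ratio_prod s.+1 n.
Proof. by rewrite /ratio_prod big_ltn ?addnS ?addSn// ltnS leq_addr. Qed.

Lemma ratio_prod_gt0 s n : 0 < ratio_prod s n.
Proof. by apply: prodr_gt0 => i _; case/andP: (hg i). Qed.

(** Every inverse branch contracts by its ratio up to a factor [expR (8 g)], and
    these factors multiply along the [n] steps. *)
Lemma trapped_cover n s : exists pts : seq R,
  [/\ size pts = (2 ^ n)%N, (forall p, p \in pts -> -1 <= p <= 0) &
   forall w, trapped s w -> exists2 p, p \in pts &
     `|w - p| <= ratio_prod s n * expR (8 * \sum_(s <= k < s + n) gamma k.+1)].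
Proof.
elim: n s => [|n IH] s.
  exists [:: 0]; split => //; first by move=> p; rewrite inE => /eqP ->; lra.
  move=> w /trapped_itv h; exists 0; rewrite ?mem_head//.
  rewrite /ratio_prod addn0 !big_geq// mulr0 expR0 mulr1 subr0 ler_norml; lra.
have [pts [szp hp hc]] := IH s.+1.
exists ([seq inv_branch (gamma s.+1) true p | p <- pts] ++
        [seq inv_branch (gamma s.+1) false p | p <- pts]); split.
- by rewrite size_cat !size_map szp addnn -mul2n expnS.
- move=> p; rewrite mem_cat => /orP[] /mapP[q /hp hq ->];
  exact: inv_branch_itv.
- move=> w hw; have wE := trapped_branchE hw.
  have /trappedS[_ /[dup] hf /hc[p pin hd]] := hw.
  exists (inv_branch (gamma s.+1) (- 2^-1 <= w) p).
    by rewrite mem_cat; case: (_ <= w); rewrite map_f// orbT.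
  rewrite [X in `|X - _|]wE.
  apply: le_trans (inv_branch_contract (hg s) _ (trapped_itv hf) (hp _ pin)) _.
  rewrite ratio_prodS [in leRHS]big_ltn ?addnS ?ltnS ?leq_addr//.
  rewrite mulrDr expRD -addSn.
  have /andP[g0 _] := hg s.
  by rewrite -!mulrA ler_pM2l// [leRHS]mulrCA ler_pM2l ?expR_gt0//.
Qed.

(** Two points of a trapped set that lie on one branch move apart sixteen times
    at each step, so they end on distinct branches, between which [-1/2]
    escapes. *)
Lemma trapped_escape_between n s x y : trapped s x -> trapped s y -> x < y ->
  (1 < 16 ^+ n * (y - x)) -> exists2 z, x < z < y & ~ trapped s z.
Proof.
elim: n s x y => [|n IH] s x y hx hy xy.
  by have := trapped_itv hx; have := trapped_itv hy; rewrite expr0; lra.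
move=> hn.
have /trappedS[hx1 hx2] := hx; have /trappedS[hy1 hy2] := hy.
have xE := trapped_branchE hx; have yE := trapped_branchE hy.
have sx := inv_branch_side (hg s) (- 2^-1 <= x) (trapped_itv hx2).
have sy := inv_branch_side (hg s) (- 2^-1 <= y) (trapped_itv hy2).
rewrite -xE in sx; rewrite -yE in sy.
have /andP[g0 g1] := hg s.
have [xm|xm] := boolP (- 2^-1 <= x); last first.
  rewrite -ltNge in xm; have [ym|ym] := boolP (- 2^-1 <= y).
    exists (- 2^-1); first by rewrite ym in sy; rewrite leNgt xm in sx; lra.
    move=> /trappedS[_ /trapped_itv/andP[h _]].
    suff : branch_map (gamma s.+1) (- 2^-1) < -1 by rewrite ltNge h.
    by rewrite /branch_map ltr_pdivrMr//; lra.
  rewrite (negbTE ym) in sy yE; rewrite -ltNge in ym.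
  rewrite leNgt xm /= in sx xE.
  have E : (y - x) * (- (x + y + 1)) = gamma s.+1 *
      (branch_map (gamma s.+1) x - branch_map (gamma s.+1) y).
    by rewrite mulrBr -!branch_mapE//; ring.
  have fxy : branch_map (gamma s.+1) y < branch_map (gamma s.+1) x.
    by rewrite -subr_gt0 -(pmulr_rgt0 _ g0) -E; nra.
  have [] := IH _ _ _ hy2 hx2 fxy.
    apply: lt_le_trans hn _; rewrite exprSr -mulrA ler_pM2l ?exprn_gt0//.
    by nra.
  move=> z zxy zn; have hz : -1 <= z <= 0.
    by have := trapped_itv hx2; have := trapped_itv hy2; lra.
  exists (inv_branch (gamma s.+1) false z); last first.
    by move=> /trappedS[_]; rewrite inv_branchK.
  have side := inv_branch_side (hg s) false hz.
  have zE := inv_branchK (hg s) false hz.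
  move: (inv_branch _ _ z) side zE => u side zE.
  have E1 a : (u - a) * (u + a + 1) = gamma s.+1 *
      (z - branch_map (gamma s.+1) a).
    by rewrite -zE mulrBr -!branch_mapE//; ring.
  have := E1 x; have := E1 y => {}E1 E2.
  have p1 : gamma s.+1 * (z - branch_map (gamma s.+1) y) > 0 by apply: mulr_gt0; lra.
  have p2 : gamma s.+1 * (branch_map (gamma s.+1) x - z) > 0 by apply: mulr_gt0; lra.
  by apply/andP; split; nra.
have ym : - 2^-1 <= y by lra.
rewrite ym in sy yE; rewrite xm in sx xE.
have E : (y - x) * (x + y + 1) = gamma s.+1 *
    (branch_map (gamma s.+1) y - branch_map (gamma s.+1) x).
  by rewrite mulrBr -!branch_mapE//; ring.
have fxy : branch_map (gamma s.+1) x < branch_map (gamma s.+1) y.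
  by rewrite -subr_gt0 -(pmulr_rgt0 _ g0) -E; nra.
have [] := IH _ _ _ hx2 hy2 fxy.
  apply: lt_le_trans hn _; rewrite exprSr -mulrA ler_pM2l ?exprn_gt0//.
  by nra.
move=> z zxy zn; have hz : -1 <= z <= 0.
  by have := trapped_itv hx2; have := trapped_itv hy2; lra.
exists (inv_branch (gamma s.+1) true z); last first.
  by move=> /trappedS[_]; rewrite inv_branchK.
have side := inv_branch_side (hg s) true hz.
have zE := inv_branchK (hg s) true hz.
move: (inv_branch _ _ z) side zE => u side zE.
have E1 a : (u - a) * (u + a + 1) = gamma s.+1 *
    (z - branch_map (gamma s.+1) a).
  by rewrite -zE mulrBr -!branch_mapE//; ring.
have := E1 x; have := E1 y => {}E1 E2.
have p1 : gamma s.+1 * (branch_map (gamma s.+1) y - z) > 0 by apply: mulr_gt0; lra.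
have p2 : gamma s.+1 * (z - branch_map (gamma s.+1) x) > 0 by apply: mulr_gt0; lra.
by apply/andP; split; nra.
Qed.

Lemma cantor_set_gap x y : x < y -> exists2 z, x < z < y & ~ cantor_set z.
Proof.
move=> xy; pose x' := (2 * x + y) / 3; pose y' := (x + 2 * y) / 3.
have xy' : x < x' /\ x' < y' /\ y' < y by rewrite /x' /y'; lra.
have [hx|hx] := pselect (cantor_set x'); last by exists x' => //; lra.
have [hy|hy] := pselect (cantor_set y'); last by exists y' => //; lra.
have d0 : 0 < y' - x' by lra.
have [n hn] : exists n : nat, 1 < 16 ^+ n * (y' - x').
  pose n := Num.truncn (y' - x')^-1; exists n.+1.
  rewrite -ltr_pdivrMr// div1r.
  have := truncnS_gt (y' - x')^-1; rewrite -/n => /lt_le_trans; apply.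
  rewrite -natrX ler_nat; exact/ltnW/ltn_expl.
have hx' := (cantor_setE _).1 hx; have hy' := (cantor_setE _).1 hy.
have [||z zz nz] := trapped_escape_between (n := n) hx' hy'; first lra.
  by rewrite (_ : y' - 1 - (x' - 1) = y' - x')//; ring.
exists (z + 1); first lra.
by move=> /cantor_setE; rewrite addrK.
Qed.

Lemma cantor_set_closed : closed cantor_set.
Proof.
apply: closed_bigI => s _.
rewrite (_ : level_set gamma s = horner (pol gamma s) @^-1` `]-oo, 0]).
  apply: preimage_closed; last exact: itv_closed_ends_closed.
  by move=> x _; exact: continuous_horner.
apply/seteqP; split=> x; rewrite /level_set/= in_itv/=//.
Qed.

(** * Polynomials that are small on the Cantor set *)

(** The partial sums of the Robin constant of K(gamma), by [radE] the numbers
    [- ln (rad gamma s) / 2 ^+ s]. *)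
Definition partial_robin (s : nat) : R :=
  \sum_(1 <= k < s.+1) ln (gamma k)^-1 / 2 ^+ k.

Lemma ln_gammaV_ge s : ln 32 <= ln (gamma s.+1)^-1.
Proof.
have /andP[g0 g1] := hg s.
rewrite ler_ln ?posrE ?invr_gt0// -[leLHS]invrK lef_pV2 ?posrE ?invr_gt0//.
Qed.

Lemma ln_gammaV_ge0 s : 0 <= ln (gamma s.+1)^-1.
Proof. by apply: le_trans (ln_gammaV_ge s); rewrite ln_ge0//; lra. Qed.

Lemma partial_robin_ge0 s : 0 <= partial_robin s.
Proof.
rewrite /partial_robin big_add1 /=; apply: sumr_ge0 => k _.
by rewrite divr_ge0 ?exprn_ge0// ln_gammaV_ge0.
Qed.

Lemma radE s : Defs.rad gamma s = expR (- (2 ^ s)%:R * partial_robin s).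
Proof.
elim: s => [|s IH].
  by rewrite /partial_robin big_geq// mulr0 expR0.
rewrite [LHS]/= IH [partial_robin s.+1]/partial_robin big_nat_recr//=.
rewrite -/(partial_robin s); have /andP[g0 _] := hg s.
rewrite mulrDr expRD mulrC -expRM_natl; congr (expR _ * _).
  by rewrite expnS natrM; ring.
rewrite lnV ?posrE// natrX; set X := 2 ^+ s.+1.
have X0 : X != 0 by rewrite expf_neq0.
rewrite (_ : - X * _ = ln (gamma s.+1)); last by field.
by rewrite lnK ?posrE.
Qed.

(** Powers of the polynomials [pol] completed by powers of ['X] : monic
    polynomials of every degree whose maximum on the Cantor set decays
    exponentially in the degree, for fixed [s], with rate [partial_robin s.+1]. *)
Definition test_poly (s k : nat) : {poly R} :=
  pol gamma s ^+ (k %/ 2 ^ s.+1) * 'X ^+ (k %% 2 ^ s.+1).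

Lemma test_poly_monic_size s k :
  test_poly s k \is monic /\ size (test_poly s k) = k.+1.
Proof.
have [m sz] := pol_monic_size s.
have m1 : pol gamma s ^+ (k %/ 2 ^ s.+1) \is monic by exact: monic_exp.
split; first by rewrite monicMl// monicXn.
rewrite size_monicM ?size_polyXn ?monic_neq0 ?monicXn// addnS /=.
rewrite (_ : size (pol _ _ ^+ _) = ((k %/ 2 ^ s.+1) * 2 ^ s.+1).+1).
  by rewrite addSn -divn_eq.
have := size_exp (pol gamma s) (k %/ 2 ^ s.+1); rewrite sz [_.+1.-1]/= mulnC.
by move=> <-; rewrite prednK// size_poly_gt0 monic_neq0.
Qed.

Lemma test_poly_le s k x : cantor_set x ->
  `|(test_poly s k).[x]| <=
    expR ((2 ^ s.+1)%:R * partial_robin s.+1 - k%:R * partial_robin s.+1).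
Proof.
move=> hx; have /andP[x0 x1] := cantor_set_itv hx.
rewrite /test_poly hornerM !horner_exp hornerX normrM !normrX.
set N := (2 ^ s.+1)%N; set V := partial_robin _.
apply: (@le_trans _ _ (Defs.rad gamma s.+1 ^+ (k %/ N) * 1)).
  apply: ler_pM; rewrite ?exprn_ge0//.
    by apply: lerXn2r; rewrite ?nnegrE ?normr_ge0 ?(ltW (rad_gt0 _))// pol_le_rad.
  by rewrite exprn_ile1// ger0_norm.
rewrite mulr1 radE -expRM_natl ler_expR -/N -/V.
rewrite -mulrBl !mulrA -subr_ge0 -mulrBl.
apply: mulr_ge0; last exact: partial_robin_ge0.
rewrite mulrN -natrM mulnC.
have : (k <= k %/ N * N + N)%N.
  by rewrite {1}(divn_eq k N) leq_add2l ltnW// ltn_mod expn_gt0.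
by rewrite -(ler_nat R) natrD; lra.
Qed.

End orbits.

(** * The logarithmic kernel of the line *)

(** For points at distance at most [1] this is the usual kernel [- ln |x - y|]; the
    maximum makes it nonnegative everywhere, so that its integrals are always
    meaningful and can be exchanged. *)
Definition logker (R : realType) (x y : R) : \bar R :=
  if x == y then +oo%E else (Num.max 0 (- ln `|x - y|))%:E.

Section kernel.
Context {R : realType}.
Implicit Types x y : R.

Lemma logker_ge0 x y : (0 <= logker x y)%E.
Proof. by rewrite /logker; case: ifP => // _; rewrite lee_fin le_max lexx. Qed.

Lemma logkerC x y : logker x y = logker y x.
Proof. by rewrite /logker eq_sym distrC. Qed.

Lemma measurable_logker_comp d (T : measurableType d) (f g : T -> R) :
  measurable_fun setT f -> measurable_fun setT g ->
  measurable_fun setT (fun t => logker (f t) (g t)).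
Proof.
move=> mf mg; apply: measurable_fun_ifT => //; first exact: measurable_fun_eqr.
apply/measurable_EFinP; apply: measurable_maxr => //; apply: measurableT_comp => //.
apply: measurableT_comp; first exact: measurable_ln.
by apply: measurableT_comp => //; exact: measurable_funB.
Qed.

Lemma logker_ge_ln x y : ((- ln `|x - y|)%:E <= logker x y)%E.
Proof. by rewrite /logker; case: ifP => _; rewrite ?leey// lee_fin le_max lexx orbT. Qed.

Lemma logker_lnE x y : x != y -> `|x - y| <= 1 -> logker x y = (- ln `|x - y|)%:E.
Proof.
move=> /negbTE xy h; rewrite /logker xy; congr _%:E; apply/max_idPr.
by rewrite oppr_ge0 ln_le0.
Qed.

End kernel.

Lemma integral_probability_cst d (T : measurableType d) (R : realType)
  (P : probability T R) (c : R) : (\int[P]__ c%:E = c%:E)%E.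
Proof.
rewrite (_ : (fun=> c%:E) = cst c%:E)// integral_cst//.
by rewrite [X in (_ * X)%E](_ : _ = 1%E) ?mule1//; exact: probability_setT.
Qed.

(** * Energy is at least the Robin constant *)

Section averaging.
Context d (T : measurableType d) {R : realType} (P : {measure set T -> \bar R}).
Variable f : T -> R.
Hypotheses (mf : measurable_fun setT f) (f0 : forall t, 0 <= f t).
Hypothesis f1 : (\int[P]_t (f t)%:E = 1)%E.

Lemma exists_le_average (g : T -> \bar R) (c : R) :
  measurable_fun setT g -> (forall t, 0 <= g t)%E -> 0 <= c ->
  (\int[P]_t (g t * (f t)%:E) <= c%:E)%E -> exists t, (g t <= (c + 1)%:E)%E.
Proof.
move=> mg g0 c0 h; apply: contrapT => /forallNP hn.
have : ((c + 1)%:E <= \int[P]_t (g t * (f t)%:E))%E.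
  rewrite -[leLHS]mule1 -f1 -ge0_integralZl//; first last.
  - by rewrite lee_fin addr_ge0.
  - by move=> x _; rewrite lee_fin.
  - exact/measurable_EFinP.
  apply: ge0_le_integral => //.
  - by move=> x _; rewrite mule_ge0// lee_fin ?addr_ge0.
  - by apply: emeasurable_funM => //; exact/measurable_EFinP.
  - by apply: emeasurable_funM => //; exact/measurable_EFinP.
  - move=> t _; apply: lee_wpmul2r; first by rewrite lee_fin.
    by rewrite leNgt; apply/negP => /ltW; exact: hn.
by move=> /le_trans /(_ h); rewrite lee_fin; lra.
Qed.

End averaging.

Section greedy.
Context d (T : measurableType d) {R : realType} (P : probability T R).
Variables (X : T -> R) (f : T -> R) (e : R).
Hypothesis mX : measurable_fun setT X.
Hypotheses (mf : measurable_fun setT f) (f0 : forall t, 0 <= f t).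
Hypothesis f1 : (\int[P]_t (f t)%:E = 1)%E.

(** The potential of the law of [X] weighted by the density [f]. *)
Definition wpot (y : R) : \bar R := (\int[P]_t (logker y (X t) * (f t)%:E))%E.

Hypothesis energyE : (\int[P]_t (wpot (X t) * (f t)%:E) = e%:E)%E.

Lemma wpot_ge0 y : (0 <= wpot y)%E.
Proof. by apply: integral_ge0 => t _; rewrite mule_ge0 ?logker_ge0// lee_fin. Qed.

Lemma measurable_wpot : measurable_fun setT (fun t => wpot (X t)).
Proof.
pose F (p : T * T) : \bar R := (logker (X p.1) (X p.2) * (f p.2)%:E)%E.
apply: (measurable_fun_fubini_tonelli_F (m2 := P) F) => //.
  apply: emeasurable_funM.
    by apply: measurable_logker_comp; apply: measurableT_comp.
  by apply/measurable_EFinP; apply: measurableT_comp.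
by move=> x; rewrite mule_ge0 ?logker_ge0// lee_fin.
Qed.

Let e_ge0 : 0 <= e.
Proof.
rewrite -lee_fin -energyE; apply: integral_ge0 => t _.
by rewrite mule_ge0 ?wpot_ge0// lee_fin.
Qed.

(** Choosing the points one after the other, each no worse than average, keeps
    the conditional expectation of the discrete energy of [m + r] points
    bounded, up to [1] per point for strictness. *)
Lemma greedy_points m r : exists x : nat -> T,
  (\sum_(j < m) \sum_(i < j) logker (X (x i)) (X (x j))
     + r%:R%:E * \sum_(j < m) wpot (X (x j))
   <= (('C(m + r, 2)%:R - 'C(r, 2)%:R) * e + m%:R)%:E)%E.
Proof.
elim: m r => [|m IH] r.
  have [t _] : exists t : T, (0 <= 1 :> \bar R)%E.
    have [t _] := @exists_le_average _ T R P f mf f0 f1 (cst 0%E) 0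
      (measurable_cst _) (fun _ => lexx _) (lexx _)
      (eq_ind_r (fun z => (z <= _)%E) (lexx _)
        (eq_trans (eq_integral _ _ (fun t _ => mul0e _)) (integral0 _ _))).
    by exists t.
  by exists (fun=> t); rewrite !big_ord0 mule0 adde0 add0n subrr mul0r addr0.
have [x hx] := IH r.+1.
set A := (\sum_(j < m) _)%E in hx; set B := (\sum_(j < m) wpot _)%E in hx.
set c := (_ + m%:R) in hx.
have A0 : (0 <= A)%E by apply: sume_ge0 => i _; apply: sume_ge0 => j _; exact: logker_ge0.
have B0 : (0 <= B)%E by apply: sume_ge0 => i _; exact: wpot_ge0.
have Bfin : B \is a fin_num.
  have : (r.+1%:R%:E * B <= c%:E)%E.
    by apply: le_trans hx; rewrite leeDr.
  rewrite ge0_fin_numE// => h; rewrite ltey; apply/negP => /eqP BE; move: h.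
  by rewrite BE gt0_muley ?lte_fin ?ltr0n// leye_eq.
have Afin : A \is a fin_num.
  rewrite ge0_fin_numE//; apply: le_lt_trans (ltry c); apply: le_trans hx.
  by rewrite leeDl// mule_ge0// lee_fin.
pose g t : \bar R := (\sum_(i < m) logker (X (x i)) (X t) + r%:R%:E * wpot (X t))%E.
have mg1 : measurable_fun setT (fun t => \sum_(i < m) logker (X (x i)) (X t))%E.
  by apply: emeasurable_sum => i; exact: measurable_logker_comp.
have mg2 : measurable_fun setT (fun t => r%:R%:E * wpot (X t))%E.
  by apply: emeasurable_funM => //; exact: measurable_wpot.
have g10 t : (0 <= \sum_(i < m) logker (X (x i)) (X t))%E.
  by apply: sume_ge0 => i _; exact: logker_ge0.
have g20 t : (0 <= r%:R%:E * wpot (X t))%E.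
  by rewrite mule_ge0 ?wpot_ge0// lee_fin.
have mfE : measurable_fun setT (fun t => (f t)%:E) by exact/measurable_EFinP.
have gE : (\int[P]_t (g t * (f t)%:E) = B + (r%:R * e)%:E)%E.
  under eq_integral => t _ do rewrite /g ge0_muleDl//.
  rewrite ge0_integralD//; first last.
  - exact: emeasurable_funM.
  - by move=> t _; rewrite mule_ge0// lee_fin.
  - exact: emeasurable_funM.
  - by move=> t _; rewrite mule_ge0// lee_fin.
  congr (_ + _)%E.
    rewrite (eq_integral
        (fun t => \sum_(i < m) (logker (X (x i)) (X t) * (f t)%:E)))%E; last first.
      by move=> t _; rewrite ge0_sume_distrl// => i _; exact: logker_ge0.
    rewrite ge0_integral_sum//; first last.
    - by move=> i t _; rewrite mule_ge0 ?logker_ge0// lee_fin.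
    - by move=> i; apply: emeasurable_funM => //; exact: measurable_logker_comp.
  under eq_integral => t _ do rewrite -muleA.
  rewrite ge0_integralZl//; first by rewrite energyE EFinM.
  - by apply: emeasurable_funM => //; exact: measurable_wpot.
  - by move=> t _; rewrite mule_ge0 ?wpot_ge0// lee_fin.
have [] := @exists_le_average _ T R P f mf f0 f1 g (fine B + r%:R * e).
- exact: emeasurable_funD.
- by move=> t; rewrite adde_ge0.
- by rewrite addr_ge0 ?fine_ge0// mulr_ge0.
- by rewrite gE EFinD fineK.
move=> t ht; exists (fun i => if i == m then t else x i).
rewrite !big_ord_recr /= eqxx.
under eq_bigr => j _ do rewrite ltn_eqF//.
under [X in (_ + X + _)%E]eq_bigr => j _ do rewrite ltn_eqF//.
under [X in (_ + _ * (X + _))%E]eq_bigr => j _ do rewrite ltn_eqF//.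
rewrite (eq_bigr (fun j : 'I_m => \sum_(i < j) logker (X (x i)) (X (x j)))%E); last first.
  by move=> j _; apply: eq_bigr => i _; rewrite ltn_eqF// (ltn_trans (ltn_ord i)).
rewrite -/A -/B ge0_muleDr ?wpot_ge0// addeACA -[in X in (_ + X)%E]/(g t).
rewrite addeA addeAC [leLHS]addeC addeCA [(_ + _ + _)%E]addeC.
apply: le_trans (_ : (fine B + r%:R * e + 1)%:E + (A + r%:R%:E * B) <= _)%E.
  by apply: leeD2r.
move: hx; rewrite -(fineK Afin) -(fineK Bfin) -!EFinM -!EFinD !lee_fin /c.
have -> : 'C(r.+1, 2)%:R = 'C(r, 2)%:R + r%:R :> R by rewrite binS bin1 natrD.
by rewrite addnS addSn -!natr1 => hx; lra.
Qed.

End greedy.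

(** * Vandermonde determinants *)

Section vandermonde.
Context {R : realType}.

(** For monic polynomials [q k] of degree [k] the determinant of the values
    [q k (x i)] is the Vandermonde determinant, whose Leibniz expansion has [n!]
    terms. *)
Lemma prod_diff_le n (x : nat -> R) (q : nat -> {poly R}) (M : nat -> R) :
  (forall k, q k \is monic /\ size (q k) = k.+1) ->
  (forall k i, (i < n)%N -> `|(q k).[x i]| <= M k) ->
  \prod_(j < n) \prod_(i < j) `|x j - x i| <= n`!%:R * \prod_(k < n) M k.
Proof.
move=> hq hM.
pose a : 'rV[R]_n := \row_(i < n) x i.
pose C : 'M[R]_n := \matrix_(k < n, l < n) (q k)`_l.
pose Q : 'M[R]_n := \matrix_(k < n, i < n) (q k).[x i].
have QE : Q = C *m Vandermonde n a.
  apply/matrixP => k i; rewrite !mxE (@horner_coef_wide _ n); last first.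
    by have [_ ->] := hq k.
  by apply: eq_bigr => l _; rewrite !mxE.
have detC : \det C = 1.
  rewrite det_trig; last first.
    apply/is_trig_mxP => k l kl; rewrite mxE nth_default//.
    by have [_ ->] := hq k.
  rewrite big1// => k _; rewrite mxE; have [/monicP <- sz] := hq k.
  by rewrite lead_coefE sz.
have detQ : \det Q = \det (Vandermonde n a) by rewrite QE det_mulmx detC mul1r.
rewrite (_ : \prod_(j < n) _ = `|\det Q|); last first.
  rewrite detQ det_Vandermonde normr_prod.
  under [RHS]eq_bigr => i _ do rewrite normr_prod.
  rewrite (exchange_big_dep xpredT)//=; apply: eq_bigr => j _.
  rewrite -(big_mkord xpredT (fun i => `|x j - x i|)).
  rewrite (big_nat_widen 0 j n)//; last by rewrite ltnW.
  rewrite big_mkord; apply: eq_bigr => i _; by rewrite !mxE.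
apply: (@le_trans _ _ (\sum_(s : 'S_n) \prod_(k < n) M k)).
  apply: le_trans (ler_norm_sum _ _ _) _; apply: ler_sum => s _.
  rewrite normrM normrX normrN1 expr1n mul1r normr_prod.
  by apply: ler_prod => k _; rewrite normr_ge0 mxE hM.
by rewrite sumr_const card_Sn mulr_natl.
Qed.

Lemma prod_dist_ge n (x : nat -> R) (c : R) :
  (\sum_(j < n) \sum_(i < j) logker (x i) (x j) <= c%:E)%E ->
  expR (- c) <= \prod_(j < n) \prod_(i < j) `|x j - x i|.
Proof.
move=> h.
have fin1 (j : 'I_n) : (\sum_(i < j) logker (x i) (x j) < +oo)%E.
  apply: le_lt_trans (ltry c); apply: le_trans h.
  by rewrite (bigD1 j)//= leeDl//; apply: sume_ge0 => ? _; apply: sume_ge0 => ? _;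
    exact: logker_ge0.
have fin2 (j : 'I_n) (i : 'I_j) : x i != x j.
  apply/eqP => E; have := fin1 j; rewrite (bigD1 i)//=.
  rewrite (_ : logker (x i) (x j) = +oo%E); last by rewrite /logker E eqxx.
  rewrite addye ?ltxx// gt_eqF//; apply: (@lt_le_trans _ _ 0%E); first exact: ltNy0.
  by apply: sume_ge0 => k _; exact: logker_ge0.
have E : \prod_(j < n) \prod_(i < j) `|x j - x i| =
    expR (- \sum_(j < n) \sum_(i < j) - ln `|x i - x j|).
  rewrite -sumrN expR_sum; apply: eq_bigr => j _.
  rewrite -sumrN expR_sum; apply: eq_bigr => i _.
  rewrite opprK lnK; first exact: distrC.
  by rewrite posrE normr_gt0 subr_eq0; exact: fin2.
rewrite E ler_expR lerN2 -lee_fin; apply: le_trans h.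
rewrite -sumEFin; apply: lee_sum => j _; rewrite -sumEFin; apply: lee_sum => i _.
exact: logker_ge_ln.
Qed.

Lemma ln_fact_le n : ln n`!%:R <= n%:R * ln n%:R :> R.
Proof.
case: n => [|n]; first by rewrite fact0 ln1 mul0r.
rewrite mulr_natl -lnXn ?ltr0n// ler_ln ?posrE ?exprn_gt0 ?ltr0n ?fact_gt0//.
rewrite -natrX ler_nat; elim: n => // n IH.
rewrite factS expnS leq_mul//; apply: leq_trans IH _.
by rewrite leq_exp2r.
Qed.

End vandermonde.

Section energy_bound.
Context {R : realType} (gamma : nat -> R).
Hypothesis hgamma : forall s : nat, (1 <= s)%N -> 0 < gamma s <= 32^-1.
Context d (T : measurableType d) (P : probability T R).
Variables (X : T -> R) (f : T -> R).
Hypothesis mX : measurable_fun setT X.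
Hypothesis hX : forall t, cantor_set gamma (X t).
Hypotheses (mf : measurable_fun setT f) (f0 : forall t, 0 <= f t).
Hypothesis f1 : (\int[P]_t (f t)%:E = 1)%E.

(** Points picked at random have, for a good choice, a product of mutual distances
    of at least [expR (- n ^ 2 e / 2 - n)], where [e] is the energy. By Vandermonde
    and the test polynomials the product is at most
    [n! * expR (- n ^ 2 V / 2 + O(n))], where [V] is the partial sum for a fixed
    [s]. Large [n] give [V <= e]. *)
Theorem energy_ge_partial_robin s :
  ((partial_robin gamma s.+1)%:E <=
    \int[P]_t (wpot P X f (X t) * (f t)%:E))%E.
Proof.
set V := partial_robin _ _.
have E0 : (0 <= \int[P]_t (wpot P X f (X t) * (f t)%:E))%E.
  by apply: integral_ge0 => t _; rewrite mule_ge0 ?wpot_ge0// lee_fin.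
case EE : (\int[P]_t _)%E E0 => [e| |] // e0; last by rewrite leey.
rewrite lee_fin leNgt; apply/negP => eV.
set N : R := (2 ^ s.+1)%:R.
have key n : (0 < n)%N ->
    n%:R * (n%:R - 1) / 2 * (V - e) <= n%:R * (1 + N * V + ln n%:R).
  move=> n0; have [x] := greedy_points mX mf f0 f1 EE n 0.
  rewrite mul0e adde0 addn0 bin0n subr0 => /(prod_dist_ge (x := X \o x)) hx.
  have := @prod_diff_le _ n (fun i => X (x i)) (test_poly gamma s)
    (fun k => expR (N * V - k%:R * V)) (test_poly_monic_size gamma s)
    (fun k i _ => test_poly_le hgamma s k (hX _)).
  move=> /(le_trans hx).
  rewrite -expR_sum -[n`!%:R]lnK ?posrE ?ltr0n ?fact_gt0// -expRD ler_expR.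
  rewrite sumrB sumr_const card_ord -mulr_suml -natr_sum.
  rewrite -(big_mkord xpredT id) bin2_sum.
  have bE : 'C(n, 2)%:R = n%:R * (n%:R - 1) / 2 :> R.
    case: n n0 {hx x} => // n _.
    have := mul_bin_diag n.+1 1; rewrite bin1 => /(congr1 (fun k => k%:R : R)).
    rewrite [n.+1.-1]/= !natrM (_ : n.+1%:R = n%:R + 1); last by rewrite natr1.
    by move: 'C(_, _)%:R => b h; lra.
  rewrite bE; have := @ln_fact_le R n; move: (ln _) (ln n%:R) => a b.
  by rewrite -mulr_natl; lra.
set dl := V - e; have dl0 : 0 < dl by rewrite subr_gt0.
set B := 1 + N * V.
have B0 : 0 <= B.
  by rewrite addr_ge0// mulr_ge0// partial_robin_ge0.
(* With [n = m ^ 2] points, [ln m <= m] suffices to absorb the term [ln n!]. *)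
have key2 m : (0 < m)%N -> m%:R * (m%:R * dl / 2 - 2) <= B + dl / 2.
  move=> m0; have := key (m * m)%N; rewrite muln_gt0 m0 => /(_ isT).
  have m0' : 0 < m%:R :> R by rewrite ltr0n.
  rewrite -mulrA -mulrA ler_pM2l ?natrM ?mulr_gt0// lnM ?posrE//.
  have := ln_sublinear m0'; move: (ln _) => l.
  by rewrite -/dl -/B; nra.
pose m := (Num.truncn (6 / dl) + Num.truncn (B + dl / 2)).+1.
have := key2 m isT.
have m1 : 6 / dl < m%:R.
  apply: lt_le_trans (truncnS_gt _) _; rewrite ler_nat ltnS leq_addr//.
have m2 : B + dl / 2 < m%:R.
  apply: lt_le_trans (truncnS_gt _) _; rewrite ler_nat ltnS leq_addl//.
rewrite ltr_pdivrMr// in m1.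
apply/negP; rewrite -ltNge; apply: lt_le_trans m2 _.
by rewrite ler_peMr ?ler0n//; lra.
Qed.

End energy_bound.
(** * The truncated kernel *)

(** The truncation at distance [expR (- M)] makes the kernel bounded by [M]. *)
Definition tker (R : realType) (M x y : R) : R :=
  Num.max 0 (- ln (Num.max (expR (- M)) `|x - y|)).

Section truncation.
Context {R : realType}.
Implicit Types x y z M : R.

Let mpos M x y : 0 < Num.max (expR (- M)) `|x - y|.
Proof. by rewrite lt_max expR_gt0. Qed.

Lemma tker_ge0 M x y : 0 <= tker M x y.
Proof. by rewrite /tker le_max lexx. Qed.

Lemma tker_le M x y : 0 <= M -> tker M x y <= M.
Proof.
move=> M0; rewrite /tker ge_max M0/= lerNl.
by rewrite -[leLHS]expRK ler_ln ?posrE ?expR_gt0// le_max lexx.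
Qed.

Lemma tker_le_logker M x y : ((tker M x y)%:E <= logker x y)%E.
Proof.
rewrite /logker; case: eqVneq => [_|xy]; first by rewrite leey.
rewrite lee_fin /tker ge_max le_max lexx /= le_max lerN2 ler_ln ?posrE//.
  by rewrite le_max lexx !orbT.
by rewrite normr_gt0 subr_eq0.
Qed.

Lemma tker_homo M M' x y : M <= M' -> tker M x y <= tker M' x y.
Proof.
move=> h; rewrite /tker ge_max le_max lexx /= le_max lerN2 ler_ln ?posrE//.
by rewrite ge_max !le_max ler_expR lerN2 h lexx orbT orbT.
Qed.

Lemma tker_anti M x y z : `|x - z| <= `|y - z| -> tker M y z <= tker M x z.
Proof.
move=> h; rewrite /tker ge_max le_max lexx /= le_max lerN2 ler_ln ?posrE//.
by rewrite ge_max !le_max lexx h !orbT.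
Qed.

Lemma measurable_tker_comp d (T : measurableType d) M (f g : T -> R) :
  measurable_fun setT f -> measurable_fun setT g ->
  measurable_fun setT (fun t => tker M (f t) (g t)).
Proof.
move=> mf mg; apply: measurable_maxr => //; apply: measurableT_comp => //.
apply: measurableT_comp; first exact: measurable_ln.
apply: measurable_maxr => //.
by apply: measurableT_comp => //; exact: measurable_funB.
Qed.

(** The truncated kernel is Lipschitz, because [ln] is so away from [0]. *)
Lemma tker_lipschitz M x y z :
  tker M x z <= tker M y z + expR M * `|x - y|.
Proof.
rewrite {1}/tker ge_max addr_ge0 ?tker_ge0 ?mulr_ge0 ?expR_ge0//=.
apply: le_trans (_ : - ln (Num.max (expR (- M)) `|y - z|) + expR M * `|x - y| <= _);
  last by rewrite lerD2r /tker le_max lexx orbT.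
set a := Num.max _ `|x - z|; set b := Num.max _ `|y - z|.
have a0 : 0 < a := mpos _ _ _; have b0 : 0 < b := mpos _ _ _.
have ae : expR (- M) <= a by rewrite le_max lexx.
have ba : b <= a + `|x - y|.
  rewrite ge_max (le_trans ae) ?lerDl//=.
  have : `|x - z| <= a by rewrite le_max lexx orbT.
  by have := ler_distD x y z; rewrite (distrC y x); lra.
suff : ln b - ln a <= expR M * `|x - y| by lra.
rewrite -ln_div ?posrE//.
have h : ln (b / a) <= b / a - 1.
  have := expR_ge1Dx (ln (b / a)); rewrite lnK ?posrE ?divr_gt0//; lra.
apply: le_trans h _; rewrite lerBlDr ler_pdivrMr// mulrDl mul1r mulrAC.
rewrite addrC; apply: le_trans ba _; rewrite lerD2l ler_peMl//.
rewrite -[leLHS](expRxMexpNx_1 M) ler_pM2l ?expR_gt0//.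
Qed.

(** Monotone convergence lets the truncation tend to the kernel. *)
Lemma logker_le_lim d (T : measurableType d) (P : {measure set T -> \bar R})
    (X : T -> R) y (c : \bar R) : measurable_fun setT X ->
  (forall n : nat, \int[P]_t (tker n%:R y (X t))%:E <= c)%E ->
  (\int[P]_t logker y (X t) <= c)%E.
Proof.
move=> mX h.
have lE x : logker y x = limn (fun n : nat => (tker n%:R y x)%:E).
  apply/esym/cvg_lim => //; rewrite /logker; case: eqVneq => [->|xy].
    apply/cvgeyPge => A; near=> n; rewrite lee_fin /tker subrr normr0.
    rewrite le_max [Num.max _ 0]max_l ?expR_ge0// expRK opprK; apply/orP; right.
    by near: n; exact: nbhs_infty_ger.
  apply: cvg_near_cst; near=> n; congr _%:E; rewrite /tker.
  have d0 : 0 < `|y - x| by rewrite normr_gt0 subr_eq0.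
  congr (Num.max _ (- ln _)); apply/max_idPr.
  rewrite -[leRHS]lnK ?posrE// ler_expR lerNl.
  by near: n; exact: nbhs_infty_ger.
under eq_integral => t _ do rewrite lE.
rewrite monotone_convergence//.
- apply: lime_le; last by near=> n.
  apply: ereal_nondecreasing_is_cvgn => n m nm; apply: ge0_le_integral => //.
  + by move=> t _; rewrite lee_fin tker_ge0.
  + by apply/measurable_EFinP; exact: measurable_tker_comp.
  + by apply/measurable_EFinP; exact: measurable_tker_comp.
  + by move=> t _; rewrite lee_fin tker_homo// ler_nat.
- by move=> n; apply/measurable_EFinP; exact: measurable_tker_comp.
- by move=> n t _; rewrite lee_fin tker_ge0.
- by move=> t _ n m nm; rewrite lee_fin tker_homo// ler_nat.
Unshelve. all: by end_near.
Qed.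

End truncation.

(** * Polynomials are not small in mean square where the potential is bounded *)

Section roots.
Context {R : realType}.

(** Moving the roots of a monic polynomial to the real line and then into
    [0, 1] only decreases its modulus on that interval. *)
Lemma real_rooted_minorant (q : {poly R}) n : q \is monic -> size q = n.+1 ->
  exists ts : seq R, [/\ size ts = n, (forall t, t \in ts -> 0 <= t <= 1) &
    forall x, 0 <= x <= 1 -> \prod_(t <- ts) `|x - t| <= `|q.[x]| ].
Proof.
move=> mq sq; pose Q : {poly R[i]} := map_poly (real_complex R) q.
have [r QE] := closed_field_poly_normal Q.
have lQ : lead_coef Q = 1 by rewrite lead_coef_map (monicP mq) rmorph1.
rewrite lQ scale1r in QE.
pose cl (z : R[i]) : R := Num.max 0 (Num.min 1 (complex.Re z)).
exists [seq cl z | z <- r]; split.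
- have : size Q = n.+1 by rewrite size_map_poly.
  by rewrite size_map QE size_prod_XsubC => -[].
- move=> t /mapP[z _ ->]; rewrite /cl le_max lexx ge_max ler01 /=.
  by rewrite ge_min lexx.
move=> x /andP[x0 x1]; rewrite big_map.
have : Q.[x%:C%C] = (q.[x])%:C%C by rewrite horner_map.
rewrite QE horner_prod => /(congr1 (@ComplexField.Normc.normc R)).
rewrite [X in _ = X]/= expr0n addr0 sqrtr_sqr => <-.
elim: r {QE} => [|z r IH].
  by rewrite !big_nil /= expr0n expr1n addr0 sqrtr1.
rewrite !big_cons ComplexField.Normc.normcM; apply: ler_pM => //.
- by apply: prodr_ge0.
apply: (@le_trans _ _ `|x - complex.Re z|).
  rewrite /cl; case: (leP 1 (complex.Re z)) => h1.
    by rewrite max_r// !ler0_norm; lra.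
  case: (leP 0 (complex.Re z)) => h2 //.
  by rewrite !ger0_norm; lra.
rewrite hornerXsubC; case: z => a b /=.
by rewrite -sqrtr_sqr ler_sqrt ?lerDl ?sqr_ge0// addr_ge0 ?sqr_ge0.
Qed.

End roots.

Section mean_square.
Context d (T : measurableType d) {R : realType} (P : probability T R).
Variables (X : T -> R) (V : R).
Hypothesis mX : measurable_fun setT X.
Hypothesis hX : forall t, 0 <= X t <= 1.
Hypothesis hV : forall y : R, 0 <= y <= 1 -> (\int[P]_t logker y (X t) <= V%:E)%E.

Let V0 : 0 <= V.
Proof.
rewrite -lee_fin; apply: le_trans (hV (y := 0) _); last by rewrite lexx ler01.
by apply: integral_ge0 => t _; exact: logker_ge0.
Qed.

(** Jensen's inequality for [exp], in the form [exp (a) >= exp (m) (1 + a - m)],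
    bounds the mean square from below by the mean of the logarithm, which is
    minus a sum of values of the potential. *)
Lemma mean_square_ge (q : {poly R}) n : q \is monic -> size q = n.+1 ->
  ((expR (- (2 * n%:R * V)))%:E <= \int[P]_t ((q.[X t]) ^+ 2)%:E)%E.
Proof.
move=> mq sq; have [ts [szt ht hq]] := real_rooted_minorant mq sq.
set m := - (2 * n%:R * V).
have hm : measurable_fun setT (fun t => ((q.[X t]) ^+ 2)%:E).
  apply/measurable_EFinP; apply: measurable_funX.
  apply: (measurableT_comp (f := horner q)) => //.
  by apply: continuous_measurable_fun; exact: continuous_horner.
have mk y : measurable_fun setT (fun t => logker y (X t)).
  exact: measurable_logker_comp.
have pw t : ((expR m * (1 - m))%:E <= ((q.[X t]) ^+ 2)%:E +
    (2 * expR m)%:E * (\sum_(y <- ts) logker y (X t)))%E.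
  have c0 : (0 < 2 * expR m) by rewrite mulr_gt0// expR_gt0.
  have [tin|tnin] := boolP (X t \in ts).
    rewrite (big_rem _ tin)/= {1}/logker eqxx addye; last first.
      rewrite gt_eqF//; apply: (@lt_le_trans _ _ 0%E); first exact: ltNy0.
      by apply: sume_ge0 => y _; exact: logker_ge0.
    by rewrite gt0_muley ?lte_fin// addey// leey.
  have E : (\sum_(y <- ts) logker y (X t) =
      (- ln (\prod_(y <- ts) `|X t - y|))%:E)%E.
    have {hq szt} : forall y, y \in ts -> 0 <= y <= 1 /\ y != X t.
      by move=> y yin; split; [exact: ht|apply: contraNneq tnin => <-].
    elim: (ts) => [|y l IH] hl; first by rewrite !big_nil ln1 oppr0.
    rewrite !big_cons IH; last by move=> z zl; apply: hl; rewrite in_cons zl orbT.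
    have [yi yX] := hl y (mem_head _ _).
    rewrite logker_lnE//; last by have := hX t; rewrite ler_norml; lra.
    rewrite -EFinD lnM ?posrE; first by rewrite opprD distrC.
      by rewrite normr_gt0 subr_eq0 eq_sym.
    rewrite big_seq; apply: prodr_gt0 => z zl.
    rewrite normr_gt0 subr_eq0 eq_sym.
    by have [] := hl z; rewrite ?in_cons ?zl ?orbT.
  rewrite E -EFinM -EFinD lee_fin.
  have p0 : 0 < \prod_(y <- ts) `|X t - y|.
    rewrite big_seq; apply: prodr_gt0 => z zl; rewrite normr_gt0 subr_eq0.
    by apply: contraNneq tnin => ->.
  set p := \prod_(y <- ts) _ in p0 *.
  have q2 : p ^+ 2 <= q.[X t] ^+ 2.
    by rewrite -[leRHS]real_normK ?num_real// lerXn2r ?nnegrE ?(ltW p0) ?normr_ge0// hq.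
  apply: le_trans (_ : p ^+ 2 + 2 * expR m * - ln p <= _); last by rewrite lerD2r.
  have pE : p ^+ 2 = expR m * expR (2 * ln p - m).
    by rewrite -expRD addrC subrK expRM_natl lnK// posrE.
  rewrite pE; have := expR_ge1Dx (2 * ln p - m).
  by move=> /(ler_wpM2l (expR_ge0 m)); lra.
have : (\int[P]_t (expR m * (1 - m))%:E <= \int[P]_t (((q.[X t]) ^+ 2)%:E +
    (2 * expR m)%:E * (\sum_(y <- ts) logker y (X t))))%E.
  apply: ge0_le_integral => //.
  - move=> t _; rewrite lee_fin mulr_ge0 ?expR_ge0//.
    by rewrite /m opprK addr_ge0// !mulr_ge0.
  - apply: emeasurable_funD => //; apply: emeasurable_funM => //.
    exact: emeasurable_sum.
rewrite integral_probability_cst ge0_integralD//; first last.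
- by apply: emeasurable_funM => //; exact: emeasurable_sum.
- move=> t _; rewrite mule_ge0 ?lee_fin ?mulr_ge0 ?expR_ge0//.
  by apply: sume_ge0 => y _; exact: logker_ge0.
- by move=> t _; rewrite lee_fin sqr_ge0.
rewrite ge0_integralZl//; first last.
- by move=> t _; apply: sume_ge0 => y _; exact: logker_ge0.
- exact: emeasurable_sum.
rewrite ge0_integral_sum//; last by move=> y t _; exact: logker_ge0.
have : (\sum_(y <- ts) \int[P]_t logker y (X t) <= (n%:R * V)%:E)%E.
  rewrite -szt mulr_natl.
  elim: (ts) ht => [|y l IH] hl; first by rewrite big_nil.
  rewrite big_cons /= mulrS EFinD leeD//; first by apply/hV/hl/mem_head.
  by apply: IH => z zl; apply: hl; rewrite in_cons zl orbT.
have : (0 <= \int[P]_t (q.[X t] ^+ 2)%:E)%E.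
  by apply: integral_ge0 => t _; rewrite lee_fin sqr_ge0.
move: (\int[P]_t _)%E (\sum_(y <- ts) _)%E => [a| |] b// a0 hb; last first.
  by rewrite leey.
move=> h.
have : ((expR m * (1 - m))%:E <= a%:E + (2 * expR m)%:E * (n%:R * V)%:E)%E.
  by apply: le_trans h _; apply: leeD2l; apply: lee_wpmul2l.
by rewrite -EFinM -EFinD !lee_fin /m; lra.
Qed.

End mean_square.

(** * Frostman's theorem on the line *)

Section bilinear_energy.
Context d (T : measurableType d) {R : realType} (P : probability T R).
Variable X : T -> R.
Hypothesis mX : measurable_fun setT X.
Implicit Types f g h : T -> R.

Definition mutual_energy f g : \bar R :=
  (\int[P]_t (wpot P X f (X t) * (g t)%:E))%E.

Lemma mutual_energy_ge0 f g : (forall t, 0 <= f t) -> (forall t, 0 <= g t) ->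
  (0 <= mutual_energy f g)%E.
Proof.
move=> f0 g0; apply: integral_ge0 => t _.
by rewrite mule_ge0 ?wpot_ge0// lee_fin.
Qed.

Let mk y : measurable_fun setT (fun t => logker y (X t)).
Proof. exact: measurable_logker_comp. Qed.

Lemma wpotD f g (y : R) : measurable_fun setT f -> measurable_fun setT g ->
  (forall t, 0 <= f t) -> (forall t, 0 <= g t) ->
  (wpot P X (fun t => f t + g t)%R y = wpot P X f y + wpot P X g y)%E.
Proof.
move=> mf mg f0 g0; rewrite /wpot -ge0_integralD//; first last.
- by apply: emeasurable_funM => //; exact/measurable_EFinP.
- by move=> t _; rewrite mule_ge0 ?logker_ge0// lee_fin.
- by apply: emeasurable_funM => //; exact/measurable_EFinP.
- by move=> t _; rewrite mule_ge0 ?logker_ge0// lee_fin.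
by apply: eq_integral => t _; rewrite EFinD ge0_muleDr ?lee_fin.
Qed.

Lemma wpotZ (a : R) f (y : R) : measurable_fun setT f -> (forall t, 0 <= f t) -> 0 <= a ->
  (wpot P X (fun t => (a * f t)%R) y = a%:E * wpot P X f y)%E.
Proof.
move=> mf f0 a0; rewrite /wpot -ge0_integralZl//; first last.
- by move=> t _; rewrite mule_ge0 ?logker_ge0// lee_fin.
- by apply: emeasurable_funM => //; exact/measurable_EFinP.
by apply: eq_integral => t _; rewrite EFinM muleCA.
Qed.

Lemma mutual_energyC f g : measurable_fun setT f -> measurable_fun setT g ->
  (forall t, 0 <= f t) -> (forall t, 0 <= g t) ->
  mutual_energy f g = mutual_energy g f.
Proof.
move=> mf mg f0 g0; rewrite /mutual_energy /wpot.
pose F (p : T * T) : \bar R := (logker (X p.1) (X p.2) * (f p.2)%:E * (g p.1)%:E)%E.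
have mF : measurable_fun setT F.
  apply: emeasurable_funM; last first.
    by apply/measurable_EFinP; apply: measurableT_comp.
  apply: emeasurable_funM.
    by apply: measurable_logker_comp; apply: measurableT_comp.
  by apply/measurable_EFinP; apply: measurableT_comp.
have F0 p : (0 <= F p)%E by rewrite !mule_ge0 ?logker_ge0// lee_fin.
transitivity (\int[P]_t \int[P]_s F (t, s))%E.
  apply: eq_integral => t _; rewrite muleC -ge0_integralZl//; first last.
  - by rewrite lee_fin.
  - by move=> s _; rewrite mule_ge0 ?logker_ge0// lee_fin.
  - by apply: emeasurable_funM => //; exact/measurable_EFinP.
  by apply: eq_integral => s _; rewrite /F muleC.
rewrite (fubini_tonelli F)//; apply: eq_integral => s _.
rewrite muleC -ge0_integralZl//; first last.
- by rewrite lee_fin.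
- by move=> t _; rewrite mule_ge0 ?logker_ge0// lee_fin.
- by apply: emeasurable_funM => //; exact/measurable_EFinP.
by apply: eq_integral => t _; rewrite /F/= logkerC muleAC muleC.
Qed.

Lemma mutual_energyDl f g h : measurable_fun setT f -> measurable_fun setT g ->
  measurable_fun setT h ->
  (forall t, 0 <= f t) -> (forall t, 0 <= g t) -> (forall t, 0 <= h t) ->
  (mutual_energy (fun t => f t + g t)%R h =
     mutual_energy f h + mutual_energy g h)%E.
Proof.
move=> mf mg mh f0 g0 h0; rewrite /mutual_energy -ge0_integralD//; first last.
- by apply: emeasurable_funM; [exact: measurable_wpot|exact/measurable_EFinP].
- by move=> t _; rewrite mule_ge0 ?wpot_ge0// lee_fin.
- by apply: emeasurable_funM; [exact: measurable_wpot|exact/measurable_EFinP].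
- by move=> t _; rewrite mule_ge0 ?wpot_ge0// lee_fin.
by apply: eq_integral => t _; rewrite wpotD// ge0_muleDl ?wpot_ge0.
Qed.

Lemma mutual_energyZl (a : R) f g : measurable_fun setT f -> measurable_fun setT g ->
  (forall t, 0 <= f t) -> (forall t, 0 <= g t) -> 0 <= a ->
  (mutual_energy (fun t => a * f t)%R g = a%:E * mutual_energy f g)%E.
Proof.
move=> mf mg f0 g0 a0; rewrite /mutual_energy -ge0_integralZl//; first last.
- by move=> t _; rewrite mule_ge0 ?wpot_ge0// lee_fin.
- by apply: emeasurable_funM; [exact: measurable_wpot|exact/measurable_EFinP].
by apply: eq_integral => t _; rewrite wpotZ// muleA.
Qed.

End bilinear_energy.

Section essential_range.
Context d (T : measurableType d) {R : realType} (P : probability T R).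

(** Membership in the support of the law of [X]. *)
Definition ess_value (X : T -> R) (x : R) : Prop :=
  forall r : R, 0 < r -> (0 < P [set t | (`|X t - x| < r)%R])%E.

(** Either the law of [X] does not charge the half-line up to [y], or its support
    has a last point [a <= y], found as a supremum. Applied to [X] and to [- X],
    this encloses [y] in a gap of the support. *)
Lemma ess_value_left (X : T -> R) (l y : R) :
  measurable_fun setT X -> (forall t, l <= X t) ->
  P [set t | X t <= y] = 0%E \/
  exists a, [/\ a <= y, ess_value X a & P [set t | a < X t <= y] = 0%E].
Proof.
move=> mX hl.
have mS (i : interval R) : measurable (X @^-1` [set` i]).
  by rewrite -[_ @^-1` _]setTI; exact: mX.
have [P0|Pn0] := eqVneq (P [set t | X t <= y]) 0%E; [by left|right].
pose A := [set x | x <= y /\ (0 < P (X @^-1` `[x, y]))%E].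
have A0 : A (Num.min l y).
  split; first by rewrite ge_min lexx orbT.
  rewrite lt0e measure_ge0 andbT.
  rewrite (_ : _ @^-1` _ = [set t | X t <= y])//.
  apply/seteqP; split => t /=; rewrite in_itv/=; first by case/andP.
  by move=> ->; rewrite ge_min hl.
have ubA : ubound A y by move=> x [].
have supA : has_sup A by split; [exists (Num.min l y)|exists y].
set a := sup A; have ay : a <= y by apply: ge_sup => //; exists (Num.min l y).
have nul : P [set t | a < X t <= y] = 0%E.
  apply/eqP; rewrite -measure_le0.
  rewrite (_ : [set t | _] = \bigcup_n (X @^-1` `[a + n.+1%:R^-1, y])); last first.
    apply/seteqP; split => t /=.
      move=> /andP[h1 h2]; have d0 : 0 < X t - a by rewrite subr_gt0.
      exists (Num.truncn (X t - a)^-1) => //=; rewrite in_itv/= h2 andbT.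
      rewrite -lerBrDl -[leRHS]invrK lef_pV2 ?posrE ?invr_gt0//.
      by apply/ltW; exact: truncnS_gt.
    move=> [n _] /=; rewrite in_itv/= => /andP[h1 h2]; rewrite h2 andbT.
    by apply: lt_le_trans h1; rewrite ltrDl invr_gt0.
  apply: le_trans (measure_sigma_subadditive _ _ _ (@subset_refl _ _)) _ => //.
    by apply: bigcupT_measurable => n; exact: mS.
  rewrite eseries0// => n _ _; apply/eqP; apply: contraT => h.
  have h' : A (a + n.+1%:R^-1).
    split; last by rewrite lt0e h measure_ge0.
    rewrite leNgt; apply: contra_neqN h => yn.
    rewrite (_ : _ @^-1` _ = set0) ?measure0//.
    apply/seteqP; split => t //=; rewrite in_itv/= => /andP[h1 h2].
    by move: (le_trans h1 h2); rewrite leNgt yn.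
  have := ub_le_sup (proj2 supA) h'; rewrite -/a gerDl leNgt invr_gt0.
  by rewrite ltr0n.
exists a; split => // r r0.
have [x Ax xr] : exists2 x, A x & a - r < x by apply: sup_adherent.
case: Ax => xy /lt_le_trans; apply.
have mB : measurable [set t | `|X t - a| < r].
  rewrite (_ : [set t | _] = X @^-1` `]a - r, a + r[); first exact: mS.
  by apply/seteqP; split => t /=; rewrite in_itv/= ltr_distl.
have mC : measurable [set t | a < X t <= y].
  rewrite (_ : [set t | _] = X @^-1` `]a, y]); first exact: mS.
  by apply/seteqP; split => t /=; rewrite in_itv.
rewrite -[leRHS]adde0 -nul; apply: le_trans (measureU2 _ mB mC).
apply: le_measure; rewrite ?inE//; first exact: measurableU.
move=> t /=; rewrite in_itv/= => /andP[h1 h2].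
by case: (leP (X t) a) => h; [left|right; rewrite h2]; rewrite ?ltr_distl; lra.
Qed.

End essential_range.

Section kernel_convexity.
Context {R : realType}.
Implicit Types a b x y : R.

Lemma logkerE x y : x != y -> logker x y = (Num.max 0 (- ln `|x - y|))%:E.
Proof. by rewrite /logker => /negbTE ->. Qed.

Lemma logker_anti a x y : `|a - x| <= `|y - x| -> (logker y x <= logker a x)%E.
Proof.
move=> h; rewrite {2}/logker; case: eqVneq => [_|ax]; first by rewrite leey.
have a0 : 0 < `|a - x| by rewrite normr_gt0 subr_eq0.
have y0 : 0 < `|y - x| := lt_le_trans a0 h.
rewrite /logker -subr_eq0 -normr_eq0 gt_eqF// lee_fin.
rewrite ge_max le_max lexx /= le_max; apply/orP; right.
by rewrite lerN2 ler_ln ?posrE.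
Qed.

Lemma ln_concave2 (A B C lam : R) : 0 < A -> 0 < B -> 0 < C -> 0 <= lam <= 1 ->
  C = (1 - lam) * A + lam * B -> (1 - lam) * ln A + lam * ln B <= ln C.
Proof.
move=> A0 B0 C0 /andP[l0 l1] CE.
have tangent (D : R) : 0 < D -> ln D <= ln C + (D / C - 1).
  move=> D0; have := expR_ge1Dx (ln (D / C)).
  by rewrite lnK ?posrE ?divr_gt0// ln_div ?posrE//; lra.
have := ler_wpM2l l0 (tangent B B0).
have l1' : 0 <= 1 - lam by lra.
have := ler_wpM2l l1' (tangent A A0).
have : (1 - lam) * (A / C) + lam * (B / C) = 1.
  by rewrite !mulrA -mulrDl -CE divff// gt_eqF.
by move: (A / C) (B / C) (ln A) (ln B) (ln C) => p q r s t; lra.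
Qed.

(** Away from [x] the function [- ln |y - x|] is convex in [y], and so is its
    maximum with [0]. *)
Lemma logker_convex a b x y lam : a < b -> 0 < lam < 1 ->
  y = (1 - lam) * a + lam * b -> x <= a \/ b <= x ->
  (logker y x <= (1 - lam)%:E * logker a x + lam%:E * logker b x)%E.
Proof.
move=> ab /andP[l0 l1] yE xab.
have l1' : 0 < 1 - lam by lra.
have [->|xa] := eqVneq x a.
  by rewrite {2}/logker eqxx gt0_muley ?lte_fin// addye ?leey// gt_eqF//
    (lt_le_trans ltNy0)// mule_ge0 ?logker_ge0// lee_fin ltW.
have [->|xb] := eqVneq x b.
  by rewrite {3}/logker eqxx gt0_muley ?lte_fin// addey ?leey// gt_eqF//
    (lt_le_trans ltNy0)// mule_ge0 ?logker_ge0// lee_fin ltW.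
have a0 : 0 < `|a - x| by rewrite normr_gt0 subr_eq0 eq_sym.
have b0 : 0 < `|b - x| by rewrite normr_gt0 subr_eq0 eq_sym.
have CE : `|y - x| = (1 - lam) * `|a - x| + lam * `|b - x|.
  case: xab => h.
    rewrite !ger0_norm; last 3 first; try lra.
    by rewrite yE subr_ge0; nra.
  rewrite !ler0_norm; last 3 first; try lra.
  by rewrite yE subr_le0; nra.
have y0 : 0 < `|y - x| by rewrite CE addr_gt0// mulr_gt0.
have hln := ln_concave2 a0 b0 y0 (lam := lam) _ CE.
rewrite !logkerE -?EFinM -?EFinD ?lee_fin; last 3 first.
- by rewrite eq_sym.
- by rewrite eq_sym.
- by rewrite -subr_eq0 -normr_eq0 gt_eqF.
rewrite ge_max addr_ge0/=; last 2 first.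
- by rewrite mulr_ge0 ?(ltW l1')// le_max lexx.
- by rewrite mulr_ge0 ?(ltW l0)// le_max lexx.
apply: (@le_trans _ _ ((1 - lam) * - ln `|a - x| + lam * - ln `|b - x|)).
  by rewrite !mulrN -opprD lerN2; apply: hln; rewrite !ltW.
by apply: lerD; rewrite ler_pM2l// le_max lexx orbT.
Qed.

End kernel_convexity.

Section frostman.
Context d (T : measurableType d) {R : realType} (P : probability T R).
Variables (X : T -> R) (V l u : R).
Hypothesis mX : measurable_fun setT X.
Hypothesis hX : forall t, l <= X t <= u.
Local Notation pot y := (\int[P]_s logker y (X s))%E.
Hypothesis energyE : (\int[P]_t pot (X t) = V%:E)%E.
Hypothesis energy_min : forall f : T -> R, measurable_fun setT f ->
  (forall t, 0 <= f t) -> (\int[P]_t (f t)%:E = 1)%E ->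
  (V%:E <= mutual_energy P X f f)%E.

Let wpot1 y : wpot P X (cst 1) y = pot y.
Proof. by apply: eq_integral => t _; rewrite mule1. Qed.

Let V0 : 0 <= V.
Proof.
rewrite -lee_fin -energyE; apply: integral_ge0 => t _.
by apply: integral_ge0 => s _; exact: logker_ge0.
Qed.

Let mpot : measurable_fun setT (fun t => pot (X t)).
Proof.
rewrite (_ : (fun t => _) = fun t => wpot P X (cst 1) (X t)); last first.
  by apply/funext => t; rewrite wpot1.
by apply: measurable_wpot => // t; rewrite ler01.
Qed.

(** If the potential exceeded the energy on a set of positive measure, removing a
    part of that mass and rescaling the rest would lower the energy. *)
Lemma frostman_ae (eps : R) : 0 < eps ->
  P [set t | ((V + eps)%:E <= pot (X t))%E] = 0%E.
Proof.
move=> eps0; set B := [set t | _].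
have mB : measurable B.
  by rewrite -[B]setTI; exact: emeasurable_fun_c_infty.
apply/eqP; apply: contraT => PB.
set b := fine (P B); have bE : P B = b%:E by rewrite fineK// fin_num_measure.
have b0 : 0 < b by rewrite -lte_fin -bE lt0e PB measure_ge0.
have b1 : b <= 1 by rewrite -lee_fin -bE probability_le1.
pose iB : T -> R := \1_B; pose one : T -> R := cst 1.
have miB : measurable_fun setT iB by exact: measurable_indic.
have iB0 t : 0 <= iB t by rewrite /iB indicE; case: (_ \in _).
have iB1 t : iB t <= 1 by rewrite /iB indicE; case: (_ \in _).
have one0 t : 0 <= one t by exact: ler01.
have m1 : measurable_fun setT one by exact: measurable_cst.
have split_by (theta : R) (h : T -> R) : 0 <= theta <= 1 -> measurable_fun setT h ->
    (forall t, 0 <= h t) ->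
    (mutual_energy P X (fun t => 1 - theta * iB t)%R h
       + theta%:E * mutual_energy P X iB h = mutual_energy P X one h)%E.
  move=> /andP[th0 th1] mh h0.
  have mth : measurable_fun setT (fun t => theta * iB t) by exact: measurable_funM.
  have mA : measurable_fun setT (fun t => 1 - theta * iB t).
    by apply: measurable_funB => //; exact: measurable_cst.
  have A0 t : 0 <= 1 - theta * iB t by rewrite subr_ge0 mulr_ile1.
  have th0' t : 0 <= theta * iB t by rewrite mulr_ge0.
  rewrite -(mutual_energyZl P mX miB mh iB0 h0 th0).
  rewrite -(mutual_energyDl P mX mA mth mh A0 th0' h0).
  rewrite (_ : (fun t => 1 - theta * iB t + theta * iB t) = one)//.
  by apply/funext => t; rewrite subrK.
have E11 : mutual_energy P X one one = V%:E.
  rewrite /mutual_energy -energyE; apply: eq_integral => t _.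
  by rewrite wpot1 mule1.
have f1 (th : R) : 0 <= th <= 1 -> forall t, 0 <= 1 - th * iB t.
  by move=> /andP[th0 th1] t; rewrite subr_ge0 mulr_ile1.
have mf1 (th : R) : measurable_fun setT (fun t => 1 - th * iB t).
  by apply: measurable_funB => //; exact: measurable_funM.
have fin (h : T -> R) (c : R) : 0 <= c -> (forall t, 0 <= h t) -> measurable_fun setT h ->
    mutual_energy P X one h = c%:E ->
    exists2 w : R, 0 <= w & mutual_energy P X iB h = w%:E.
  move=> c0 h0 mh hE; have h01 : 0 <= (1 : R) <= 1 by rewrite ler01 lexx.
  have := split_by 1 h h01 mh h0; rewrite mul1e hE.
  have := mutual_energy_ge0 P X iB0 h0.
  have := mutual_energy_ge0 P X (f1 1 h01) h0.
  case: (mutual_energy P X iB h) => [w| |]//; last first.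
    by move=> p0 _; rewrite addey// gt_eqF// (lt_le_trans _ p0).
  by move=> _ w0 _; exists w.
have [u' u0 uE] := fin one V V0 one0 m1 E11.
have uE' : mutual_energy P X one iB = u'%:E by rewrite mutual_energyC.
have [w w0 wE] := fin iB u' u0 iB0 miB uE'.
have iBint : (\int[P]_t (iB t)%:E = b%:E)%E by rewrite integral_indic// setIT.
have ub : b * (V + eps) <= u'.
  rewrite -lee_fin -uE' mulrC EFinM -iBint.
  rewrite -ge0_integralZl//; first last.
  - by rewrite lee_fin addr_ge0// ltW.
  - by move=> t _; rewrite lee_fin.
  - exact/measurable_EFinP.
  apply: ge0_le_integral => //.
  - by move=> t _; rewrite mule_ge0 ?lee_fin// addr_ge0// ltW.
  - by apply: emeasurable_funM => //; exact/measurable_EFinP.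
  - by apply: emeasurable_funM; [exact: measurable_wpot|exact/measurable_EFinP].
  move=> t _; rewrite /iB indicE; have [tB|tB] := boolP (t \in B).
    by rewrite !mule1 wpot1; move: tB; rewrite inE.
  by rewrite !mule0.
(* Against the density [1 - th * iB], normalised by its integral [1 - th * b], the
   minimality of the energy reads
   [V * (1 - th * b) ^+ 2 <= V - 2 * th * u' + th ^+ 2 * w]. As [u' > b * V], this
   fails for small [th > 0], and already for the following one. *)
pose th := (u' - b * V) / (u' + w + 1).
have ubV : 0 < u' - b * V by have := mulr_gt0 b0 eps0; lra.
have D0 : 0 < u' + w + 1 by lra.
have th0 : 0 < th by rewrite divr_gt0.
have bV0 : 0 <= b * V by rewrite mulr_ge0// ltW.
have th1 : th < 1 by rewrite ltr_pdivrMr//; lra.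
have th01 : 0 <= th <= 1 by rewrite !ltW.
have thD : th * (u' + w + 1) = u' - b * V by rewrite divfK// gt_eqF.
pose f t := 1 - th * iB t.
have := split_by th one th01 m1 one0; rewrite E11 uE -/f.
have := split_by th iB th01 miB iB0; rewrite uE' wE -/f.
have := split_by th f th01 (mf1 th) (f1 _ th01); rewrite -/f.
rewrite (mutual_energyC P mX m1 (mf1 th) one0 (f1 _ th01)).
rewrite (mutual_energyC P mX miB (mf1 th) iB0 (f1 _ th01)) -/f.
have := mutual_energy_ge0 P X (f1 _ th01) (f1 _ th01); rewrite -/f.
have := mutual_energy_ge0 P X (f1 _ th01) iB0; rewrite -/f.
have := mutual_energy_ge0 P X (f1 _ th01) one0; rewrite -/f.
have thb : 0 < 1 - th * b by rewrite subr_gt0; apply: le_lt_trans th1; rewrite ler_piMr// ltW.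
have := energy_min (f := fun t => (1 - th * b)^-1 * f t).
have If : (\int[P]_t (f t)%:E + (th * b)%:E = 1)%E.
  rewrite EFinM -iBint.
  rewrite -ge0_integralZl ?lee_fin ?ltW//; first last.
  - by move=> t _; rewrite lee_fin.
  - exact/measurable_EFinP.
  rewrite -ge0_integralD//; first last.
  - by apply: emeasurable_funM => //; exact/measurable_EFinP.
  - by move=> t _; rewrite mule_ge0// lee_fin// ltW.
  - by apply/measurable_EFinP; exact: mf1.
  - by move=> t _; rewrite lee_fin; exact: f1.
  rewrite (eq_integral (fun=> 1%:E)%E) ?integral_probability_cst//.
  by move=> t _; rewrite -EFinM -EFinD subrK.
have c0 : 0 <= (1 - th * b)^-1 by rewrite invr_ge0 ltW.
rewrite mutual_energyZl//; last 4 first.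
- exact: mf1.
- by apply: measurable_funM => //; exact: mf1.
- exact: f1.
- by move=> t; rewrite mulr_ge0//; exact: f1.
rewrite mutual_energyC//; last 4 first.
- exact: mf1.
- by apply: measurable_funM => //; exact: mf1.
- exact: f1.
- by move=> t; rewrite mulr_ge0//; exact: f1.
rewrite mutual_energyZl//; try exact: mf1; try exact: f1.
case: (mutual_energy P X f one) => [Z| |]//.
case: (mutual_energy P X f iB) => [Y| |]//.
case: (mutual_energy P X f f) => [F| |]//.
move=> hmin _ _ _ [h1] [h2] [h3].
have : V <= (1 - th * b)^-1 * ((1 - th * b)^-1 * F).
  rewrite -lee_fin !EFinM; apply: hmin.
  - by apply: measurable_funM => //; exact: mf1.
  - by move=> t; rewrite mulr_ge0//; exact: f1.
  - under eq_integral do rewrite EFinM.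
    rewrite ge0_integralZl//; last 2 first.
    - by apply/measurable_EFinP; exact: mf1.
    - by move=> t _; rewrite lee_fin; exact: f1.
    move: If; case: (\int[P]_t (f t)%:E)%E => [v| |]// [vE].
    rewrite -EFinM (_ : v = 1 - th * b); last by rewrite -vE addrK.
    by rewrite mulVf// gt_eqF.
rewrite mulrA -invfM mulrC ler_pdivlMr ?mulr_gt0// => h4.
exfalso.
have YE : Y = u' - th * w by lra.
have FE : F = V - 2 * th * u' + th * th * w.
  have -> : F = Z - th * Y by lra.
  by rewrite YE; lra.
have : th * (2 * (u' - b * V) + th * (b * b * V) - th * w) <= 0.
  by move: h4; rewrite FE; lra.
rewrite pmulr_rle0//; apply/negP; rewrite -ltNge.
have : 0 <= th * (b * b * V).
  by apply: mulr_ge0; [exact: ltW|apply: mulr_ge0 => //; apply: mulr_ge0; exact: ltW].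
have : 0 <= th * u' by rewrite mulr_ge0// ltW.
by move: thD; lra.
Qed.

(** The potential is lower semicontinuous: the truncated potentials are Lipschitz,
    and every neighbourhood of a point of the support contains points where the
    potential is nearly at most [V]. *)
Lemma frostman_support x : ess_value P X x -> (pot x <= V%:E)%E.
Proof.
move=> hx; apply: (logker_le_lim mX) => n; apply/lee_addgt0Pr => e e0.
have e2 : 0 < e / 2 by rewrite divr_gt0.
pose r := e / 2 / expR n%:R.
have r0 : 0 < r by rewrite divr_gt0 ?expR_gt0.
have [t [h1 h2]] : exists t, `|X t - x| < r /\ (pot (X t) <= (V + e / 2)%:E)%E.
  apply: contrapT => /forallNP hn; have := hx r r0; apply/negP.
  rewrite -leNgt -(frostman_ae e2); apply: le_measure; rewrite ?inE.
  - rewrite (_ : [set t | _] = X @^-1` `]x - r, x + r[).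
      by rewrite -[_ @^-1` _]setTI; exact: mX.
    by apply/seteqP; split => t /=; rewrite in_itv/= ltr_distl.
  - by rewrite -[X in measurable X]setTI; exact: emeasurable_fun_c_infty.
  - move=> t /= ht; rewrite leNgt; apply/negP => /ltW h.
    by apply: (hn t).
have mt (z : R) : measurable_fun setT (fun s => (tker n%:R z (X s))%:E).
  by apply/measurable_EFinP; exact: measurable_tker_comp.
apply: (@le_trans _ _
    (\int[P]_s ((tker n%:R (X t) (X s))%:E + (expR n%:R * `|x - X t|)%:E))%E).
  apply: ge0_le_integral => //.
  - by move=> s _; rewrite lee_fin tker_ge0.
  - by apply: emeasurable_funD.
  - by move=> s _; rewrite -EFinD lee_fin; exact: tker_lipschitz.
rewrite ge0_integralD//; first last.
- by move=> s _; rewrite lee_fin tker_ge0.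
rewrite integral_probability_cst -EFinD.
rewrite (_ : V + e = V + e / 2 + e / 2); last by rewrite -addrA -splitr.
rewrite EFinD leeD//; last first.
  by rewrite lee_fin mulrC -ler_pdivlMr ?expR_gt0// distrC ltW.
apply: le_trans h2; apply: ge0_le_integral => //.
- by move=> s _; rewrite lee_fin tker_ge0.
- exact: measurable_logker_comp.
- by move=> s _; exact: tker_le_logker.
Qed.

(** On a gap of the support the potential is convex, and beyond the support it
    is monotone, so its values are controlled by those on the support: this is
    the maximum principle for real points. *)
Theorem frostman_potential_le y : (pot y <= V%:E)%E.
Proof.
have mN : measurable_fun setT (fun t => - X t) by exact: measurable_funN.
have mS (i : interval R) : measurable (X @^-1` [set` i]).
  by rewrite -[_ @^-1` _]setTI; exact: mX.
have mlog (z : R) : measurable_fun setT (fun t => logker z (X t)).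
  exact: measurable_logker_comp.
have essN a : ess_value P (fun t => - X t) a -> ess_value P X (- a).
  move=> h r r0; 
  rewrite (_ : [set t | _] = [set t | `|- X t - a| < r]); first exact: h.
  by apply/seteqP; split => t /=; rewrite -opprD normrN opprK.
have aele (g : T -> \bar R) (N : set T) : P.-negligible N ->
    measurable_fun setT g -> (forall t, 0 <= g t)%E ->
    (forall t, ~ N t -> logker y (X t) <= g t)%E ->
    (pot y <= \int[P]_t g t)%E.
  move=> N0 mg g0 hN; apply: ae_ge0_le_integral => //.
  - by move=> t _; exact: logker_ge0.
  - by apply: negligibleS N0 => t /=; apply: contra_notP => hh _; exact: hN.
have mL : measurable [set t | X t <= y].
  rewrite (_ : [set t | _] = X @^-1` `]-oo, y]); first exact: mS.
  by apply/seteqP; split => t /=; rewrite in_itv.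
have mR : measurable [set t | - X t <= - y].
  rewrite (_ : [set t | _] = X @^-1` `[y, +oo[); first exact: mS.
  by apply/seteqP; split => t /=; rewrite in_itv/= andbT lerN2.
have mLa a : measurable [set t | a < X t <= y].
  rewrite (_ : [set t | _] = X @^-1` `]a, y]); first exact: mS.
  by apply/seteqP; split => t /=; rewrite in_itv.
have mRb b : measurable [set t | b < - X t <= - y].
  rewrite (_ : [set t | _] = X @^-1` `[y, - b[); first exact: mS.
  by apply/seteqP; split => t /=; rewrite in_itv/= lerN2 ltrNr andbC.
have hl t : l <= X t by case/andP: (hX t).
have hu t : - u <= - X t by case/andP: (hX t) => _; rewrite lerN2.
have [L0|[a [ay ea La]]] := ess_value_left P y mX hl;
have [R0|[b [yb /essN eb Rb]]] := ess_value_left P (- y) mN hu.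
- have : (P setT <= P [set t | (X t <= y)%R] + P [set t | (- X t <= - y)%R])%E.
    apply: le_trans (measureU2 _ mL mR); apply: le_measure; rewrite ?inE//.
      exact: measurableU.
    by move=> t _ /=; rewrite lerN2; case: (leP (X t) y); [left|right; exact: ltW].
  by rewrite L0 R0 adde0 probability_setT lee_fin ler10.
- rewrite lerNr in yb; move: yb; rewrite le_eqVlt => /predU1P[->|yb].
    exact: frostman_support.
  apply: le_trans (frostman_support eb).
  apply: (@aele _ ([set t | X t <= y] `|` [set t | b < - X t <= - y])) => //.
  - by apply: negligibleU; apply/negligibleP.
  - by move=> t; exact: logker_ge0.
  move=> t /not_orP[/= /negP h1 /negP h2]; apply: logker_anti.
  by rewrite !ler0_norm; lra.
- move: ay; rewrite le_eqVlt => /predU1P[<-|ay]; first exact: frostman_support.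
  apply: le_trans (frostman_support ea).
  apply: (@aele _ ([set t | - X t <= - y] `|` [set t | a < X t <= y])) => //.
  - by apply: negligibleU; apply/negligibleP.
  - by move=> t; exact: logker_ge0.
  move=> t /not_orP[/= /negP h1 /negP h2]; apply: logker_anti.
  by rewrite !ger0_norm; lra.
- move: ay; rewrite le_eqVlt => /predU1P[<-|ay]; first exact: frostman_support.
  rewrite lerNr in yb; move: yb; rewrite le_eqVlt => /predU1P[->|yb].
    exact: frostman_support.
  pose lam := (y - a) / (- b - a).
  have D0 : 0 < - b - a by lra.
  have l0 : 0 < lam by rewrite divr_gt0//; lra.
  have l1 : lam < 1 by rewrite ltr_pdivrMr//; lra.
  have lD : lam * (- b - a) = y - a by rewrite divfK// gt_eqF.
  have l1' : 0 < 1 - lam by rewrite subr_gt0.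
  have l01 : 0 < lam < 1 by rewrite l0 l1.
  have ab : a < - b by lra.
  have yE : y = (1 - lam) * a + lam * - b by lra.
  apply: (@le_trans _ _ (\int[P]_t ((1 - lam)%:E * logker a (X t)
      + lam%:E * logker (- b) (X t)))%E).
    apply: (@aele _ ([set t | a < X t <= y] `|` [set t | b < - X t <= - y])).
    - by apply: negligibleU; apply/negligibleP.
    - by apply: emeasurable_funD; apply: emeasurable_funM.
    - move=> t; apply: adde_ge0; rewrite mule_ge0 ?logker_ge0// lee_fin ltW//.
    move=> t /not_orP[/= /negP h1 /negP h2]; apply: (logker_convex ab l01 yE).
    by case: (leP (X t) y) => h; [left|right]; lra.
  rewrite ge0_integralD//; first last.
  - by apply: emeasurable_funM.
  - by move=> t _; rewrite mule_ge0 ?logker_ge0// lee_fin ltW.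
  - by apply: emeasurable_funM.
  - by move=> t _; rewrite mule_ge0 ?logker_ge0// lee_fin ltW.
  have k0 z t : [set: T] t -> (0 <= logker z (X t))%E by move=> _; exact: logker_ge0.
  rewrite !ge0_integralZl_EFin ?(ltW l0) ?(ltW l1')//; try exact: k0.
  apply: (@le_trans _ _ ((1 - lam)%:E * V%:E + lam%:E * V%:E)%E).
    by apply: leeD; apply: lee_wpmul2l;
      rewrite ?lee_fin ?(ltW l0) ?(ltW l1')//; exact: frostman_support.
  by rewrite -!EFinM -EFinD -mulrDl subrK mul1r.
Qed.

End frostman.

(** * The self-similar measure *)

Section halving.
Context {R : realType}.
Local Notation mu := (@lebesgue_measure R).
Local Notation P0 := (@uniform_prob R 0 1 ltr01).

(** [aff 0] and [aff 1] stretch the two halves of [0, 1] onto [0, 1]. *)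
Let aff (c : R) (x : measurableTypeR R) : measurableTypeR R := 2 * (x : R) - c.

Let maff c : measurable_fun setT (aff c).
Proof.
apply: (@continuous_measurable_fun R) => x.
by apply: cvgB; [apply: cvgMr; exact: cvg_id|exact: cvg_cst].
Qed.

Let affm (c : R) : {measure set (measurableTypeR R) -> \bar R}.
Proof. by refine (pushforward mu (aff c)); exact: maff. Defined.

Let aff_pushforward c (A : set R) : measurable A ->
  mscale (2%:nng : {nonneg R}) (affm c) A = mu A.
Proof.
move=> mA; apply/esym.
apply: (lebesgue_measure_unique (mu := mscale _ (affm c))) => //.
move=> _ [[a b]] _ <-; transitivity (2%:E * mu (aff c @^-1` `]a, b]%classic))%E; last by [].
rewrite (_ : aff c @^-1` `]a, b] = `](a + c) / 2, (b + c) / 2]%classic); last first.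
  apply/seteqP; split => x /=; rewrite !in_itv/= /aff => /andP[h1 h2];
  by apply/andP; split; lra.
rewrite !lebesgue_measure_itv/= !lte_fin.
have -> : ((a + c) / 2 < (b + c) / 2) = (a < b).
  by rewrite ltr_pM2r ?invr_gt0// ltrD2r.
case: ifP => _; last by rewrite mule0.
by rewrite -!EFinB -EFinM; congr _%:E; field.
Qed.

Let integral_aff (c a b : R) (F : R -> \bar R) : measurable_fun setT F ->
  (forall u, 0 <= F u)%E ->
  (\int[mu]_(u in `[((a + c) / 2)%R, ((b + c) / 2)%R]) F u =
    2^-1%:E * \int[mu]_(u in `[a, b]) F ((u + c) / 2)%R)%E.
Proof.
move=> mF F0.
have mH : measurable_fun setT (fun u : R => F ((u + c) / 2)).
  apply: (measurableT_comp mF); apply: continuous_measurable_fun => x.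
  by apply: cvgMl; apply: cvgD; [exact: cvg_id|exact: cvg_cst].
rewrite -[in RHS](@eq_measure_integral _ _ _ _ mu
    (mscale (2%:nng : {nonneg R}) (affm c))); last first.
  by move=> A mA _; exact: aff_pushforward.
rewrite ge0_integral_mscale//=; last exact: measurable_funTS.
rewrite muleA -EFinM mulVf// mul1e (ge0_integral_pushforward (maff c))//; last exact: measurable_funTS.
rewrite (_ : aff c @^-1` `[a, b] = `[(a + c) / 2, (b + c) / 2]%classic); last first.
  apply/seteqP; split => x /=; rewrite !in_itv/= /aff => /andP[h1 h2];
  by apply/andP; split; lra.
by apply: eq_integral => u _ /=; congr F; rewrite /aff; field.
Qed.

Lemma uniform_integralE (F : R -> \bar R) : measurable_fun setT F ->
  (forall u, 0 <= F u)%E ->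
  (\int[P0]_u F u = \int[mu]_(u in `[0%R, 1%R]) F u)%E.
Proof.
by move=> mF F0; rewrite integral_uniform// subr0 invr1 mul1e.
Qed.

(** Doubling preserves the uniform law on [0, 1]. *)
Lemma uniform_halving (F F0 F1 : R -> \bar R) :
  measurable_fun setT F -> measurable_fun setT F0 -> measurable_fun setT F1 ->
  (forall u, 0 <= F u)%E -> (forall u, 0 <= F0 u)%E -> (forall u, 0 <= F1 u)%E ->
  (forall u : R, 0 <= u <= 1 -> F (u / 2) = F0 u) ->
  (forall u : R, 0 < u <= 1 -> F ((u + 1) / 2) = F1 u) ->
  (\int[P0]_u F u = 2^-1%:E * \int[P0]_u F0 u + 2^-1%:E * \int[P0]_u F1 u)%E.
Proof.
move=> mF mF0 mF1 F_0 F0_0 F1_0 h0 h1; rewrite !uniform_integralE//.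
rewrite [X in (\int[mu]_(u in X) F u)%E](_ : _ = `[0, 2^-1] `|` `]2^-1, 1] :> set R); last first.
  apply/seteqP; split => x /=; rewrite !in_itv/=.
    by move=> /andP[x0 x1]; case: (leP x 2^-1) => h; [left|right]; rewrite ?x0 ?x1.
  by case => /andP[a b]; apply/andP; split; lra.
rewrite ge0_integral_setU//=; first last.
- by apply/disj_setPS => x [] /=; rewrite !in_itv/=; lra.
- exact: measurable_funTS.
congr (_ + _)%E.
  have := integral_aff 0 0 1 mF F_0; rewrite !addr0 mul0r div1r => ->.
  congr (_ * _)%E; apply: eq_integral => u; rewrite inE/= in_itv/= => hu.
  by rewrite addr0 h0.
rewrite integral_itv_obnd_cbnd; last exact: measurable_funTS.
have := integral_aff 1 0 1 mF F_0; rewrite add0r div1r (_ : (1 + 1) / 2 = 1); last by field.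
move=> ->; congr (_ * _)%E.
rewrite -integral_itv_obnd_cbnd; last first.
  apply: measurable_funTS; apply: (measurableT_comp mF).
  apply: continuous_measurable_fun => x.
  by apply: cvgMl; apply: cvgD; [exact: cvg_id|exact: cvg_cst].
rewrite -integral_itv_obnd_cbnd; last exact: measurable_funTS.
by apply: eq_integral => u; rewrite inE/= in_itv/= => hu; rewrite h1.
Qed.

End halving.

Section coding.
Context {R : realType} (gamma : nat -> R).
Hypothesis hgamma : forall s : nat, (1 <= s)%N -> 0 < gamma s <= 32^-1.
Implicit Types u v w x y : R.

Let hg s : 0 < gamma s.+1 <= 32^-1. Proof. exact: hgamma. Qed.

(** The point reached after [n] steps back in time, when the binary digits of [u]
    select the inverse branches. *)
Fixpoint code_approx (n s : nat) (u : R) : R :=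
  if n is n'.+1 then
    if u <= 2^-1 then inv_branch (gamma s.+1) false (code_approx n' s.+1 (2 * u))
    else inv_branch (gamma s.+1) true (code_approx n' s.+1 (2 * u - 1))
  else 0.

Lemma code_approx_itv n s u : -1 <= code_approx n s u <= 0.
Proof.
elim: n s u => [|n IH] s u /=; first by rewrite lexx lerN10.
by case: ifP => _; exact: inv_branch_itv.
Qed.

Lemma inv_branch_contract16 s b v v' : -1 <= v <= 0 -> -1 <= v' <= 0 ->
  `|inv_branch (gamma s.+1) b v - inv_branch (gamma s.+1) b v'| <=
    16^-1 * `|v - v'|.
Proof.
move=> hv hv'; apply: le_trans (inv_branch_contract (hg s) b hv hv') _.
apply: ler_wpM2r => //; have /andP[g0 g1] := hg s.
have e0 := expR_gt0 (8 * gamma s.+1).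
have : expR (8 * gamma s.+1) <= 2.
  have := expR_ge1Dx (- (8 * gamma s.+1)); rewrite expRN => h.
  have : 2^-1 <= (expR (8 * gamma s.+1))^-1 by lra.
  by rewrite lef_pV2 ?posrE.
by nra.
Qed.

Lemma code_approx_dist n s u :
  `|code_approx n.+1 s u - code_approx n s u| <= 16^-1 ^+ n.
Proof.
elim: n s u => [|n IH] s u.
  by have := code_approx_itv 1 s u; rewrite /= subr0 expr0 ler_norml; lra.
have step m : code_approx m.+1 s u =
    if u <= 2^-1 then inv_branch (gamma s.+1) false (code_approx m s.+1 (2 * u))
    else inv_branch (gamma s.+1) true (code_approx m s.+1 (2 * u - 1)) by [].
rewrite exprS !step; case: ifP => _;
  (apply: le_trans (inv_branch_contract16 _ _ (code_approx_itv _ _ _)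
    (code_approx_itv _ _ _)) _);
  by rewrite ler_pM2l ?invr_gt0//; exact: IH.
Qed.

Definition code (s : nat) (u : R) : R := limn (fun n => code_approx n s u).

Lemma cvg_code_approx s u : (fun n => code_approx n s u) @ \oo --> code s u.
Proof.
suff : cvgn (fun n => code_approx n s u) by [].
pose d n := code_approx n.+1 s u - code_approx n s u.
have E : (fun n => code_approx n s u) = series d.
  apply/funext => n; rewrite /series/= telescope_sumr// subr0//.
rewrite E; apply: normed_cvg; apply: (@series_le_cvg R _ (geometric 1 16^-1)).
- by move=> n /=.
- by move=> n /=; rewrite mul1r exprn_ge0.
- by move=> n /=; rewrite mul1r; exact: code_approx_dist.
- by apply: is_cvg_geometric_series; rewrite ger0_norm//; lra.
Qed.

Lemma code_itv s u : -1 <= code s u <= 0.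
Proof.
have c := @cvg_code_approx s u; apply/andP; split.
  apply: (limr_ge (cvgP _ c)); near=> n; have := code_approx_itv n s u.
  by case/andP.
apply: (limr_le (cvgP _ c)); near=> n; have := code_approx_itv n s u.
by case/andP.
Unshelve. all: by end_near.
Qed.

Lemma codeE s u : code s u =
  if u <= 2^-1 then inv_branch (gamma s.+1) false (code s.+1 (2 * u))
  else inv_branch (gamma s.+1) true (code s.+1 (2 * u - 1)).
Proof.
have lim b v : (fun n => inv_branch (gamma s.+1) b (code_approx n s.+1 v)) @ \oo
    --> inv_branch (gamma s.+1) b (code s.+1 v).
  apply/cvgrPdist_le => e e0; have /cvgrPdist_le/(_ e e0) := @cvg_code_approx s.+1 v.
  apply: filterS => n h.
  apply: le_trans (inv_branch_contract16 s b (code_itv _ _) (code_approx_itv _ _ _)) _.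
  apply: le_trans h; rewrite ler_piMl// invf_le1//; lra.
have /cvg_lim <- // : (fun n => code_approx n.+1 s u) @ \oo --> code s u.
  by rewrite (cvg_shiftS (fun n => code_approx n s u)); exact: cvg_code_approx.
by rewrite /=; case: ifP => _; apply/cvg_lim => //; exact: lim.
Qed.

Lemma code_trapped s u : trapped gamma s (code s u).
Proof.
move=> n; suff [v ->] : exists v, branch_orbit gamma s n (code s u) = code (s + n) v.
  exact: code_itv.
elim: n s u => [|n IH] s u; first by exists u; rewrite addn0.
have -> : branch_orbit gamma s n.+1 (code s u) =
    branch_orbit gamma s.+1 n (branch_map (gamma s.+1) (code s u)) by [].
rewrite codeE addnS -addSn; case: ifP => _;
  by rewrite (inv_branchK (hg s))//; exact: code_itv.
Qed.

Lemma measurable_inv_branch g b : measurable_fun setT (inv_branch g b : R -> R).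
Proof.
apply: continuous_measurable_fun => x; rewrite /inv_branch.
apply: cvgMl; apply: cvgB; last exact: cvg_cst.
apply: cvgMr; apply: continuous_comp; last exact: sqrt_continuous.
by apply: cvgD; [exact: cvg_cst|apply: cvgMr; exact: cvg_id].
Qed.

Lemma measurable_code s : measurable_fun setT (code s).
Proof.
apply: (@measurable_fun_cvg _ _ _ _ (fun n => code_approx n s)); last first.
  by move=> u _; exact: cvg_code_approx.
move=> n; elim: n s => [|n IH] s /=; first exact: measurable_cst.
have mid : measurable_fun setT (fun u : R => 2 * u) by exact: measurable_funM.
apply: measurable_fun_ifT; first exact: measurable_fun_ler.
- by apply: measurableT_comp; [exact: measurable_inv_branch|apply: measurableT_comp (IH _) _].
- apply: measurableT_comp; first exact: measurable_inv_branch.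
  by apply: measurableT_comp (IH _) _; exact: measurable_funB.
Qed.

Local Notation P0 := (@uniform_prob R 0 1 ltr01).

Lemma code_halving s (H : R -> \bar R) : measurable_fun setT H ->
  (forall x, 0 <= H x)%E ->
  (\int[P0]_u H (code s u) =
    2^-1%:E * \int[P0]_u H (inv_branch (gamma s.+1) false (code s.+1 u)) +
    2^-1%:E * \int[P0]_u H (inv_branch (gamma s.+1) true (code s.+1 u)))%E.
Proof.
move=> mH H0.
have mb b : measurable_fun setT
    (fun u => H (inv_branch (gamma s.+1) b (code s.+1 u))).
  apply: (measurableT_comp mH); apply: measurableT_comp.
    exact: measurable_inv_branch.
  exact: measurable_code.
apply: uniform_halving => //.
- by apply: (measurableT_comp mH); exact: measurable_code.
- move=> u /andP[u0 u1]; rewrite codeE ler_piMl ?invr_ge0//.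
  by rewrite mulrCA divff// mulr1.
- move=> u /andP[u0 u1]; rewrite codeE ifF; last by apply/negP; lra.
  by congr (H (inv_branch _ _ (code _ _))); field.
Qed.

(** * The potential of the self-similar measure *)

(** Without truncation this follows from [(w - v_0) (w - v_1) = g (f w - v)] for the
    two inverse images [v_0], [v_1] of [v]. One of them is at distance [1 / 4] or more
    from [w], and [g <= 1 / 4], so that truncating the distance to the other one
    costs no more than truncating [|f w - v|]. *)
Lemma tker_branches g M w v : 0 < g <= 32^-1 -> 0 <= M ->
  -1 <= w <= 0 -> -1 <= v <= 0 ->
  tker M w (inv_branch g false v) + tker M w (inv_branch g true v) <=
    ln g^-1 + tker M (Num.max (-1) (branch_map g w)) v.
Proof.
move=> hg' M0 hw hv; have /andP[g0 g1] := hg'.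
have h0 := inv_branch_side hg' false hv; have h1 := inv_branch_side hg' true hv.
have i0 := inv_branch_itv hg' false hv; have i1 := inv_branch_itv hg' true hv.
have e0 := inv_branchK hg' false hv.
have fw0 : branch_map g w <= 0.
  rewrite /branch_map pmulr_lle0 ?invr_gt0//; nra.
set a := inv_branch g false v in h0 i0 e0 *.
set b := inv_branch g true v in h1 i1 *.
have sum_ab : a + b = -1 by rewrite /a /b /inv_branch; field.
have prodE : (w - a) * (w - b) = g * (branch_map g w - v).
  have := branch_mapE hg' w; have := branch_mapE hg' a; rewrite e0 => ea ew.
  rewrite [RHS]mulrBr -ea -ew; have -> : b = -1 - a by lra.
  by ring.
have eps1 : expR (- M) <= 1 by rewrite -expR0 ler_expR oppr_le0.
have eps0 := expR_gt0 (- M).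
have tE x : -1 <= x <= 0 -> tker M w x = - ln (Num.max (expR (- M)) `|w - x|).
  move=> hx; rewrite /tker; apply/max_idPr; rewrite oppr_ge0 ln_le0//.
  by rewrite ge_max eps1 ler_norml; lra.
rewrite !tE//.
set A := Num.max _ `|w - a|; set B := Num.max _ `|w - b|.
set D := Num.max (expR (- M)) `|branch_map g w - v|.
have A0 : 0 < A by rewrite lt_max eps0.
have B0 : 0 < B by rewrite lt_max eps0.
have D0 : 0 < D by rewrite lt_max eps0.
have gD : g * D <= A * B.
  have pE : `|w - a| * `|w - b| = g * `|branch_map g w - v|.
    by rewrite -normrM prodE normrM gtr0_norm.
  have [Ae Aa] : expR (- M) <= A /\ `|w - a| <= A by rewrite !le_max !lexx orbT.
  have [Be Bb] : expR (- M) <= B /\ `|w - b| <= B by rewrite !le_max !lexx orbT.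
  have : 4^-1 <= `|w - a| \/ 4^-1 <= `|w - b|.
    case: (leP (w - b) (-(1/4))) => h; [right|left].
      by rewrite ler0_norm; lra.
    by rewrite ger0_norm; lra.
  have na := normr_ge0 (w - a); have nb := normr_ge0 (w - b).
  rewrite /D (maxr_pMr _ _ (ltW g0)) ge_max -pE.
  move=> pq; apply/andP; split; last by apply: ler_pM.
  have q0 : 0 <= 4^-1 :> R by rewrite invr_ge0.
  have : g * expR (- M) <= 4^-1 * expR (- M) by rewrite ler_pM2r//; lra.
  move=> /le_trans; apply; case: pq => h.
    by apply: ler_pM => //; exact: le_trans h Aa.
  by rewrite mulrC; apply: ler_pM => //; exact: le_trans h Bb.
have lnD : - ln A - ln B <= ln g^-1 - ln D.
  rewrite lnV ?posrE// -!opprD lerN2 -!lnM ?posrE// ler_ln ?posrE ?mulr_gt0//.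
apply: le_trans lnD _; rewrite lerD2l.
apply: (@le_trans _ _ (tker M (branch_map g w) v)).
  by rewrite /tker le_max lexx orbT.
apply: tker_anti; case: (leP (-1) (branch_map g w)) => h //.
by rewrite !ler0_norm; lra.
Qed.

Definition robin_from (s n : nat) : R :=
  \sum_(k < n) ln (gamma (s + k).+1)^-1 / 2 ^+ k.+1.

Lemma robin_from0 n : robin_from 0 n = partial_robin gamma n.
Proof. by rewrite /partial_robin big_add1 /= big_mkord. Qed.

Lemma robin_fromS s n :
  robin_from s n.+1 = 2^-1 * (ln (gamma s.+1)^-1 + robin_from s.+1 n).
Proof.
rewrite /robin_from big_ord_recl /= addn0 expr1 mulrDr [2^-1 * _]mulrC.
congr (_ + _); rewrite big_distrr /=; apply: eq_bigr => k _.
by rewrite /bump/= add1n addnS addSn [2 ^+ k.+2]exprS invfM mulrCA.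
Qed.

Lemma measurable_tker_code M w s :
  measurable_fun setT (fun u => (tker M w (code s u))%:E).
Proof.
apply/measurable_EFinP; apply: measurable_tker_comp => //.
exact: measurable_code.
Qed.

(** The truncated potentials at consecutive levels satisfy a contraction, so
    that a bound by [M] propagates to a bound by a partial sum of the Robin
    series. *)
Lemma tpotential_le M n s w : 0 <= M -> -1 <= w <= 0 ->
  (\int[P0]_u (tker M w (code s u))%:E <= (robin_from s n + M / 2 ^+ n)%:E)%E.
Proof.
move=> M0; elim: n s w => [|n IH] s w hw.
  rewrite /robin_from big_ord0 add0r expr0 divr1.
  rewrite -(integral_probability_cst P0 M); apply: ge0_le_integral => //.
  - by move=> u _; rewrite lee_fin tker_ge0.
  - exact: measurable_tker_code.
  - by move=> u _; rewrite lee_fin tker_le.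
have mt : measurable_fun setT (fun x => (tker M w x)%:E).
  by apply/measurable_EFinP; exact: measurable_tker_comp.
rewrite (@code_halving s (fun x => (tker M w x)%:E))//; last first.
  by move=> x; rewrite lee_fin tker_ge0.
have mb b : measurable_fun setT
    (fun u => (tker M w (inv_branch (gamma s.+1) b (code s.+1 u)))%:E).
  apply: (measurableT_comp mt); apply: measurableT_comp.
    exact: measurable_inv_branch.
  exact: measurable_code.
rewrite -ge0_muleDr; last 2 first.
- by apply: integral_ge0 => u _; rewrite lee_fin tker_ge0.
- by apply: integral_ge0 => u _; rewrite lee_fin tker_ge0.
rewrite -ge0_integralD//; last 4 first.
- by move=> u _; rewrite lee_fin tker_ge0.
- exact: mb.
- by move=> u _; rewrite lee_fin tker_ge0.
- exact: mb.
have lg0 : 0 <= ln (gamma s.+1)^-1 by exact: ln_gammaV_ge0.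
set w' := Num.max (-1) (branch_map (gamma s.+1) w).
have hw' : -1 <= w' <= 0.
  rewrite /w' le_max lexx ge_max lerN10 /= /branch_map.
  by have /andP[g0 _] := hg s; rewrite pmulr_lle0 ?invr_gt0//; nra.
apply: (@le_trans _ _ (2^-1%:E *
   \int[P0]_u ((ln (gamma s.+1)^-1)%:E + (tker M w' (code s.+1 u))%:E))%E).
  apply: lee_wpmul2l; first by rewrite lee_fin invr_ge0.
  apply: ge0_le_integral => //.
  - by move=> u _; rewrite -EFinD lee_fin addr_ge0 ?tker_ge0.
  - by apply: emeasurable_funD; exact: mb.
  - by apply: emeasurable_funD => //; exact: measurable_tker_code.
  - by move=> u _; rewrite -!EFinD lee_fin; apply: tker_branches => //; exact: code_itv.
rewrite ge0_integralD//; last 2 first.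
- by move=> u _; rewrite lee_fin tker_ge0.
- exact: measurable_tker_code.
rewrite integral_probability_cst robin_fromS.
have -> : 2^-1 * (ln (gamma s.+1)^-1 + robin_from s.+1 n) + M / 2 ^+ n.+1 =
    2^-1 * (ln (gamma s.+1)^-1 + (robin_from s.+1 n + M / 2 ^+ n)).
  by rewrite exprS invfM; ring.
rewrite EFinM EFinD; apply: lee_wpmul2l; first by rewrite lee_fin invr_ge0.
by apply: leeD2l; exact: IH.
Qed.

(** The depth [n] in [tpotential_le] tends to infinity first, then the truncation
    level. *)
Theorem code_potential_le (V : R) y : (forall n, partial_robin gamma n <= V) ->
  0 <= y <= 1 -> (\int[P0]_u logker y (1 + code 0 u) <= V%:E)%E.
Proof.
move=> hV hy; apply: logker_le_lim.
  by apply: measurable_funD => //; exact: measurable_code.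
move=> M; apply/lee_addgt0Pr => e e0.
have [n hn] : exists n : nat, M%:R / 2 ^+ n <= e.
  exists (Num.truncn (M%:R / e)).+1; rewrite ler_pdivrMr ?exprn_gt0//.
  rewrite mulrC -ler_pdivrMr//; apply: le_trans (ltW (truncnS_gt _)) _.
  by rewrite -natrX ler_nat ltnW// ltn_expl.
have -> : (fun u => (tker M%:R y (1 + code 0 u))%:E) =
    (fun u => (tker M%:R (y - 1) (code 0 u))%:E).
  by apply/funext => u; rewrite /tker opprD addrA.
have hy' : -1 <= y - 1 <= 0 by lra.
apply: le_trans (tpotential_le n 0 (ler0n _ M) hy') _.
by rewrite -EFinD lee_fin robin_from0 lerD.
Qed.

(** * The masses of short intervals *)

Lemma inv_branch_preimage_measurable s b (J : set R) : measurable J ->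
  measurable ((fun u => inv_branch (gamma s.+1) b (code s.+1 u)) @^-1` J).
Proof.
move=> mJ; rewrite -[_ @^-1` _]setTI.
have : measurable_fun setT (fun u => inv_branch (gamma s.+1) b (code s.+1 u)).
  by apply: measurableT_comp; [exact: measurable_inv_branch|exact: measurable_code].
by apply.
Qed.

Lemma code_mass_halving s (J : set R) : measurable J ->
  (P0 (code s @^-1` J) =
   2^-1%:E * P0 ((fun u => inv_branch (gamma s.+1) false (code s.+1 u)) @^-1` J) +
   2^-1%:E * P0 ((fun u => inv_branch (gamma s.+1) true (code s.+1 u)) @^-1` J))%E.
Proof.
move=> mJ.
have mc : measurable (code s @^-1` J).
  by rewrite -[_ @^-1` _]setTI; exact: measurable_code.
have iE (h : R -> R) : measurable (h @^-1` J) ->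
    (P0 (h @^-1` J) = \int[P0]_u (\1_J (h u))%:E)%E.
  by move=> mh; rewrite -[h @^-1` J]setIT -integral_indic.
rewrite !iE//; first apply: (@code_halving s (fun x => (\1_J x)%:E)).
- exact/measurable_EFinP/measurable_indic.
- by move=> x; rewrite lee_fin.
- exact: inv_branch_preimage_measurable.
- exact: inv_branch_preimage_measurable.
Qed.

(** Such a set is too short to meet both halves of the Cantor set, which carry mass
    [1 / 2] each, and on one half it is stretched to a set of the same kind for the
    next level. *)
Lemma code_mass_le n s (J : set R) : measurable J ->
  (forall x y, J x -> J y -> `|x - y| <= 2 * ratio_prod gamma s n) ->
  (P0 (code s @^-1` J) <= (2^-1 ^+ n)%:E)%E.
Proof.
elim: n s J => [|n IH] s J mJ hJ.
  rewrite expr0; apply: probability_le1.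
  by rewrite -[_ @^-1` _]setTI; exact: measurable_code.
rewrite code_mass_halving//.
have one b : (P0 ((fun u => inv_branch (gamma s.+1) b (code s.+1 u)) @^-1` J)
    <= (2^-1 ^+ n)%:E)%E.
  have mJ' : measurable (`[-1, 0] `&` inv_branch (gamma s.+1) b @^-1` J).
    by apply: measurableI => //; rewrite -[_ @^-1` _]setTI; exact: measurable_inv_branch.
  rewrite (_ : _ @^-1` J = code s.+1 @^-1` (`[-1, 0] `&` inv_branch (gamma s.+1) b @^-1` J)).
    apply: IH => // x y /= [/= hx Jx] [/= hy Jy].
    rewrite !in_itv/= in hx hy.
    have := le_trans (inv_branch_expand (hg s) b hx hy) (hJ _ _ Jx Jy).
    by have /andP[g0 _] := hg s; rewrite ratio_prodS mulrCA ler_pM2l.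
  apply/seteqP; split => u /=; last by case.
  by split => //; rewrite in_itv/=; exact: code_itv.
have zero : exists b, P0 ((fun u => inv_branch (gamma s.+1) b (code s.+1 u)) @^-1` J) = 0%E.
  have len1 : ratio_prod gamma s n.+1 <= 32^-1.
    have /andP[g0 g1] := hg s; rewrite ratio_prodS; apply: le_trans g1.
    rewrite ger_pMr// /ratio_prod; apply: prodr_ile1 => i; have /andP[i0 i1] := hg i.
    by rewrite (ltW i0)/=; lra.
  have [[x Jx xb]|hn] := pselect (exists2 x, J x & x <= - 2^-1).
    exists true; rewrite (_ : _ @^-1` J = set0) ?measure0//.
    apply/seteqP; split => u //= Ju.
    have := inv_branch_side (hg s) true (code_itv s.+1 u).
    by have := hJ _ _ Ju Jx; rewrite ler_norml; lra.
  exists false; rewrite (_ : _ @^-1` J = set0) ?measure0//.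
  apply/seteqP; split => u //= Ju; apply: hn.
  exists (inv_branch (gamma s.+1) false (code s.+1 u)) => //.
  by have := inv_branch_side (hg s) false (code_itv s.+1 u); lra.
rewrite exprS EFinM; case: zero => -[] ->; rewrite mule0 ?add0e ?adde0;
  by apply: lee_wpmul2l; rewrite ?lee_fin ?invr_ge0.
Qed.

End coding.

(** * Hausdorff measures *)

Section distance.
Context {R : realType}.
Implicit Types z w : R * R.

Lemma distE w z : dist w z = Num.sqrt ((w.1 - z.1) ^+ 2 + (w.2 - z.2) ^+ 2).
Proof. by []. Qed.

Lemma dist_ge w z : `|w.1 - z.1| <= dist w z.
Proof.
by rewrite distE -sqrtr_sqr ler_wsqrtr// lerDl sqr_ge0.
Qed.

Lemma dist_line (x y : R) : dist (x, 0) (y, 0) = `|x - y|.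
Proof. by rewrite distE /= subrr expr0n addr0 sqrtr_sqr. Qed.

End distance.

Section hausdorff_outer.
Context {R : realType} (h : R -> R).
Hypotheses (h0 : h 0 = 0) (h_ge0 : forall t, 0 <= h t).
Implicit Types (A B : set (R * R)) (d : R).

Let hE_ge0 (r : nat -> R) n : (0 <= (h (r n))%:E)%E.
Proof. by rewrite lee_fin. Qed.

Lemma hausdorff_content_ge0 A d : (0 <= hausdorff_content h A d)%E.
Proof.
apply: le_ereal_inf_tmp => _ [z [r [_ _ ->]]].
by apply: nneseries_ge0 => n _ _; exact: hE_ge0.
Qed.

Lemma le_hausdorff_content A B d : A `<=` B ->
  (hausdorff_content h A d <= hausdorff_content h B d)%E.
Proof.
move=> AB; apply: ereal_inf_le_tmp => _ [z [r [hB hr ->]]].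
by exists z, r; split => //; exact: subset_trans hB.
Qed.

Lemma hausdorff_content_anti A d d' : d <= d' ->
  (hausdorff_content h A d' <= hausdorff_content h A d)%E.
Proof.
move=> dd; apply: ereal_inf_le_tmp => _ [z [r [hB hr ->]]].
exists z, r; split => // j; have /andP[-> /le_trans] := hr j; exact.
Qed.

Lemma cvg_hausdorff A :
  hausdorff_content h A d @[d --> 0^'+] --> hausdorff h A.
Proof.
have := @nonincreasing_at_right_cvge R (hausdorff_content h A) 0 (BInfty _ false) isT.
move=> c; apply: (cvgP _ (c _)) => x y _ _; exact: hausdorff_content_anti.
Qed.

Lemma hausdorffE A : hausdorff h A =
  ereal_sup (hausdorff_content h A @` [set d | 0 < d]).
Proof.
rewrite /hausdorff; apply/cvg_lim => //.
rewrite (_ : [set d | 0 < d] = [set` `]0, +oo[]); last first.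
  by apply/seteqP; split => x /=; rewrite in_itv/= andbT.
apply: nonincreasing_at_right_cvge => // x y _ _.
exact: hausdorff_content_anti.
Qed.

Lemma hausdorff_content_le A d : 0 < d ->
  (hausdorff_content h A d <= hausdorff h A)%E.
Proof. by move=> d0; rewrite hausdorffE; apply: ereal_sup_ubound; exists d. Qed.

Lemma hausdorff_le A (c : \bar R) :
  (forall d, 0 < d -> (hausdorff_content h A d <= c)%E) -> (hausdorff h A <= c)%E.
Proof. by move=> H; rewrite hausdorffE; apply: ge_ereal_sup => _ [d /H hd <-]. Qed.

Lemma hausdorff_ge0 A : (0 <= hausdorff h A)%E.
Proof.
exact: le_trans (hausdorff_content_ge0 A 1) (hausdorff_content_le A ltr01).
Qed.

Lemma hausdorff_set0 : hausdorff h set0 = 0%E.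
Proof.
apply/eqP; rewrite eq_le hausdorff_ge0 andbT; apply: hausdorff_le => d d0.
apply: ereal_inf_lbound; exists (fun=> 0), (fun=> 0); split => //.
  by move=> _; rewrite lexx ltW.
by rewrite eseries0// => n _ _; rewrite h0.
Qed.

Lemma le_hausdorff A B : A `<=` B -> (hausdorff h A <= hausdorff h B)%E.
Proof.
move=> AB; apply: hausdorff_le => d d0.
exact: le_trans (le_hausdorff_content _ AB) (hausdorff_content_le _ d0).
Qed.

(** Covers of the single sets, each nearly optimal, are merged into one sequence
    along a bijection between [nat] and [nat * nat]. *)
Lemma hausdorff_content_sigma_subadditive (A : (set (R * R))^nat) d :
  (hausdorff_content h (\bigcup_n A n) d <=
    \sum_(n <oo) hausdorff_content h (A n) d)%E.
Proof.
have [[i ioo]|] := pselect (exists i, hausdorff_content h (A i) d = +oo%E).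
  rewrite (eseries_pinfty _ _ ioo) ?leey// => n _.
  by rewrite -ltNye (lt_le_trans _ (hausdorff_content_ge0 _ _)).
rewrite -forallNE => Aoo.
apply/lee_addgt0Pr => _/posnumP[e].
rewrite (le_trans _ (epsilon_trick _ _ _))//; last first.
  by move=> n; exact: hausdorff_content_ge0.
pose Q n (zr : (nat -> R * R) * (nat -> R)) :=
  [/\ A n `<=` \bigcup_j disk (zr.1 j) (zr.2 j), forall j, 0 <= zr.2 j <= d &
   (\sum_(0 <= j <oo) (h (zr.2 j))%:E <=
      hausdorff_content h (A n) d + (e%:num / (2 ^ n.+1)%:R)%:E)%E].
have [G PG] : {G : nat -> (nat -> R * R) * (nat -> R) & forall n, Q n (G n)}.
  apply: (@choice _ _ Q) => n; rewrite /Q /hausdorff_content.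
  set S := (X in ereal_inf X).
  have infS : ereal_inf S \is a fin_num.
    rewrite ge0_fin_numE; last exact: hausdorff_content_ge0.
    by rewrite ltey; apply/eqP; exact: Aoo.
  have en1 : (0 < e%:num / (2 ^ n.+1)%:R)%R by [].
  have [_ [z [r [hA hr ->]]] hs] := lb_ereal_inf_adherent en1 infS.
  by exists (z, r); split => //; exact: ltW.
pose F (i : nat * nat) : \bar R := (h ((G i.1).2 i.2))%:E.
have F0 i : (0 <= F i)%E by rewrite lee_fin.
apply: (@le_trans _ _ (\esum_(i in setT) F i)).
  apply: ereal_inf_lbound => /=.
  have /card_esym/ppcard_eqP[f] := card_nat2.
  exists (fun k => (G (f k).1).1 (f k).2), (fun k => (G (f k).1).2 (f k).2); split.
  - move=> t [n _ Ant]; have [hA _ _] := PG n; have [j _ tj] := hA _ Ant.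
    by exists (f^-1%FUN (n, j)) => //=; rewrite invK ?inE.
  - by move=> j; have [_ hr _] := PG (f j).1.
  - rewrite -(esum_pred_image F _ xpredT) ?[fun=> _]set_true//.
    congr esum; apply/seteqP; split => // t _.
    by exists (f^-1%FUN t) => //; rewrite invK ?inE.
rewrite (_ : esum _ _ = \sum_(i <oo) \sum_(j <oo) F (i, j))%E; last first.
  pose J : nat -> set (nat * nat) := fun i => [set (i, j) | j in setT].
  rewrite (_ : setT = \bigcup_k J k); last first.
    by rewrite predeqE => -[a b]; split => // _; exists a => //; exists b.
  rewrite esum_bigcupT /=; last 2 first.
    - apply/trivIsetP => i j _ _ ij.
      rewrite predeqE => -[n m] /=; split => //= -[] [_] _ [<-{n} _].
      by move=> [m' _] [] /esym/eqP; rewrite (negbTE ij).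
    - by move=> /= [n m]; exact: F0.
  rewrite (_ : setT = id @` xpredT); last by rewrite image_id funeqE => x; rewrite trueE.
  rewrite esum_pred_image//; last by move=> n _; exact: esum_ge0.
  apply: eq_eseriesr => /= j _.
  rewrite -(esum_pred_image F (pair j) predT)//=; last by move=> n m _ _; move=> [].
  by congr esum; rewrite predeqE => -[a b]; split; move=> [i _ <-]; exists i.
apply: lee_nneseries => [n _ _|n _].
  by apply: nneseries_ge0 => m _ _; exact: F0.
by have [_ _] := PG n.
Qed.

Lemma hausdorff_sigma_subadditive (A : (set (R * R))^nat) :
  (hausdorff h (\bigcup_n A n) <= \sum_(n <oo) hausdorff h (A n))%E.
Proof.
apply: hausdorff_le => d d0.
apply: le_trans (hausdorff_content_sigma_subadditive _ _) _.
apply: lee_nneseries => n *; [exact: hausdorff_content_ge0|].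
exact: hausdorff_content_le.
Qed.

(** Small disks do not meet two sets at positive distance from each other, so
    that a fine cover of the union splits into covers of the two sets. *)
Lemma hausdorff_separated A B (eps : R) : 0 < eps ->
  (forall a b, A a -> B b -> 2 * eps <= `|a.1 - b.1|) ->
  (hausdorff h A + hausdorff h B <= hausdorff h (A `|` B))%E.
Proof.
move=> eps0 hAB.
have key d : 0 < d <= eps -> (hausdorff_content h A d + hausdorff_content h B d <=
    hausdorff_content h (A `|` B) d)%E.
  move=> /andP[d0 de]; apply: le_ereal_inf_tmp => _ [z [r [hz hr ->]]].
  pose rA j := if pselect (exists2 a, A a & disk (z j) (r j) a) then r j else 0.
  pose rB j := if pselect (exists2 b, B b & disk (z j) (r j) b) then r j else 0.
  have rE (C : set (R * R)) : let rC j :=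
      if pselect (exists2 a, C a & disk (z j) (r j) a) then r j else 0 in
      C `<=` A `|` B ->
      (hausdorff_content h C d <= \sum_(0 <= j <oo) (h (rC j))%:E)%E.
    move=> rC CAB; apply: ereal_inf_lbound; exists z, rC; split => //.
    - move=> c Cc; have [j _ cj] := hz _ (CAB _ Cc).
      exists j => //; rewrite /rC; case: (pselect _) => // -[].
      by exists c.
    - move=> j; rewrite /rC; case: (pselect _) => _ /=; first exact: hr.
      by rewrite lexx ltW.
  apply: (@le_trans _ _ (\sum_(0 <= j <oo) (h (rA j))%:E +
      \sum_(0 <= j <oo) (h (rB j))%:E)%E).
    by apply: leeD; [apply: (rE A) => ?; left|apply: (rE B) => ?; right].
  rewrite -nneseriesD//.
  apply: lee_nneseries => [j _ _|j _]; first by rewrite adde_ge0.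
  rewrite -EFinD lee_fin /rA /rB.
  case: (pselect (exists2 a, A a & _)) => [[a Aa az]|_] /=;
    case: (pselect (exists2 b, B b & _)) => [[b Bb bz]|_] /=; rewrite ?h0 ?addr0 ?add0r//.
  exfalso; have := hAB _ _ Aa Bb.
  have := ler_distD (z j).1 a.1 b.1; rewrite (distrC (z j).1 b.1).
  have := dist_ge a (z j); have := dist_ge b (z j).
  by rewrite /disk/= in az bz; have /andP[_ rd] := hr j; lra.
have cS : hausdorff_content h A d + hausdorff_content h B d @[d --> 0^'+]
    --> (hausdorff h A + hausdorff h B)%E.
  by apply: cvgeD; [by apply: ge0_adde_def; rewrite inE hausdorff_ge0|exact: cvg_hausdorff|exact: cvg_hausdorff].
rewrite -(cvg_lim _ cS)// -(cvg_lim _ (@cvg_hausdorff (A `|` B)))//.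
apply: lee_lim; [exact: (cvgP _ cS)|exact: (cvgP _ (@cvg_hausdorff _))|].
near=> d; apply: key; apply/andP; split.
  by near: d; exact: nbhs_right_gt.
by near: d; exact: nbhs_right_le.
Unshelve. all: by end_near. Qed.

End hausdorff_outer.

Section hausdorff_line.
Context {R : realType} (h : R -> R) (C : set R).
Hypotheses (h0 : h 0 = 0) (h_ge0 : forall t, 0 <= h t).
Hypothesis closedC : closed C.
Hypothesis gapC : forall x y : R, x < y -> exists2 z, x < z < y & ~ C z.

Definition line_point (x : R) : R * R := (x, 0).

(** The Hausdorff measure of a set on the real axis, restricted to the carrier [C],
    as a function of subsets of the line. *)
Definition hausdorff_on (A : set R) : \bar R :=
  hausdorff h (line_point @` (A `&` C)).

Let mu0 : hausdorff_on set0 = 0%E.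
Proof. by rewrite /hausdorff_on set0I image_set0 hausdorff_set0. Qed.

Let mu_ge0 A : (0 <= hausdorff_on A)%E.
Proof. exact: hausdorff_ge0. Qed.

Let mu_le : {homo hausdorff_on : A B / A `<=` B >-> (A <= B)%E}.
Proof.
move=> A B AB; apply: le_hausdorff => //; apply: image_subset.
by move=> x [Ax Cx]; split => //; exact: AB.
Qed.

Let mu_sub : sigma_subadditive hausdorff_on.
Proof.
move=> A.
apply: le_trans (hausdorff_sigma_subadditive h_ge0 (fun n => line_point @` (A n `&` C))).
apply: le_hausdorff => //.
by move=> _ [x [[n _ Ax] Cx] <-]; exists n => //; exists x.
Qed.

HB.instance Definition _ := isOuterMeasure.Build R R hausdorff_on
  mu0 mu_ge0 mu_le mu_sub.

(** A closed carrier that misses [a] has a gap around [a]. *)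
Let caratheodory_ray a : ~ C a -> hausdorff_on.-caratheodory `]-oo, a[.
Proof.
move=> nCa; have [e /= e0 he] : exists2 e, 0 < e & ball a e `<=` ~` C.
  have : nbhs a (~` C) by apply: open_nbhs_nbhs; split => //; exact: closed_openC.
  by move=> /nbhs_ballP[e e0 he]; exists e.
apply: (le_caratheodory_measurable (mu := hausdorff_on)) => X.
change (hausdorff h (line_point @` (X `&` `]-oo, a[ `&` C)) +
  hausdorff h (line_point @` (X `&` ~` `]-oo, a[ `&` C)) <=
  hausdorff h (line_point @` (X `&` C)))%E.
set A := line_point @` _; set B := line_point @` (_ `&` C).
have -> : line_point @` (X `&` C) = A `|` B.
  rewrite -image_setU; congr image; apply/seteqP; split => x /=; rewrite in_itv/=.
    by move=> [Xx Cx]; case: (ltP x a) => xa; [left|right].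
  by case=> -[[]].
apply: (@hausdorff_separated _ _ h0 h_ge0 _ _ e) => //.
move=> _ _ [x [[_ xa] Cx] <-] [y [[_ ya] Cy] <-] /=.
rewrite /= in_itv/= in xa; move: ya; rewrite /= in_itv/= => /negP; rewrite -leNgt => ya.
have far z : C z -> e <= `|a - z|.
  by move=> Cz; rewrite leNgt; apply/negP => az; exact: (he z).
have := far _ Cx; have := far _ Cy.
by rewrite ler0_norm ?subr_le0// gtr0_norm ?subr_gt0// ler0_norm; lra.
Qed.

(** The complement of the carrier is dense, so every ray is a union of rays that
    end outside it and split the carrier into two separated parts. *)
Lemma hausdorff_on_caratheodory (A : set R) : measurable A ->
  hausdorff_on.-caratheodory A.
Proof.
move=> mA; have {mA} : (@RGenInftyO.G R).-sigma.-measurable A.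
  by rewrite -RGenInftyO.measurableE.
move: A.
apply: smallest_sub; last first.
  move=> _ [a ->] /=.
  have [b hb] : {b : nat -> R & forall n, a - n.+1%:R^-1 < b n < a /\ ~ C (b n)}.
    apply: (@choice _ _ (fun n x => a - n.+1%:R^-1 < x < a /\ ~ C x)) => n.
    have [|z z1 z2] := gapC (x := a - n.+1%:R^-1) (y := a); last by exists z.
    by rewrite ltrBlDr ltrDl invr_gt0.
  rewrite (_ : `]-oo, a[%classic = \bigcup_n `]-oo, b n[%classic); last first.
    apply/seteqP; split => x /=; rewrite in_itv/=.
      move=> xa; have d0 : 0 < a - x by rewrite subr_gt0.
      exists (Num.truncn (a - x)^-1) => //=; rewrite in_itv/=.
      have [/andP[h1 _] _] := hb (Num.truncn (a - x)^-1).
      apply: le_lt_trans h1; rewrite lerBrDr -lerBrDl.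
      rewrite -[leRHS]invrK lef_pV2 ?posrE ?invr_gt0//.
      by apply/ltW; exact: truncnS_gt.
    by move=> [n _]; have [/andP[_ h2] _] := hb n; rewrite /= in_itv/= => /lt_trans; exact.
  apply: caratheodory_measurable_bigcup => n; apply: caratheodory_ray.
  by have [] := hb n.
split.
- exact: caratheodory_measurable_set0.
- by move=> B mB; rewrite setTD; exact: caratheodory_measurable_setC.
- by move=> F mF; exact: caratheodory_measurable_bigcup.
Qed.

Lemma hausdorff_on_sigma_additive : semi_sigma_additive (hausdorff_on : set R -> _).
Proof.
move=> F mF tF mUF.
apply: (@caratheodory_measure_sigma_additive R R hausdorff_on F) => //.
  by move=> n; exact: hausdorff_on_caratheodory.
exact: hausdorff_on_caratheodory.
Qed.

End hausdorff_line.

(** * The dimension function *)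

Section dimension.
Context {R : realType} (gamma : nat -> R).
Hypothesis hgamma : forall s : nat, (1 <= s)%N -> 0 < gamma s <= 32^-1.
Local Notation P0 := (@uniform_prob R 0 1 ltr01).

Let hg s : 0 < gamma s.+1 <= 32^-1. Proof. exact: hgamma. Qed.

Lemma deltaE n : delta gamma n = ratio_prod gamma 0 n.
Proof. by rewrite /delta /ratio_prod big_add1. Qed.

Lemma deltaS n : delta gamma n.+1 = delta gamma n * gamma n.+1.
Proof. by rewrite /delta big_nat_recr. Qed.

Lemma delta0 : delta gamma 0 = 1.
Proof. by rewrite /delta big_geq. Qed.

Lemma delta_gt0 n : 0 < delta gamma n.
Proof. by rewrite deltaE; exact: ratio_prod_gt0. Qed.

Lemma delta_add n m : delta gamma (n + m) <= delta gamma n * 32^-1 ^+ m.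
Proof.
elim: m => [|m IH]; first by rewrite addn0 expr0 mulr1.
rewrite addnS deltaS exprSr mulrA; have /andP[g0 g1] := hg (n + m).
by apply: ler_pM => //; [exact: (ltW (delta_gt0 _))|exact: (ltW g0)].
Qed.

Lemma delta_anti n m : (n <= m)%N -> delta gamma m <= delta gamma n.
Proof.
move=> /subnKC <-; apply: le_trans (delta_add _ _) _.
by rewrite ler_piMr ?(ltW (delta_gt0 _))// exprn_ile1//; lra.
Qed.

Lemma delta_small (d : R) : 0 < d -> exists n, delta gamma n < d.
Proof.
move=> d0; have [n hn] : exists n, 32^-1 ^+ n < d.
  have : (fun n => (32^-1 : R) ^+ n) @ \oo --> (0 : R).
    by apply: cvg_expr; rewrite ger0_norm; lra.
  move=> /(_ `]-oo, d[%classic) []; first by apply: lt_nbhsl.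
  by move=> n _ /(_ n (leqnn n)) hn; exists n; rewrite /= in_itv/= in hn.
exists n; apply: le_lt_trans hn.
by have := delta_add 0 n; rewrite add0n delta0 mul1r.
Qed.

Lemma dim_fun_itv t : 0 < t <= 1 -> exists s : nat,
  [/\ delta gamma s.+1 < t, t <= delta gamma s,
      2^-1 ^+ s.+1 <= dim_fun gamma t & dim_fun gamma t <= 2^-1 ^+ s].
Proof.
move=> /andP[t0 t1].
have ex : exists s, delta gamma s.+1 < t <= delta gamma s.
  have exn : exists n, delta gamma n < t by exact: delta_small.
  have := ex_minnP exn => -[[|s] hs min]; first by rewrite delta0 ltNge t1 in hs.
  exists s; rewrite hs /= leNgt; apply/negP => /min.
  by rewrite ltnn.
rewrite /dim_fun leNgt t0 t1 /= /eta.
have := xgetPex 0%N ex; set s := xget _ _ => /andP[s1 s0]; exists s; split => //.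
  rewrite -[2^-1]powR_inv1// -powR_mulrn ?powR_ge0// -powRrM mulN1r.
  apply: ler_powR; first lra.
  rewrite lerN2 -natr1 lerD2l ler_pdivrMr ?mul1r; last first.
    rewrite ln_gt0// ltr_pdivlMr ?mul1r ?delta_gt0//.
    by apply: lt_le_trans s0.
  rewrite ler_ln ?posrE ?divr_gt0 ?delta_gt0// ler_pM2l ?delta_gt0//.
  by rewrite lef_pV2 ?posrE ?delta_gt0// ltW.
rewrite -[2^-1]powR_inv1// -powR_mulrn ?powR_ge0// -powRrM mulN1r.
apply: ler_powR; first lra.
rewrite lerN2 lerDl divr_ge0// ln_ge0//; rewrite ler_pdivlMr ?mul1r ?delta_gt0//.
by apply: le_trans s0; exact: ltW.
Qed.

Lemma dim_fun0 : dim_fun gamma 0 = 0.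
Proof. by rewrite /dim_fun lexx. Qed.

Lemma dim_fun_ge0 t : 0 <= dim_fun gamma t.
Proof. by rewrite /dim_fun; case: ifP => // _; case: ifP => // _; exact: powR_ge0. Qed.

Lemma dim_fun_delta n : dim_fun gamma (delta gamma n) <= 2^-1 ^+ n.
Proof.
have [|s [s1 _ _ hs]] := @dim_fun_itv (delta gamma n).
  by rewrite delta_gt0 -delta0 delta_anti.
apply: le_trans hs _; apply: ler_wiXn2l; [lra|lra|].
by rewrite leqNgt; apply/negP => /delta_anti; rewrite leNgt s1.
Qed.

(** If [delta s.+1 < r <= delta s], then the strip has mass at most [2 ^ - s], while
    [dim_fun gamma r] is at least [2 ^ - (s + 1)]. *)
Lemma code_strip_le (z r : R) : 0 <= r ->
  (P0 ((fun u => 1 + code gamma 0 u)%R @^-1` `](z - r)%R, (z + r)%R[) <=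
   (2 * dim_fun gamma r)%:E)%E.
Proof.
move=> r0; have E : (fun u => 1 + code gamma 0 u) @^-1` `]z - r, z + r[ =
    code gamma 0 @^-1` `]z - r - 1, z + r - 1[.
  by apply/seteqP; split => u /=; rewrite !in_itv/=; lra.
rewrite E; have mI : measurable (`]z - r - 1, z + r - 1[%classic : set R) by [].
move: r0; rewrite le_eqVlt => /predU1P[r0|r0].
  rewrite set_itv_ge ?preimage_set0 ?measure0 ?lee_fin ?mulr_ge0 ?dim_fun_ge0//.
  by rewrite bnd_simp -r0 subr0 addr0 ltxx.
have [r1|r1] := leP r 1; last first.
  apply: (@le_trans _ _ 1%E).
    by apply: probability_le1; rewrite -[_ @^-1` _]setTI; exact: measurable_code.
  by rewrite lee_fin /dim_fun (leNgt r 0) r0 (leNgt r 1) r1/=; lra.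
have [|s [_ rs hs _]] := @dim_fun_itv r; first by rewrite r0 r1.
apply: le_trans (code_mass_le hgamma (n := s) mI _) _.
  move=> x y; rewrite /= !in_itv/= -deltaE => /andP[x1 x2] /andP[y1 y2].
  by rewrite ler_norml; lra.
by rewrite lee_fin; move: hs; rewrite exprS; lra.
Qed.

(** The mass distribution principle: the vertical strips around the disks of a cover
    have total mass at most twice the sum that defines the Hausdorff content. *)
Lemma code_le_hausdorff (A : set R) : measurable A ->
  (P0 ((fun u => 1 + code gamma 0 u)%R @^-1` A) <=
   2%:E * hausdorff (dim_fun gamma) (line_point @` (A `&` cantor_set gamma)))%E.
Proof.
move=> mA; have mX : measurable_fun setT (fun u => 1 + code gamma 0 u).
  by apply: measurable_funD => //; exact: measurable_code.
have mpre (B : set R) : measurable B ->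
    measurable ((fun u => 1 + code gamma 0 u) @^-1` B).
  by move=> mB; rewrite -[_ @^-1` _]setTI; exact: mX.
apply: (@le_trans _ _ (2%:E * hausdorff_content (dim_fun gamma)
    (line_point @` (A `&` cantor_set gamma)) 1)%E); last first.
  by apply: lee_wpmul2l => //; apply: hausdorff_content_le.
rewrite -lee_pdivrMl//.
apply: le_ereal_inf_tmp => _ [z [r [hz hr ->]]].
rewrite lee_pdivrMl// -nneseriesZl//; last first.
  by move=> i _; rewrite lee_fin dim_fun_ge0.
pose S j := (fun u => 1 + code gamma 0 u) @^-1` `](z j).1 - r j, (z j).1 + r j[.
have mS j : measurable (S j) by apply: mpre.
apply: (@le_trans _ _ (\sum_(0 <= j <oo) P0 (S j))%E).
  apply: measure_sigma_subadditive => //; first exact: mpre.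
  move=> u /= Au; have : A (1 + code gamma 0 u) /\ cantor_set gamma (1 + code gamma 0 u).
    split => //; apply/cantor_setE => //; rewrite [X in trapped _ _ X](_ : _ = code gamma 0 u).
      exact: code_trapped.
    by ring.
  move=> hu; have [j _ dj] := hz (line_point (1 + code gamma 0 u)) (ex_intro2 _ _ _ hu erefl).
  exists j => //; rewrite /S /= in_itv/=.
  by have := le_lt_trans (dist_ge _ _) dj; rewrite /= ltr_norml; lra.
apply: lee_nneseries => j *; first exact: measure_ge0.
by rewrite -EFinM; apply: code_strip_le; have /andP[] := hr j.
Qed.

(** If [32 ^ m] exceeds the distortion [expR (8 * S)], the [2 ^ (n + m)] basic
    intervals of level [n + m] are covered by disks of radius [delta gamma n], for
    each of which [dim_fun gamma] is at most [2 ^ - n]. *)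
Lemma hausdorff_cantor_lty :
  (\sum_(1 <= s <oo) (gamma s)%:E < +oo)%E ->
  (hausdorff (dim_fun gamma) (line_point @` cantor_set gamma) < +oo)%E.
Proof.
move=> hsum; pose S := fine (\sum_(1 <= s <oo) (gamma s)%:E).
have g0 n : (1 <= n)%N -> true -> (0 <= (gamma n)%:E)%E.
  by move=> n1 _; rewrite lee_fin; have /andP[/ltW] := hgamma n1.
have hS n : \sum_(0 <= k < n) gamma k.+1 <= S.
  rewrite -lee_fin fineK; last first.
    by rewrite ge0_fin_numE//; apply: nneseries_ge0 => k k1 _; exact: g0.
  have := nneseries_lim_ge (n.+1) g0.
  by rewrite big_add1 /= sumEFin.
have [m hm] : exists m, expR (8 * S) * 32^-1 ^+ m < 1.
  have [m hm] : exists m, 32^-1 ^+ m < (expR (8 * S))^-1.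
    have : (fun n => (32^-1 : R) ^+ n) @ \oo --> (0 : R).
      by apply: cvg_expr; rewrite ger0_norm; lra.
    move=> /(_ `]-oo, (expR (8 * S))^-1[%classic) [].
      by apply: lt_nbhsl; rewrite invr_gt0 expR_gt0.
    by move=> n _ /(_ n (leqnn n)) hn; exists n; rewrite /= in_itv/= in hn.
  by exists m; rewrite -ltr_pdivlMl ?expR_gt0// mulr1.
apply: (@le_lt_trans _ _ (2 ^+ m)%:E); last exact: ltry.
apply: hausdorff_le => d d0; have [n hn] := delta_small d0.
have [pts [spts _ hpts]] := trapped_cover hgamma (n + m) 0.
pose r j : R := if (j < 2 ^ (n + m))%N then delta gamma n else 0.
apply: (@le_trans _ _ (\sum_(0 <= j <oo) (dim_fun gamma (r j))%:E)%E).
  apply: ereal_inf_lbound; exists (fun j => line_point (1 + nth 0 pts j)), r; split => //.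
    move=> _ [x Kx <-]; have [p pin hp] := hpts _ (proj1 (cantor_setE hgamma x) Kx).
    exists (index p pts) => //; rewrite /r -spts index_mem pin.
    rewrite /disk /= dist_line nth_index//.
    rewrite (_ : x - (1 + p) = x - 1 - p); last by ring.
    apply: le_lt_trans hp _; rewrite -deltaE add0n.
    apply: (@le_lt_trans _ _ (delta gamma n * (expR (8 * S) * 32^-1 ^+ m))).
      rewrite mulrCA [leLHS]mulrC; apply: ler_pM; rewrite ?expR_ge0 ?(ltW (delta_gt0 _))//.
        by rewrite ler_expR; have := hS (n + m)%N; lra.
      exact: delta_add.
    by rewrite -[ltRHS]mulr1 ltr_pM2l ?delta_gt0.
  move=> j; rewrite /r; case: ifP => _; last by rewrite lexx ltW.
  by rewrite !ltW ?delta_gt0.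
rewrite (nneseries_split _ (2 ^ (n + m))); last by move=> k _; rewrite lee_fin dim_fun_ge0.
rewrite eseries0 ?adde0; last first.
  by move=> k; rewrite add0n /r ltnNge => -> _; rewrite dim_fun0.
rewrite sumEFin lee_fin add0n big_nat.
apply: (@le_trans _ _ (\sum_(0 <= i < 2 ^ (n + m)) 2^-1 ^+ n)).
  rewrite [leRHS]big_nat; apply: ler_sum => i /andP[_ hi].
  by rewrite /r hi dim_fun_delta.
rewrite sumr_const_nat subn0 -[_ *+ (2 ^ _)]mulr_natl natrX exprD mulrAC -exprMn divff// expr1n mul1r.
exact: lexx.
Qed.

End dimension.

(** * Measures on the plane *)

Section null_congruence.
Local Open Scope ereal_scope.
Context d (T : measurableType d) (R : realType) (mu : {measure set T -> \bar R}).
Import HBNNSimple.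

(** The integral is a supremum over simple functions, and cutting off a simple
    function on a null set does not change its integral. *)
Lemma eq_integral_null (N : set T) (f g : T -> \bar R) : measurable N ->
  mu N = 0 -> (forall x, ~ N x -> f x = g x) ->
  \int[mu]_x f x = \int[mu]_x g x.
Proof.
move=> mN N0; have key (f1 g1 : T -> \bar R) : (forall x, 0 <= g1 x) ->
    (forall x, ~ N x -> f1 x = g1 x) ->
  ereal_sup [set sintegral mu h | h in [set h : {nnsfun T >-> R} | forall x, (h x)%:E <= f1 x]]
  <= ereal_sup [set sintegral mu h | h in [set h : {nnsfun T >-> R} | forall x, (h x)%:E <= g1 x]].
  move=> g0 fg; apply: ge_ereal_sup => _ [h hf <-].
  apply: ereal_sup_ubound; exists (proj_nnsfun h (measurableC mN)).
    move=> x /=; rewrite mindicE; case: (asboolP ((~` N) x)) => Nx.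
      by rewrite mem_set// mulr1 -fg.
    by rewrite memNset// mulr0.
  rewrite -[LHS]integralT_nnsfun -[RHS]integralT_nnsfun.
  apply: ge0_ae_eq_integral => //.
  - exact/measurable_EFinP.
  - exact/measurable_EFinP.
  - by move=> x _; rewrite lee_fin.
  - by move=> x _; rewrite lee_fin.
  exists N; split => // x /= hx; apply: contrapT => Nx; apply: hx => _.
  by rewrite mindicE mem_set// mulr1.
move=> fg; rewrite /integral; congr (_ - _); apply/eqP; rewrite eq_le; apply/andP; split;
  apply: key => x; rewrite ?patch_setT; try exact: funepos_ge0; try exact: funeneg_ge0;
  by move=> Nx; rewrite ?funeposE ?funenegE ?patch_setT fg.
Qed.

End null_congruence.

Section plane_topology.
Context {R : realType}.
Implicit Types (U A : set (R * R)) (mu : {measure set (plane R) -> \bar R}).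

(** A countable base of the plane by measurable rectangles. *)
Definition rational_square (n : nat) : set (R * R) :=
  if unpickle n is Some q then
    let: (a, b, k) := q : rat * rat * nat in
    `]ratr a - k.+1%:R^-1, ratr a + k.+1%:R^-1[ `*`
    `]ratr b - k.+1%:R^-1, ratr b + k.+1%:R^-1[
  else set0.

Lemma measurable_rational_square n : measurable (rational_square n : set (plane R)).
Proof.
rewrite /rational_square; case: unpickle => [[[a b] k]|] //.
exact: measurableX.
Qed.

Lemma rational_square_base U z : open U -> U z ->
  exists2 n, rational_square n z & rational_square n `<=` U.
Proof.
move=> oU Uz; have /nbhs_ballP[e /= e0 he] : nbhs z U by exact: open_nbhs_nbhs.
have [k hk] : exists k : nat, 2 * k.+1%:R^-1 < e.
  exists (Num.truncn (2 / e)); rewrite -ltr_pdivlMl ?invr_gt0//.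
  rewrite -[ltRHS]invrK ltf_pV2 ?posrE ?ltr0n// ?invr_gt0 ?mulr_gt0 ?invr_gt0//.
  by rewrite invfM invrK mulrC; exact: truncnS_gt.
have ex (x : R) : exists a : rat, x - k.+1%:R^-1 < ratr a < x + k.+1%:R^-1.
  have [|a] := @rat_in_itvoo R (x - k.+1%:R^-1) (x + k.+1%:R^-1).
    by rewrite ltrBlDr -addrA ltrDl addr_gt0 ?invr_gt0.
  by rewrite in_itv/=; exists a.
have [a ha] := ex z.1; have [b hb] := ex z.2.
exists (pickle (a, b, k)); rewrite /rational_square pickleK.
  move: ha hb; move: (ratr a : R) (ratr b : R) => c d hc hd.
  move: hc hd; move: (k.+1%:R^-1) => r hc hd.
  by split; rewrite /= in_itv/=; lra.
move: ha hb; move: (ratr a : R) (ratr b : R) => c d hc hd.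
move: hc hd hk; move: (k.+1%:R^-1) => r hc hd hk.
move=> w [/=]; rewrite !in_itv/= => h1 h2; apply: he.
by split; rewrite /ball/= ltr_norml; lra.
Qed.

Lemma open_measurable_plane U : open U -> measurable (U : set (plane R)).
Proof.
move=> oU; rewrite (_ : U = \bigcup_(n in [set n | rational_square n `<=` U]) rational_square n).
  by apply: bigcup_measurable => n _; exact: measurable_rational_square.
apply/seteqP; split => [z Uz|z [n hn]]; last exact: hn.
by have [n nz nU] := rational_square_base oU Uz; exists n.
Qed.

Lemma closed_measurable_plane A : closed A -> measurable (A : set (plane R)).
Proof.
by move=> /closed_openC/open_measurable_plane/measurableC; rewrite setCK.
Qed.

Lemma closed_support mu : closed (Defs.support mu).
Proof.
rewrite -[Defs.support mu]setCK; apply: open_closedC; rewrite openE => z.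
rewrite /interior /= => nz; rewrite nbhsE.
have [U [oU Uz nU]] : exists U, [/\ open U, U z & ~ (0 < mu U)%E].
  apply: contrapT => h; apply: nz => U oU Uz; apply: contrapT => nU; apply: h.
  by exists U.
by exists U; [split|move=> w Uw hw; apply: nU; exact: hw].
Qed.

(** The complement of the support is covered by null sets of a countable base. *)
Lemma null_compl_support mu : mu (~` Defs.support mu) = 0%E.
Proof.
pose N n := if pselect (mu (rational_square n) = 0%E) then rational_square n else set0.
have mN n : measurable (N n : set (plane R)).
  by rewrite /N; case: (pselect _) => _ //=; exact: measurable_rational_square.
have N0 n : mu (N n) = 0%E by rewrite /N; case: (pselect _) => //= _.
have mS : measurable (~` Defs.support mu : set (plane R)).
  by apply: measurableC; apply: closed_measurable_plane; exact: closed_support.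
apply/eqP; rewrite eq_le measure_ge0 andbT.
apply: (@le_trans _ _ (\sum_(0 <= n <oo) mu (N n))%E); last first.
  by rewrite eseries0.
apply: measure_sigma_subadditive => // z /= nz.
have [U [oU Uz nU]] : exists U, [/\ open U, U z & ~ (0 < mu U)%E].
  apply: contrapT => h; apply: nz => U oU Uz; apply: contrapT => nU; apply: h.
  by exists U.
have [n nz' nU'] := rational_square_base oU Uz; exists n => //; rewrite /N.
case: (pselect _) => //=; apply.
apply/eqP; rewrite eq_le measure_ge0 andbT.
apply: (@le_trans _ _ (mu U)); last by rewrite leNgt; apply/negP.
apply: le_measure; rewrite ?inE//; first exact: measurable_rational_square.
exact: open_measurable_plane.
Qed.

Lemma null_compl mu A : closed A -> Defs.support mu `<=` A -> mu (~` A) = 0%E.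
Proof.
move=> cA sA; apply/eqP; rewrite eq_le measure_ge0 andbT -(null_compl_support mu).
apply: le_measure; rewrite ?inE; last exact: subsetC.
  by apply: measurableC; exact: closed_measurable_plane.
by apply: measurableC; apply: closed_measurable_plane; exact: closed_support.
Qed.

Lemma support_sub mu A : closed A -> mu (~` A) = 0%E -> Defs.support mu `<=` A.
Proof.
move=> cA A0 z hz; apply: contrapT => nz.
by have := hz _ (closed_openC cA) nz; rewrite A0 ltxx.
Qed.

End plane_topology.

(** * Logarithmic energy on K(gamma) *)

Section cantor_plane.
Context {R : realType} (gamma : nat -> R).
Hypothesis hgamma : forall s : nat, (1 <= s)%N -> 0 < gamma s <= 32^-1.
Local Notation C := (cantor_set gamma).

Lemma cantor_set0 : C 0.
Proof.
have h s : (pol gamma s).[0] = 0.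
  elim: s => [|s IH] /=; first by rewrite hornerM hornerX mul0r.
  by rewrite hornerM IH mul0r.
by move=> s _; rewrite /level_set /= h.
Qed.

Lemma closed_K : closed (K gamma).
Proof.
rewrite (_ : K gamma = fst @^-1` C `&` snd @^-1` [set 0]); last first.
  by apply/seteqP; split => z.
apply: closedI.
  apply: preimage_closed; last exact: cantor_set_closed.
  by move=> z _; exact: cvg_fst.
apply: preimage_closed; last exact: closed_eq.
by move=> z _; exact: cvg_snd.
Qed.

Lemma compact_K : compact (K gamma).
Proof.
have cB : compact (`[0, 1]%classic `*` `[0, 0]%classic : set (R * R)).
  by apply: compact_setX; exact: segment_compact.
apply: (subclosed_compact closed_K cB).
move=> z [Cz z0]; split; rewrite /= in_itv/=; first exact: cantor_set_itv Cz.
by rewrite z0 lexx.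
Qed.

Lemma measurable_K : measurable (K gamma : set (plane R)).
Proof. by apply: closed_measurable_plane; exact: closed_K. Qed.

(** As [0] is a point of the Cantor set, the first coordinate cut off in this way takes
    its values there everywhere, not only almost everywhere. *)
Definition cantor_coord (z : plane R) : R := z.1 * \1_C z.1.

Lemma cantor_coordE z : K gamma z -> cantor_coord z = z.1.
Proof. by move=> [Cz _]; rewrite /cantor_coord indicE mem_set// mulr1. Qed.

Lemma cantor_coord_in z : C (cantor_coord z).
Proof.
rewrite /cantor_coord indicE; case: (asboolP (C z.1)) => Cz.
  by rewrite mem_set// mulr1.
by rewrite memNset// mulr0; exact: cantor_set0.
Qed.

Lemma measurable_cantor_coord : measurable_fun setT cantor_coord.
Proof.
have mC : measurable (C : set R) by apply: closed_measurable; exact: cantor_set_closed.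
apply: measurable_funM; first exact: measurable_fst.
apply: (@measurableT_comp _ _ _ _ _ _ (\1_C : measurableTypeR R -> R) _ fst); last exact: measurable_fst.
exact: measurable_indic.
Qed.

Lemma log_kernel_cantor z w : K gamma z -> K gamma w ->
  log_kernel z w = logker (cantor_coord z) (cantor_coord w).
Proof.
move=> Kz Kw; rewrite !cantor_coordE//; move: z w Kz Kw => [x x'] [y y'].
move=> [/= Cx ->] [/= Cy ->]; rewrite /log_kernel.
have -> : ((x, 0) == (y, 0 : R)) = (x == y).
  by apply/eqP/eqP => [[]|->].
rewrite dist_line; have [->|xy] := eqVneq x y; first by rewrite /logker eqxx.
have d0 : 0 < `|x - y| by rewrite normr_gt0 subr_eq0.
rewrite logker_lnE ?lnV ?posrE//.
have := cantor_set_itv hgamma Cx; have := cantor_set_itv hgamma Cy.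
by rewrite ler_norml; lra.
Qed.

Lemma log_energyE (mu : {measure set (plane R) -> \bar R}) : mu (~` K gamma) = 0%E ->
  log_energy mu =
    (\int[mu]_z \int[mu]_w logker (cantor_coord z) (cantor_coord w))%E.
Proof.
move=> mu0; have mK := measurableC measurable_K.
apply: (eq_integral_null mK mu0) => z /contrapT Kz.
apply: (eq_integral_null mK mu0) => w /contrapT Kw.
exact: log_kernel_cantor.
Qed.

Lemma carried_by_K (mu : {measure set (plane R) -> \bar R}) E :
  E `<=` K gamma -> compactly_supported_in E mu -> mu (~` K gamma) = 0%E.
Proof.
by move=> EK [_ sE]; apply: null_compl; [exact: closed_K|exact: subset_trans EK].
Qed.

Lemma compactly_supported_K (mu : {measure set (plane R) -> \bar R}) :
  mu (~` K gamma) = 0%E -> compactly_supported_in (Defs.support mu) mu /\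
    Defs.support mu `<=` K gamma.
Proof.
move=> mu0; have sK := support_sub closed_K mu0; split => //; split => //.
exact: (subclosed_compact (@closed_support _ mu) compact_K).
Qed.

Lemma weighted_energy_ge (mu : probability (plane R) R) (f : plane R -> R) (V : R) :
  measurable_fun setT f -> (forall t, 0 <= f t) -> (\int[mu]_t (f t)%:E = 1)%E ->
  (forall e : R, 0 < e -> exists s, V - e < partial_robin gamma s.+1) ->
  (V%:E <= mutual_energy mu cantor_coord f f)%E.
Proof.
move=> mf f0 f1 hV; apply/lee_addgt0Pr => e e0; have [s hs] := hV _ e0.
apply: (@le_trans _ _ ((partial_robin gamma s.+1)%:E + e%:E)%E).
  by rewrite -EFinD lee_fin -lerBlDr ltW.
by apply: leeD2r; exact: (energy_ge_partial_robin hgamma measurable_cantor_coord cantor_coord_in).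
Qed.

Lemma log_energy_ge (mu : probability (plane R) R) s : mu (~` K gamma) = 0%E ->
  ((partial_robin gamma s.+1)%:E <= log_energy mu)%E.
Proof.
move=> mu0; rewrite log_energyE//.
have i1 : (\int[mu]_t ((cst 1 : plane R -> R) t)%:E = 1)%E by exact: integral_probability_cst.
have := energy_ge_partial_robin hgamma measurable_cantor_coord cantor_coord_in
  (measurable_cst _) (fun=> ler01) i1 s.
rewrite /wpot (eq_integral (fun z => \int[mu]_w logker (cantor_coord z) (cantor_coord w)))%E//.
by move=> z _; rewrite mule1; apply: eq_integral => w _; rewrite mule1.
Qed.

Lemma partial_robin_le n m : (n <= m)%N -> partial_robin gamma n <= partial_robin gamma m.
Proof.
move=> /subnKC <-; elim: (m - n)%N => [|k IH]; first by rewrite addn0.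
rewrite addnS; apply: le_trans IH _.
rewrite /partial_robin [leRHS]big_nat_recr//= lerDl.
by rewrite divr_ge0 ?exprn_ge0//; exact: ln_gammaV_ge0.
Qed.

Lemma min_energy_ge E s : E `<=` K gamma ->
  ((partial_robin gamma s.+1)%:E <= min_energy E)%E.
Proof.
move=> EK; apply: le_ereal_inf_tmp => _ [mu hmu <-].
by apply: log_energy_ge; exact: carried_by_K EK hmu.
Qed.

(** Were the partial sums unbounded, every probability measure on K(gamma) would have
    infinite energy. *)
Lemma non_polar_robin : non_polar (K gamma) -> exists2 V : R,
  forall n, partial_robin gamma n <= V &
  forall e : R, 0 < e -> exists s, V - e < partial_robin gamma s.+1.
Proof.
move=> hK; have [B hB] : exists B, forall s, partial_robin gamma s.+1 <= B.
  apply: contrapT => /forallNP nB; move: hK; rewrite /non_polar /capacity.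
  suff -> : min_energy (K gamma) = +oo%E by rewrite /= ltxx.
  apply/eqyP => r r0; have /existsNP[s /negP] := nB r; rewrite -ltNge => rs.
  apply: (@le_trans _ _ (partial_robin gamma s.+1)%:E); first by rewrite lee_fin ltW.
  exact: min_energy_ge.
pose S := range (fun s => partial_robin gamma s.+1).
have supS : has_sup S.
  by split; [exists (partial_robin gamma 1), 0%N|exists B => _ [s _ <-]].
exists (sup S) => [n|e e0].
  apply: le_trans (partial_robin_le (leqnSn n)) _.
  by apply: ub_le_sup; [have [] := supS|exists n].
by have [_ [s _ <-] hs] := sup_adherent e0 supS; exists s.
Qed.

Lemma robin_le_min_energy E (V : R) :
  (forall e : R, 0 < e -> exists s, V - e < partial_robin gamma s.+1) ->
  E `<=` K gamma -> (V%:E <= min_energy E)%E.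
Proof.
move=> hV EK; apply/lee_addgt0Pr => e e0; have [s hs] := hV _ e0.
apply: (@le_trans _ _ ((partial_robin gamma s.+1)%:E + e%:E)%E).
  by rewrite -EFinD lee_fin -lerBlDr ltW.
by apply: leeD2r; exact: min_energy_ge.
Qed.

Local Notation P0 := (@uniform_prob R 0 1 ltr01).

Definition code_point (u : measurableTypeR R) : plane R := line_point (1 + code gamma 0 u).

Lemma measurable_code_point : measurable_fun setT code_point.
Proof.
apply: measurable_fun_pair => //.
by apply: measurable_funD => //; exact: measurable_code.
Qed.

HB.instance Definition _ := isMeasurableFun.Build _ _ _ _ code_point measurable_code_point.

Lemma code_point_in u : K gamma (code_point u).
Proof.
split => //; apply/(cantor_setE hgamma); rewrite /= addrC addKr; exact: code_trapped.
Qed.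

Definition code_measure : probability (plane R) R := distribution P0 code_point.

Lemma code_measureE (A : set (plane R)) : code_measure A = P0 (code_point @^-1` A).
Proof. by []. Qed.

Lemma code_measure_compl : code_measure (~` K gamma) = 0%E.
Proof.
rewrite code_measureE (_ : _ @^-1` _ = set0) ?measure0//.
by apply/seteqP; split => // u /=; apply; exact: code_point_in.
Qed.

Lemma code_measure_potential_le (V y : R) : (forall n, partial_robin gamma n <= V) ->
  0 <= y <= 1 -> (\int[code_measure]_w logker y (cantor_coord w) <= V%:E)%E.
Proof.
move=> hV hy; rewrite ge0_integral_distribution//; first last.
- by move=> w; exact: logker_ge0.
- by apply: measurable_logker_comp => //; exact: measurable_cantor_coord.
apply: le_trans (code_potential_le hgamma hV hy).
rewrite le_eqVlt; apply/orP; left; apply/eqP; apply: eq_integral => u _ /=.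
by rewrite [cantor_coord (code_point u)]cantor_coordE//; exact: code_point_in.
Qed.

Lemma code_energy_le (V : R) : (forall n, partial_robin gamma n <= V) ->
  (log_energy code_measure <= V%:E)%E.
Proof.
move=> hV; rewrite log_energyE; last exact: code_measure_compl.
rewrite -(integral_probability_cst code_measure V).
apply: ge0_le_integral => //.
- by move=> z _; apply: integral_ge0 => w _; exact: logker_ge0.
- pose F (p : plane R * plane R) := logker (cantor_coord p.1) (cantor_coord p.2).
  apply: (measurable_fun_fubini_tonelli_F (m2 := code_measure) F) => //.
    apply: measurable_logker_comp; apply: measurableT_comp => //;
      exact: measurable_cantor_coord.
  by move=> [z w]; exact: logker_ge0.
move=> z _; apply: code_measure_potential_le => //.
by apply: (cantor_set_itv hgamma); exact: cantor_coord_in.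
Qed.

(** On subsets of K(gamma), the lower bound [V] for the energy is sharp as soon as one
    measure attains it. *)
Lemma min_energy_eq E (V : R) (P : probability (plane R) R) :
  (forall e : R, 0 < e -> exists s, V - e < partial_robin gamma s.+1) ->
  E `<=` K gamma -> compactly_supported_in E P -> (log_energy P <= V%:E)%E ->
  min_energy E = V%:E.
Proof.
move=> hV EK hP PV; apply/eqP; rewrite eq_le (robin_le_min_energy hV EK) andbT.
by apply: le_trans PV; apply: ereal_inf_lbound; exists P.
Qed.

End cantor_plane.

(** * Orthogonal polynomials *)

Section moment_functional.
Context d (T : measurableType d) {R : realType} (mu : {finite_measure set T -> \bar R}).
Variable X : T -> R.
Hypothesis mX : measurable_fun setT X.
Hypothesis hX : forall t, 0 <= X t <= 1.
Implicit Types p q f g : {poly R}.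

(** The inner product of [p] and [q] is the moment of [p * q]. *)
Definition moment p : R := \int[mu]_t p.[X t].

Lemma measurable_horner_comp p : measurable_fun setT (fun t => p.[X t]).
Proof.
apply: (measurableT_comp (f := horner p)) => //.
by apply: continuous_measurable_fun; exact: continuous_horner.
Qed.

Lemma integrable_horner p : mu.-integrable setT (EFin \o (fun t => p.[X t])).
Proof.
apply: measurable_bounded_integrable => //.
- by rewrite -ge0_fin_numE//; exact: fin_num_measure.
- exact: measurable_horner_comp.
exists (\sum_(i < size p) `|p`_i|); split; first by rewrite num_real.
move=> M hM t _; apply: le_trans (ltW hM).
rewrite horner_coef; apply: le_trans (ler_norm_sum _ _ _) _.
apply: ler_sum => i _; rewrite normrM ler_piMr//.
have /andP[x0 x1] := hX t.
by rewrite ger0_norm ?exprn_ge0// exprn_ile1.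
Qed.

Lemma momentD p q : moment (p + q) = moment p + moment q.
Proof.
rewrite /moment -RintegralD//; [|exact: integrable_horner..].
by congr Rintegral; apply/funext => t; rewrite hornerD.
Qed.

Lemma momentZ (c : R) p : moment (c *: p) = c * moment p.
Proof.
rewrite /moment -RintegralZl//; last exact: integrable_horner.
by congr Rintegral; apply/funext => t; rewrite hornerZ.
Qed.

Lemma momentB p q : moment (p - q) = moment p - moment q.
Proof. by rewrite -scaleN1r momentD momentZ mulN1r. Qed.

Lemma moment_le p q : (forall t, p.[X t] <= q.[X t]) -> moment p <= moment q.
Proof. by move=> h; apply: le_Rintegral => //; exact: integrable_horner. Qed.

Lemma moment_sqr_ge0 p : 0 <= moment (p * p).
Proof. by apply: Rintegral_ge0 => t _; rewrite hornerM -expr2 sqr_ge0. Qed.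

Hypothesis monic_gt0 : forall q, q \is monic -> 0 < moment (q * q).

Lemma moment_sqr_gt0 p : p != 0 -> 0 < moment (p * p).
Proof.
move=> p0; have l0 : lead_coef p != 0 by rewrite lead_coef_eq0.
rewrite -[p](scalerKV l0) -scalerAl -scalerAr !momentZ.
have : 0 < moment ((lead_coef p)^-1 *: p * ((lead_coef p)^-1 *: p)).
  by apply: monic_gt0; rewrite monicE lead_coefZ mulVf.
by move=> h; rewrite mulrA mulr_gt0// -expr2 exprn_even_gt0.
Qed.

(** Gram-Schmidt orthogonalisation of the monomials, one degree at a time. *)
Lemma projection_exists n f : exists2 g : {poly R}, (size g <= n)%N &
  forall p, (size p <= n)%N -> moment ((f - g) * p) = 0.
Proof.
elim: n f => [|n IH] f.
  exists 0; first by rewrite size_poly0.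
  move=> p; rewrite leqn0 size_poly_eq0 => /eqP ->.
  by rewrite mulr0 -(scale0r 1) momentZ mul0r.
have [h sh oh] := IH 'X^n; have [g sg og] := IH f.
pose q : {poly R} := 'X^n - h.
have szq : size q = n.+1 by rewrite size_polyDl ?size_polyXn// size_polyN ltnS.
have q0 : q != 0 by rewrite -size_poly_eq0 szq.
pose c := moment ((f - g) * q) / moment (q * q).
have sq' p : (size p <= n.+1)%N -> exists a : R, (size (p - a *: q)%R <= n)%N.
  move=> sp; exists p`_n; apply/leq_sizeP => j nj.
  rewrite coefB coefZ; move: nj; rewrite leq_eqVlt => /predU1P[<-|nj].
    by rewrite coefB coefXn eqxx (nth_default 0 sh) subr0 mulr1 subrr.
  by rewrite (nth_default 0 (leq_trans sp nj)) (nth_default 0 (s := q)) ?szq// mulr0 subr0.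
exists (g + c *: q).
  apply: leq_trans (size_polyD _ _) _; rewrite geq_max (leq_trans sg)//=.
  by rewrite (leq_trans (size_scale_leq _ _))// szq.
have oq p : (size p <= n)%N -> moment ((f - (g + c *: q)) * p) = 0.
  move=> sp; rewrite (_ : _ * p = (f - g) * p - c *: (q * p)).
    by rewrite momentB momentZ og// oh// mulr0 subr0.
  by rewrite -!mul_polyC; ring.
move=> p /sq' [a sa].
rewrite (_ : (f - (g + c *: q)) * p = (f - (g + c *: q)) * (p - a *: q) +
    a *: ((f - g) * q - c *: (q * q))).
  rewrite momentD oq// momentZ momentB momentZ /c divfK ?subrr ?mulr0 ?addr0//.
  by rewrite gt_eqF// moment_sqr_gt0.
by rewrite -!mul_polyC; ring.
Qed.

Lemma monic_orthogonal : exists q : nat -> {poly R}, forall n,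
  [/\ q n \is monic, size (q n) = n.+1 &
      forall p, (size p <= n)%N -> moment (q n * p) = 0].
Proof.
suff /choice[q hq] : forall n, exists q : {poly R}, [/\ q \is monic, size q = n.+1 &
  forall p, (size p <= n)%N -> moment (q * p) = 0] by exists q.
move=> n.
have [g sg og] := projection_exists n 'X^n; exists ('X^n - g).
have szq : size ('X^n - g)%R = n.+1 by rewrite size_polyDl ?size_polyXn// size_polyN ltnS.
split => //; rewrite monicE lead_coefE szq coefB coefXn eqxx.
by rewrite (nth_default 0 sg) subr0.
Qed.

(** Pythagoras: [t - q] has lower degree, so it is orthogonal to [q]. *)
Lemma monic_orthogonal_min (q t : {poly R}) n : q \is monic -> size q = n.+1 ->
  (forall p, (size p <= n)%N -> moment (q * p) = 0) ->
  t \is monic -> size t = n.+1 -> moment (q * q) <= moment (t * t).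
Proof.
move=> mq sq oq mt st.
rewrite (_ : t * t = q * q + 2 *: (q * (t - q)) + (t - q) * (t - q)); last first.
  by rewrite -mul_polyC; ring.
rewrite !momentD momentZ (oq (t - q)) ?mulr0 ?addr0 ?lerDl ?moment_sqr_ge0//.
apply/leq_sizeP => j nj; rewrite coefB; move: nj; rewrite leq_eqVlt => /predU1P[<-|nj].
  move: mt mq; rewrite !monicE !lead_coefE sq st /= => /eqP -> /eqP ->.
  by rewrite subrr.
by rewrite !nth_default ?subrr// ?sq ?st.
Qed.

End moment_functional.

(** * Regularity from a lower bound for mean squares *)

Section regularity.
Context {R : realType} (gamma : nat -> R).
Hypothesis hgamma : forall s : nat, (1 <= s)%N -> 0 < gamma s <= 32^-1.
Variable V : R.
Hypothesis hVsup : forall e : R, 0 < e -> exists s, V - e < partial_robin gamma s.+1.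
Variable mu : {finite_measure set (plane R) -> \bar R}.
Hypothesis mu0 : mu (~` K gamma) = 0%E.
Variable A : R.
Hypothesis A0 : 0 < A.
Local Notation X := (cantor_coord gamma).
Hypothesis mean_square : forall (q : {poly R}) n, q \is monic -> size q = n.+1 ->
  ((A * expR (- (2 * n%:R * V)))%:E <= \int[mu]_z ((q.[X z]) ^+ 2)%:E)%E.
Hypothesis energyE : min_energy (Defs.support mu) = V%:E.
Implicit Types p q : {poly R}.

Local Notation mom := (moment mu X).

Let mX : measurable_fun setT X. Proof. exact: measurable_cantor_coord. Qed.
Let hX z : 0 <= X z <= 1.
Proof. by apply: (cantor_set_itv hgamma); exact: cantor_coord_in. Qed.

Let mean_square_moment q n : q \is monic -> size q = n.+1 ->
  A * expR (- (2 * n%:R * V)) <= mom (q * q).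
Proof.
move=> mq sq; rewrite -lee_fin /moment /Rintegral fineK.
  apply: le_trans (mean_square mq sq) _; rewrite le_eqVlt; apply/orP; left; apply/eqP.
  by apply: eq_integral => z _; rewrite hornerM expr2.
by apply: integrable_fin_num => //; exact: integrable_horner.
Qed.

Let monic_gt0 q : q \is monic -> 0 < mom (q * q).
Proof.
move=> mq; apply: lt_le_trans (mean_square_moment (n := (size q).-1) mq _).
  by rewrite mulr_gt0 ?expR_gt0.
by rewrite prednK// size_poly_gt0 monic_neq0.
Qed.

Let supportK : Defs.support mu `<=` K gamma.
Proof. by apply: support_sub => //; exact: closed_K. Qed.

(** A monic polynomial that vanishes on a finite support would have norm zero,
    against the lower bound. *)
Lemma infinite_support : infinite_set (Defs.support mu).
Proof.
move=> /finite_seqP[s sE]; pose q : {poly R} := \prod_(w <- s) ('X - w.1%:P).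
have mq : q \is monic by exact: monic_prod_XsubC.
have := mean_square mq (size_prod_XsubC _ _).
suff -> : (\int[mu]_z ((q.[X z]) ^+ 2)%:E = \int[mu]_z 0)%E.
  by rewrite integral0 lee_fin leNgt mulr_gt0 ?expR_gt0.
have mS : measurable (~` Defs.support mu : set (plane R)).
  by apply: measurableC; apply: closed_measurable_plane; exact: closed_support.
apply: (eq_integral_null mS (null_compl_support mu)) => z /contrapT Sz.
rewrite cantor_coordE; last exact: supportK.
suff -> : q.[z.1] = 0 by rewrite expr0n.
apply/eqP; rewrite horner_prod prodf_seq_eq0; apply/hasP; exists z.
  by move: Sz; rewrite sE.
by rewrite hornerXsubC subrr eqxx.
Qed.

Lemma test_moment_le s n : mom (test_poly gamma s n * test_poly gamma s n) <=
  mom 1 * expR ((2 ^ s.+1)%:R * partial_robin gamma s.+1 -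
                   n%:R * partial_robin gamma s.+1) ^+ 2.
Proof.
rewrite [leRHS]mulrC -(momentZ mu mX hX); apply: moment_le => // z.
rewrite hornerM hornerZ hornerC mulr1 -expr2 -real_normK ?num_real//.
rewrite lerXn2r ?nnegrE ?expR_ge0//.
exact: (test_poly_le hgamma s n (cantor_coord_in gamma z)).
Qed.

(** The two bounds on the square norms pinch their [2 n]-th roots. *)
Lemma norm_root_cvg (q : nat -> {poly R}) :
  (forall n, [/\ q n \is monic, size (q n) = n.+1 &
      forall p, (size p <= n)%N -> mom (q n * p) = 0]) ->
  ln (mom (q n * q n)) / (2 * n%:R) @[n --> \oo] --> - V.
Proof.
move=> hq; set M := mom 1.
have M0 : 0 < M.
  have : (1 : {poly R}) \is monic by rewrite monic1.
  by move=> /monic_gt0; rewrite mulr1.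
apply/cvgrPdist_le => e e0; have [|s hs] := hVsup (e := e / 2); first by rewrite divr_gt0.
set W := partial_robin gamma s.+1 in hs; set N : R := (2 ^ s.+1)%:R.
have W0 : 0 <= W by exact: partial_robin_ge0.
(* The errors of both bounds, divided by [2 * n], are at most [B / (2 * n)]. *)
pose B := `|ln A| + `|ln M| + 2 * N * W.
exists (Num.truncn (B / e)).+1 => // n /= hn.
have n0 : 0 < n%:R :> R by rewrite ltr0n (leq_trans _ hn).
have hB : B <= n%:R * e.
  rewrite -ler_pdivrMr//; apply: le_trans (ltW (truncnS_gt _)) _.
  by rewrite ler_nat.
have [mq sq oq] := hq n.
have mq0 : 0 < mom (q n * q n) by exact: monic_gt0.
have lo : ln A - 2 * n%:R * V <= ln (mom (q n * q n)).
  rewrite -[leLHS]expRK ler_ln ?posrE ?expR_gt0//.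
  by rewrite expRD lnK ?posrE//; exact: mean_square_moment.
have hi : ln (mom (q n * q n)) <= ln M + 2 * (N * W - n%:R * W).
  rewrite -[leRHS]expRK ler_ln ?posrE ?expR_gt0// expRD lnK ?posrE// (expRM_natl 2).
  have [mt st] := test_poly_monic_size gamma s n.
  apply: le_trans (monic_orthogonal_min mX hX mq sq oq mt st) _.
  exact: test_moment_le.
have [a1 a2] : - `|ln A| <= ln A /\ ln M <= `|ln M|.
  by split; rewrite ?ler_norm// lerNl -normrN ler_norm.
have n2 : 0 < 2 * n%:R :> R by rewrite mulr_gt0.
rewrite ler_norml; apply/andP; split.
  rewrite lerBrDl -lerBrDr ler_pdivrMr//; apply: le_trans hi _.
  move: (n%:R) n0 hB hs => x x0; rewrite /B => hB hs; have := normr_ge0 (ln A).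
  have : 0 <= x * (W - (V - e / 2)) by rewrite mulr_ge0 ?subr_ge0 ?(ltW hs)// ltW.
  by nra.
rewrite lerBlDr -lerBlDl ler_pdivlMr//; apply: le_trans lo.
move: (n%:R) n0 hB => x x0; rewrite /B => hB; have := normr_ge0 (ln M).
have : 0 <= N * W by rewrite mulr_ge0.
by nra.
Qed.

(** The measure lives on the real axis, where real polynomials are real. *)
Lemma inner_prod_real p q :
  inner_prod mu (map_poly (real_complex R) p) (map_poly (real_complex R) q) =
  (mom (p * q))%:C%C.
Proof.
have mK := measurableC (@measurable_K R gamma).
have E z : K gamma z ->
    (map_poly (real_complex R) p).[toC z] * conjc (map_poly (real_complex R) q).[toC z] =
    ((p * q).[X z])%:C%C.
  move=> Kz; have -> : toC z = (X z)%:C%C.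
    by rewrite cantor_coordE//; case: z Kz => x y [_ /= ->].
  have hm r : (map_poly (real_complex R) r).[(X z)%:C%C] = (r.[X z])%:C%C.
    exact: (horner_map (real_complex R)).
  by rewrite !hm conjc_real -(rmorphM (real_complex R)) hornerM.
rewrite /inner_prod; congr Complex.
  rewrite /moment /Rintegral; congr fine.
  by apply: (eq_integral_null mK mu0) => z /contrapT /E ->.
rewrite /Rintegral (eq_integral_null (g := cst 0%E) mK mu0) ?integral0//.
by move=> z /contrapT /E ->.
Qed.

(** The orthonormal polynomials are the real monic orthogonal ones divided by their
    norms, which gives the leading coefficients. *)
Theorem regular_of_mean_square : stahl_totik_regular mu.
Proof.
have [q hq] := monic_orthogonal mX hX monic_gt0.
have q_gt0 n : 0 < mom (q n * q n) by apply: monic_gt0; have [] := hq n.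
pose c n := (Num.sqrt (mom (q n * q n)))^-1.
have c_gt0 n : 0 < c n by rewrite invr_gt0 sqrtr_gt0.
have leadE n : lead_coef (map_poly (real_complex R) (c n *: q n)) = (c n)%:C%C.
  have [mq _ _] := hq n.
  by rewrite lead_coef_map lead_coefZ (monicP mq) mulr1.
split; first exact: (compactly_supported_K hgamma mu0).1.1.
  exact: infinite_support.
exists (fun n => map_poly (real_complex R) (c n *: q n)).
  split=> [n|n|m n].
  - have [_ sq _] := hq n.
    by rewrite size_map_poly size_scale ?gt_eqF.
  - by rewrite leadE ltcR.
  rewrite inner_prod_real -scalerAl -scalerAr !momentZ//.
  have [<-|mn] := eqVneq m n.
    rewrite mulrA -[c m * c m]expr2 /c exprVn sqr_sqrtr ?(ltW (q_gt0 _))//.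
    by rewrite mulVf ?gt_eqF.
  suff -> : mom (q m * q n) = 0 by rewrite !mulr0.
  have [[_ sm om] [_ sn on]] := (hq m, hq n).
  move: mn; rewrite neq_ltn => /orP[mn|mn]; first by rewrite mulrC on ?sm.
  by rewrite om ?sn.
rewrite /capacity energyE /=.
apply: (cvg_trans _ (continuous_cvg _ (@continuous_expR R (- V)) (norm_root_cvg hq))).
apply: near_eq_cvg; near=> n.
rewrite leadE /= /powR gt_eqF//; congr expR.
rewrite /c lnV ?posrE ?sqrtr_gt0// -powR12_sqrt ?(ltW (q_gt0 n))// ln_powR invfM.
by ring.
Unshelve. all: by end_near. Qed.

End regularity.

(** * The two measures *)

Section cantor_hausdorff.
Context {R : realType} (gamma : nat -> R).
Hypothesis hgamma : forall s : nat, (1 <= s)%N -> 0 < gamma s <= 32^-1.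
Hypothesis hsum : (\sum_(1 <= s <oo) (gamma s)%:E < +oo)%E.

Definition cantor_hausdorff (A : set (plane R)) : \bar R :=
  hausdorff (dim_fun gamma) (A `&` K gamma).

(** The Hausdorff measure on K(gamma) is carried by the real axis, where additivity
    is known. *)
Lemma cantor_hausdorffE A : cantor_hausdorff A =
  hausdorff_on (dim_fun gamma) (cantor_set gamma) (line_point @^-1` A).
Proof.
congr hausdorff; apply/seteqP; split.
  by move=> [x y] [Axy [/= Cx y0]]; exists x; rewrite /line_point ?y0//; split; rewrite // /line_point/= -y0.
by move=> _ [x [Ax Cx] <-].
Qed.

Let cantor_hausdorff0 : cantor_hausdorff set0 = 0%E.
Proof.
by rewrite /cantor_hausdorff set0I hausdorff_set0//; [exact: dim_fun0|exact: dim_fun_ge0].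
Qed.

Let cantor_hausdorff_ge0 A : (0 <= cantor_hausdorff A)%E.
Proof. by apply: hausdorff_ge0; exact: dim_fun_ge0. Qed.

Let cantor_hausdorff_sigma_additive : semi_sigma_additive cantor_hausdorff.
Proof.
have mline : measurable_fun setT (line_point : measurableTypeR R -> plane R).
  exact: measurable_fun_pair.
have mpre (A : set (plane R)) : measurable A -> measurable (line_point @^-1` A : set R).
  by move=> mA; rewrite -[_ @^-1` _]setTI; exact: mline.
move=> F mF tF mUF; rewrite cantor_hausdorffE preimage_bigcup.
rewrite (_ : (fun n => _) = (fun n => \sum_(0 <= i < n) hausdorff_on (dim_fun gamma)
  (cantor_set gamma) (line_point @^-1` F i))%E); last first.
  by apply/funext => n; apply: eq_bigr => i _; rewrite cantor_hausdorffE.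
apply: hausdorff_on_sigma_additive.
- exact: dim_fun0.
- exact: dim_fun_ge0.
- exact: cantor_set_closed.
- by move=> x y xy; exact: cantor_set_gap.
- by move=> n; exact: mpre.
- apply/trivIsetP => i j _ _ ij; rewrite -preimage_setI.
  by move/trivIsetP: tF => ->//; rewrite preimage_set0.
- by rewrite -preimage_bigcup; exact: mpre.
Qed.

HB.instance Definition _ := isMeasure.Build _ _ _ cantor_hausdorff
  cantor_hausdorff0 cantor_hausdorff_ge0 cantor_hausdorff_sigma_additive.

Let cantor_hausdorff_fin : fin_num_fun cantor_hausdorff.
Proof.
apply: lty_fin_num_fun; change (cantor_hausdorff setT < +oo)%E; rewrite cantor_hausdorffE.
apply: le_lt_trans (hausdorff_cantor_lty hgamma hsum).
by apply: le_hausdorff; apply: image_subset => x [].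
Qed.

HB.instance Definition _ := Measure_isFinite.Build _ _ _ cantor_hausdorff
  cantor_hausdorff_fin.

Definition cantor_hausdorff_measure : {finite_measure set (plane R) -> \bar R} :=
  cantor_hausdorff.

Lemma code_measure_le (A : set (plane R)) : measurable A ->
  (code_measure hgamma A <= 2%:E * cantor_hausdorff A)%E.
Proof.
have mline : measurable_fun setT (line_point : measurableTypeR R -> plane R).
  exact: measurable_fun_pair.
move=> mA; rewrite cantor_hausdorffE; apply: code_le_hausdorff => //.
by rewrite -[_ @^-1` _]setTI; exact: mline.
Qed.

End cantor_hausdorff.

Section equilibrium.
Context {R : realType} (gamma : nat -> R).
Hypothesis hgamma : forall s : nat, (1 <= s)%N -> 0 < gamma s <= 32^-1.
Variable V : R.
Hypothesis hV : forall n, partial_robin gamma n <= V.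
Hypothesis hVsup : forall e : R, 0 < e -> exists s, V - e < partial_robin gamma s.+1.

Lemma min_energy_K : min_energy (K gamma) = V%:E.
Proof.
apply: (min_energy_eq hgamma (P := code_measure hgamma) hVsup) => //.
  split; first exact: (compactly_supported_K hgamma (code_measure_compl hgamma)).1.1.
  exact: (compactly_supported_K hgamma (code_measure_compl hgamma)).2.
exact: code_energy_le.
Qed.

(** The energy of the equilibrium measure is the Robin constant, so it is minimal
    also among the measures with a density with respect to it: this is the
    hypothesis of Frostman's theorem. *)
Lemma equilibrium_regular (mu : probability (plane R) R) :
  is_equilibrium_measure (K gamma) mu -> stahl_totik_regular mu.
Proof.
move=> [hmu hE]; have mu0 : mu (~` K gamma) = 0%E by exact: carried_by_K hmu.
have EV : log_energy mu = V%:E by rewrite hE min_energy_K.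
have mX := measurable_cantor_coord gamma.
have hX z : 0 <= cantor_coord gamma z <= 1.
  by apply: (cantor_set_itv hgamma); exact: cantor_coord_in.
have pot y : (\int[mu]_w logker y (cantor_coord gamma w) <= V%:E)%E.
  apply: (frostman_potential_le mX hX).
    by rewrite -EV (log_energyE hgamma mu0).
  by move=> f mf f0 f1; exact: weighted_energy_ge.
apply: (regular_of_mean_square hgamma hVsup mu0 ltr01).
  by move=> q n mq sq; rewrite mul1r; exact: mean_square_ge.
have [sc sK] := compactly_supported_K hgamma mu0.
by apply: (min_energy_eq hgamma (P := mu) hVsup) => //; rewrite EV.
Qed.

(** Being at least half of [code_measure], the Hausdorff measure satisfies the same
    lower bound for mean squares up to the factor [1 / 2], and its support carries
    [code_measure], which has minimal energy. *)
Lemma cantor_hausdorff_regular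
  (hsum : (\sum_(1 <= s <oo) (gamma s)%:E < +oo)%E) : stahl_totik_regular (cantor_hausdorff_measure hgamma hsum).
Proof.
have L0 : (cantor_hausdorff_measure hgamma hsum) (~` K gamma) = 0%E.
  rewrite /(cantor_hausdorff_measure hgamma hsum) /= /cantor_hausdorff setICl hausdorff_set0//; [exact: dim_fun0|exact: dim_fun_ge0].
have mX := measurable_cantor_coord gamma.
have hX z : 0 <= cantor_coord gamma z <= 1.
  by apply: (cantor_set_itv hgamma); exact: cantor_coord_in.
have half0 : 0 < 2^-1 :> R by [].
apply: (regular_of_mean_square hgamma hVsup L0 half0).
  move=> q n mq sq.
  have mq2 : measurable_fun setT (fun z => ((q.[cantor_coord gamma z]) ^+ 2)%:E).
    apply/measurable_EFinP; apply: measurable_funX.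
    exact: measurable_horner_comp.
  have q2_ge0 z : (0 <= ((q.[cantor_coord gamma z]) ^+ 2)%:E)%E.
    by rewrite lee_fin sqr_ge0.
  have := mean_square_ge mX hX (V := V) (P := code_measure hgamma)
    (fun y => code_measure_potential_le hgamma hV) mq sq.
  rewrite EFinM muleC -lee_pdivlMr// invrK muleC => /le_trans; apply.
  have <- := @ge0_integral_mscale _ _ R (cantor_hausdorff_measure hgamma hsum)
    setT measurableT 2%:nng _ mq2 (fun x _ => q2_ge0 x).
  by apply: ge0_le_measure_integral => // A mA; exact: code_measure_le.
have [_ sK] := compactly_supported_K hgamma L0.
have [[sc _] _] := compactly_supported_K hgamma (code_measure_compl hgamma).
apply: (min_energy_eq hgamma (P := code_measure hgamma) hVsup) => //; last exact: code_energy_le.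
split => // z hz U oU Uz; rewrite ltNge; apply/negP => U0.
have := hz U oU Uz; rewrite ltNge => /negP; apply.
apply: le_trans (code_measure_le hgamma (open_measurable_plane oU)) _.
by apply: mule_ge0_le0.
Qed.

End equilibrium.
Theorem theorem4p2 (R : realType) (gamma : nat -> R)
    (hgamma : forall s : nat, (1 <= s)%N -> 0 < gamma s <= 32^-1)
    (hsum : (\sum_(1 <= s <oo) (gamma s)%:E < +oo)%E)
    (hK : non_polar (K gamma)) :
  (forall mu : probability (plane R) R,
     is_equilibrium_measure (K gamma) mu -> stahl_totik_regular mu) /\
  (exists Lambda : {finite_measure set (plane R) -> \bar R},
     (forall A : set (plane R), measurable A ->
        Lambda A = hausdorff (dim_fun gamma) (A `&` K gamma)) /\
     stahl_totik_regular Lambda).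
Proof.
have [V hV hVsup] := non_polar_robin hgamma hK; split.
  by move=> mu; exact: equilibrium_regular.
exists (cantor_hausdorff_measure hgamma hsum); split => //.
exact: (cantor_hausdorff_regular hgamma hV hVsup).
Qed.
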